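(* Let $a\in\{1,2,4,8\}$. The variety of reductions $Y_a$ is a linear section of the Grassmannian $G(2,\mathcal J_3(\mathbb A)_0)\subset\mathbb P(\wedge^2\mathcal J_3(\mathbb A)_0)$, namely $$Y_a=G(2,\mathcal J_3(\mathbb A)_0)\cap\mathbb P(U_a).$$ For $a>1$ this linear section is non-transverse, and it does not even have the expected dimension, i.e. $\dim Y_a\neq \dim G(2,\mathcal J_3(\mathbb A)_0)-\operatorname{codim}(U_a,\wedge^2\mathcal J_3(\mathbb A)_0)$.
   Context: For $a=1,2,4,8$, $\mathbb A$ is the complexification of $\mathbf R,\mathbf C,\mathbf H,\mathbf O$ respectively: a complex composition algebra of dimension $a$ with conjugation $x\mapsto\bar x$ and quadratic form $q$, $x\bar x=q(x)1$. $\mathcal J_3(\mathbb A)$ is the complex vector space (dimension $3a+3$) of $3\times3$ $\mathbb A$-Hermitian matrices (diagonal entries in $\mathbf C$, off-diagonal entries in $\mathbb A$), a Jordan algebra for $A\circ B=\frac12(AB+BA)$. $\mathcal J_3(\mathbb A)_0$ is the subspace of traceless matrices (dimension $3a+2$), $Q(X)=\operatorname{trace}(X^2)$, and $Q(X,Y)$ is the associated symmetric bilinear form. The Severi variety is $X_a=\{[X]: X^2=\operatorname{trace}(X)X\}\subset\mathbb P\mathcal J_3(\mathbb A)$, smooth of dimension $2a$. $I$ is the identity matrix. $G(2,V)$ is the Grassmannian of $2$-dimensional subspaces of $V$ (lines in $\mathbb P(V)$), in its Plücker embedding. A plane in $\mathbb P\mathcal J_3(\mathbb A)$ is simply $3$-secant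 to $X_a$ if it meets $X_a$ in exactly three points, each a simple contact. Projection from $[I]$, $X\mapsto X-\frac13\operatorname{trace}(X)I$, sends each plane through $[I]$ to a line in $\mathbb P\mathcal J_3(\mathbb A)_0$. The variety of reductions $Y_a\subset G(2,\mathcal J_3(\mathbb A)_0)$ is the Zariski closure of the set of lines that are images of planes through $[I]$ which are simply $3$-secant to $X_a$. Let $\mathfrak{so}_3(\mathbb A)=\operatorname{Der}(\mathcal J_3(\mathbb A))$ (equal to $\mathfrak{sl}_2,\mathfrak{sl}_3,\mathfrak{sp}_6,\mathfrak f_4$ for $a=1,2,4,8$). $U_a\subset\wedge^2\mathcal J_3(\mathbb A)_0$ is the kernel of the linear map $\wedge^2\mathcal J_3(\mathbb A)_0\to\mathfrak{so}_3(\mathbb A)^*$ sending $X\wedge Y$ to the linear form $u\mapsto Q(X,uY)$; it is the $\mathfrak{so}_3(\mathbb A)$-stable complement to the copy of $\mathfrak{so}_3(\mathbb A)$ in $\wedge^2\mathcal J_3(\mathbb A)_0$. *)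

(* Defs.v *)
From HB Require Import structures.
From mathcomp Require Import all_boot all_order all_algebra.
From mathcomp Require Import mpoly.

Set Implicit Arguments.
Unset Strict Implicit.
Unset Printing Implicit Defensive.

Import GRing.Theory.
Local Open Scope ring_scope.

(* Points of P(E) are the lines l : {vspace E}, \dim l = 1; a set of points
   is a predicate on {vspace E}.  Homogeneous coordinates on P(E) are taken
   in the basis [vbasis {:E}]; none of the notions below depends on it. *)
Section ProjectiveGeometry.
Variables (K : fieldType) (E : vectType K).
Implicit Types (Z C : {vspace E} -> Prop) (l : {vspace E}) (U : {vspace E}).

Notation poly_on := {mpoly K[\dim {:E}]}.

Definition coords (v : E) : 'I_(\dim {:E}) -> K :=
  fun i => coord (vbasis {:E}) i v.

Definition homogeneous (f : poly_on) : Prop := exists d : nat, f \is d.-homog.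

Definition vanishes_at (f : poly_on) l : Prop :=
  forall v, v \in l -> f.@[coords v] = 0.

Definition zclosed C : Prop :=
  exists F : poly_on -> Prop,
    (forall f, F f -> homogeneous f) /\
    (forall l, C l <-> \dim l = 1%N /\ (forall f, F f -> vanishes_at f l)).

Definition zclosure Z : {vspace E} -> Prop := fun l =>
  forall C, zclosed C -> (forall m, Z m -> C m) -> C l.

Definition zirreducible C : Prop :=
  (exists l, C l) /\
  (forall A B, zclosed A -> zclosed B -> (forall l, C l -> A l \/ B l) ->
     (forall l, C l -> A l) \/ (forall l, C l -> B l)).

(* Chains C 0 < C 1 < ... < C d of irreducible closed subsets of Z. *)
Definition zchain Z (d : nat) : Prop :=
  exists C : nat -> {vspace E} -> Prop,
    (forall i, (i <= d)%N ->
       [/\ zclosed (C i), zirreducible (C i) & forall l, C i l -> Z l]) /\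
    (forall i, (i < d)%N ->
       (forall l, C i l -> C i.+1 l) /\ (exists l, C i.+1 l /\ ~ C i l)).

(* Krull dimension of a closed subset Z of P(E). *)
Definition has_dim Z (d : nat) : Prop :=
  zchain Z d /\ (forall e, zchain Z e -> (e <= d)%N).

Definition in_lin U : {vspace E} -> Prop := fun l =>
  \dim l = 1%N /\ (l <= U)%VS.

(* Zariski tangent space, at the point l, of the affine cone over Z. *)
Definition tangent Z l (v : E) : Prop :=
  forall f : poly_on, homogeneous f -> (forall m, Z m -> vanishes_at f m) ->
  forall p, p \in l -> \sum_i (f^`M(i)).@[coords p] * coords v i = 0.

Definition transverse Z U : Prop :=
  forall l, Z l -> in_lin U l ->
  forall w : E, exists t u, [/\ tangent Z l t, u \in U & w = t + u].

(* The plane P(P) meets Z in exactly three points, at each of which the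
   tangent spaces of Z and of the plane have only that point in common. *)
Definition simply_3secant Z (P : {vspace E}) : Prop :=
  \dim P = 3%N /\
  exists s : seq {vspace E},
    [/\ uniq s, size s = 3%N,
        forall l, l \in s <-> Z l /\ in_lin P l
      & forall l, l \in s -> forall v, v \in P -> tangent Z l v -> v \in l].

End ProjectiveGeometry.

(* The exterior square of V, in the basis e_i /\ e_j (i < j) attached to the
   basis e = vbasis V. *)
Section ExteriorSquare.
Variables (K : fieldType) (E : vectType K) (V : {vspace E}).

Definition ext2 : vectType K :=
  {ffun {p : 'I_(\dim V) * 'I_(\dim V) | (p.1 < p.2)%N} -> K^o}.

(* For x and y in V. *)
Definition wedge (x y : E) : ext2 :=
  [ffun p => let x_ i := coord (vbasis V) i x in
             let y_ i := coord (vbasis V) i y in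
             x_ (val p).1 * y_ (val p).2 - x_ (val p).2 * y_ (val p).1].

(* For L of dimension 2 in V. *)
Definition plucker (L : {vspace E}) : {vspace ext2} :=
  <[wedge (vbasis L)`_0 (vbasis L)`_1]>%VS.

Definition grass2 : {vspace ext2} -> Prop := fun l =>
  exists L : {vspace E}, [/\ (L <= V)%VS, \dim L = 2%N & l = plucker L].

End ExteriorSquare.

Arguments grass2 {K E} V _.

(* Cayley-Dickson algebras over K.  Over the real numbers, n = 0, 1, 2, 3
   gives R, C, H, O; the structure constants are integers, so over R[i] the
   same formulas give the complexifications, of dimension a = 2 ^ n, with
   C-linear conjugation. *)
Section CayleyDickson.
Variable K : fieldType.

Fixpoint cd (n : nat) : vectType K :=
  if n is m.+1 then (cd m * cd m)%type else K^o.

Fixpoint cdone (n : nat) : cd n :=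
  match n return cd n with
  | 0 => (1 : K)
  | m.+1 => (cdone m, 0)
  end.

Fixpoint cdconj (n : nat) : cd n -> cd n :=
  match n return cd n -> cd n with
  | 0 => fun x => x
  | m.+1 => fun x => (cdconj x.1, - x.2)
  end.

Fixpoint cdmul (n : nat) : cd n -> cd n -> cd n :=
  match n return cd n -> cd n -> cd n with
  | 0 => fun x y => (x : K) * (y : K)
  | m.+1 => fun x y =>
      (cdmul x.1 y.1 - cdmul (cdconj y.2) x.2,
       cdmul y.2 x.1 + cdmul x.2 (cdconj y.1))
  end.

(* The coefficient on 1; it sends c * 1 to c. *)
Fixpoint cdre (n : nat) : cd n -> K :=
  match n return cd n -> K with
  | 0 => fun x => x
  | m.+1 => fun x => cdre x.1
  end.

Lemma cdconj_is_linear n : linear (@cdconj n).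
Proof.
elim: n => [|m IH] c x y //=.
by apply: injective_projections => /=; rewrite ?IH ?opprD -?scalerN.
Qed.

HB.instance Definition _ n :=
  GRing.isLinear.Build K (cd n) (cd n) *:%R (@cdconj n) (@cdconj_is_linear n).

Lemma cdre_is_linear n : linear_for *%R (@cdre n).
Proof. by elim: n => [|m IH] c x y //=; rewrite IH. Qed.

HB.instance Definition _ n :=
  GRing.isLinear.Build K (cd n) K *%R (@cdre n) (@cdre_is_linear n).

Lemma cdconj1 n : cdconj (cdone n) = cdone n.
Proof. by elim: n => [|m IH] //=; rewrite IH oppr0. Qed.

Lemma cdconjK n : involutive (@cdconj n).
Proof.
by elim: n => [|m IH] x //=; apply: injective_projections; rewrite /= ?IH ?opprK.
Qed.

Lemma cdmul_linear n c (x x' y : cd n) :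
  cdmul (c *: x + x') y = c *: cdmul x y + cdmul x' y /\
  cdmul y (c *: x + x') = c *: cdmul y x + cdmul y x'.
Proof.
elim: n c x x' y => [|m IH] c x x' y /=.
  split; rewrite ?mulrDl ?mulrDr; congr (_ + _).
    exact/esym/mulrA.
  exact: mulrCA.
have IHl := fun c x x' y => (IH c x x' y).1.
have IHr := fun c x x' y => (IH c x x' y).2.
split; apply: injective_projections => /=;
  rewrite ?linearP /= ?IHl ?IHr ?scalerBr ?scalerDr ?opprD -!addrA;
  by congr (_ + _); rewrite addrCA.
Qed.

Lemma cdmulPl n c (x x' y : cd n) :
  cdmul (c *: x + x') y = c *: cdmul x y + cdmul x' y.
Proof. by case: (cdmul_linear c x x' y). Qed.

Lemma cdmulPr n c (x x' y : cd n) :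
  cdmul y (c *: x + x') = c *: cdmul y x + cdmul y x'.
Proof. by case: (cdmul_linear c x x' y). Qed.

Lemma cdconjM n (x y : cd n) :
  cdconj (cdmul x y) = cdmul (cdconj y) (cdconj x).
Proof.
have mulN m (u v : cd m) :
    cdmul (- u) v = - cdmul u v /\ cdmul u (- v) = - cdmul u v.
  have mul0 : cdmul 0 v = 0 /\ cdmul u 0 = 0.
    have := cdmulPl (-1) 0 0 v; have := cdmulPr (-1) 0 0 u.
    by rewrite !scaleN1r !oppr0 !addr0 !addNr.
  have := cdmulPl (-1) u 0 v; have := cdmulPr (-1) v 0 u.
  by rewrite !scaleN1r mul0.1 mul0.2 !addr0.
elim: n x y => [|m IH] x y /=; first by rewrite [LHS]mulrC.
apply: injective_projections => /=.
  by rewrite raddfB /= !IH cdconjK raddfN (mulN _ _ _).1 (mulN _ _ _).2 opprK.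
by rewrite !cdconjK opprD !(mulN _ _ _).1 addrC.
Qed.

End CayleyDickson.

(* J_3(A) as a space of matrices M(i, j) with entries in A = cd K n, written
   as functions of (i, j).  A diagonal entry of a Hermitian matrix is equal to
   its conjugate, hence is a scalar multiple of 1 when 2 is invertible. *)
Section JordanAlgebra.
Variables (K : fieldType) (n : nat).

Definition mat3 : vectType K := {ffun 'I_3 * 'I_3 -> cd K n}.

Definition mat3mul (M N : mat3) : mat3 :=
  [ffun p => \sum_k cdmul (M (p.1, k)) (N (k, p.2))].

Definition conjT (M : mat3) : mat3 := [ffun p => cdconj (M (p.2, p.1))].

Lemma conjT_is_linear : linear conjT.
Proof. by move=> c M N; apply/ffunP => p; rewrite !ffunE linearP. Qed.

HB.instance Definition _ :=
  GRing.isLinear.Build K mat3 mat3 *:%R conjT conjT_is_linear.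

Definition herm3 : {vspace mat3} := lker (linfun conjT - \1)%VF.

Lemma herm3P M : reflect (conjT M = M) (M \in herm3).
Proof.
rewrite memv_ker add_lfunE opp_lfunE id_lfunE lfunE /= subr_eq0.
exact: eqP.
Qed.

Definition J3 : vectType K := subvs_of herm3.

Lemma conjT_mul (M N : mat3) :
  conjT (mat3mul M N) = mat3mul (conjT N) (conjT M).
Proof.
apply/ffunP => p; rewrite !ffunE raddf_sum; apply: eq_bigr => k _.
by rewrite !ffunE /= cdconjM.
Qed.

Lemma jmul_herm (X Y : J3) :
  2^-1 *: (mat3mul (vsval X) (vsval Y) + mat3mul (vsval Y) (vsval X))
    \in herm3.
Proof.
apply/herm3P; rewrite linearZ /= raddfD /= !conjT_mul addrC.
by rewrite (herm3P _ (subvsP X)) (herm3P _ (subvsP Y)).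
Qed.

Definition jmul (X Y : J3) : J3 := Subvs (jmul_herm X Y).

Lemma jone_herm : [ffun p => if p.1 == p.2 then cdone K n else 0] \in herm3.
Proof.
apply/herm3P/ffunP => p; rewrite !ffunE eq_sym.
by case: eqP => _; rewrite ?cdconj1 ?raddf0.
Qed.

Definition jone : J3 := Subvs jone_herm.

Definition jtrace (X : J3) : K := \sum_i cdre (vsval X (i, i)).

Lemma jtrace_is_linear : linear_for *%R jtrace.
Proof.
move=> c X Y; rewrite /jtrace mulr_sumr -big_split; apply: eq_bigr => i _.
by rewrite !ffunE /= linearP.
Qed.

HB.instance Definition _ :=
  GRing.isLinear.Build K J3 K *%R jtrace jtrace_is_linear.

(* The polar form of Q(X) = trace(X^2). *)
Definition jQ (X Y : J3) : K := jtrace (jmul X Y).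

Definition J30 : {vspace J3} := lker (linfun (jtrace : J3 -> K^o)).

Lemma J30P X : reflect (jtrace X = 0) (X \in J30).
Proof. by rewrite memv_ker lfunE; apply: eqP. Qed.

(* The matrix square of X is its Jordan square jmul X X. *)
Definition severi : {vspace J3} -> Prop := fun l =>
  \dim l = 1%N /\ forall X, X \in l -> jmul X X = jtrace X *: X.

Definition proj_one (X : J3) : J3 := X - (jtrace X / 3) *: jone.

Lemma proj_one_is_linear : linear proj_one.
Proof.
move=> c X Y; rewrite /proj_one linearP mulrDl scalerDl -mulrA -scalerA.
by rewrite scalerBr opprD addrACA.
Qed.

HB.instance Definition _ :=
  GRing.isLinear.Build K J3 J3 *:%R proj_one proj_one_is_linear.

(* Y_a, as a subset of P(ext2 J30) by the Pluecker embedding. *)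
Definition reductions : {vspace ext2 J30} -> Prop :=
  zclosure (fun l => exists P : {vspace J3},
    [/\ simply_3secant severi P, jone \in P
      & l = plucker J30 (linfun proj_one @: P)]).

Lemma mat3mulPl c (M M' N : mat3) :
  mat3mul (c *: M + M') N = c *: mat3mul M N + mat3mul M' N.
Proof.
apply/ffunP => p; rewrite !ffunE scaler_sumr -big_split.
by apply: eq_bigr => k _; rewrite !ffunE cdmulPl.
Qed.

Lemma mat3mulPr c (M M' N : mat3) :
  mat3mul N (c *: M + M') = c *: mat3mul N M + mat3mul N M'.
Proof.
apply/ffunP => p; rewrite !ffunE scaler_sumr -big_split.
by apply: eq_bigr => k _; rewrite !ffunE cdmulPr.
Qed.

Lemma jmulC X Y : jmul X Y = jmul Y X.
Proof. by apply: val_inj; rewrite /= addrC. Qed.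

Lemma jmulPl c (X X' Y : J3) :
  jmul (c *: X + X') Y = c *: jmul X Y + jmul X' Y.
Proof.
apply: val_inj; rewrite [RHS](linearP (@vsval _ _ herm3)) /=.
rewrite mat3mulPl mat3mulPr addrACA.
by rewrite -scalerDr [LHS]scalerDr !scalerA mulrC.
Qed.

Lemma jmulPr c (X X' Y : J3) :
  jmul Y (c *: X + X') = c *: jmul Y X + jmul Y X'.
Proof. by rewrite jmulC jmulPl !(jmulC Y). Qed.

(* so_3(A) = Der(J_3(A)), cut out by the Leibniz rule on a basis. *)
Definition leibniz_defect (X Y : J3) (u : 'End(J3)) : J3 :=
  u (jmul X Y) - (jmul (u X) Y + jmul X (u Y)).

Definition so3 : {vspace 'End(J3)} :=
  (\bigcap_(p : 'I_(\dim {:J3}) * 'I_(\dim {:J3}))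
     lker (linfun (leibniz_defect (vbasis {:J3})`_p.1 (vbasis {:J3})`_p.2)))%VS.

Lemma leibniz_defect_is_linear X Y : linear (leibniz_defect X Y).
Proof.
move=> c u v; rewrite /leibniz_defect !add_lfunE !scale_lfunE jmulPl jmulPr.
by rewrite addrACA -scalerDr opprD addrACA -scalerBr.
Qed.

HB.instance Definition _ X Y := GRing.isLinear.Build K 'End(J3) J3 *:%R
  (leibniz_defect X Y) (leibniz_defect_is_linear X Y).

Lemma so3P (u : 'End(J3)) :
  u \in so3 <-> forall X Y, u (jmul X Y) = jmul (u X) Y + jmul X (u Y).
Proof.
split=> [us X Y | ud]; last first.
  rewrite memvE; apply/subv_bigcapP => p _.
  by rewrite -memvE memv_ker lfunE /= /leibniz_defect ud subrr.
apply/subr0_eq; rewrite -/(leibniz_defect X Y u).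
have ld0r X' : leibniz_defect X' 0 u = 0.
  have jmul0 Z : jmul Z 0 = 0.
    by have := jmulPr (-1) 0 0 Z; rewrite !scaleN1r oppr0 !addr0 addNr.
  by rewrite /leibniz_defect linear0 !jmul0 linear0 addr0 subr0.
have ldr X' c Z Z' : leibniz_defect X' (c *: Z + Z') u =
    c *: leibniz_defect X' Z u + leibniz_defect X' Z' u.
  rewrite /leibniz_defect linearP !jmulPr linearP addrACA -scalerDr opprD.
  by rewrite addrACA -scalerBr.
have ldC Z Z' : leibniz_defect Z Z' u = leibniz_defect Z' Z u.
  rewrite /leibniz_defect (jmulC Z Z') (jmulC (u Z)) (jmulC Z).
  by rewrite [X in _ - X]addrC.
have ld_span X' : (forall i : 'I_(\dim {:J3}),
    leibniz_defect X' (vbasis {:J3})`_i u = 0) ->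
    forall Z, leibniz_defect X' Z u = 0.
  move=> ld0 Z; rewrite (coord_vbasis (memvf Z)).
  elim/big_rec: _ => [|i Z' _ IH]; first exact: ld0r.
  by rewrite ldr ld0 IH scaler0 addr0.
apply: (ld_span X _ Y) => i; rewrite ldC; apply: (ld_span _ _ X) => j.
move/subv_bigcapP: us => /(_ (i, j) isT); rewrite -memvE memv_ker lfunE.
by move/eqP.
Qed.

(* The linear map ext2 J30 -> so_3(A)^*, X /\ Y |-> (u |-> Q(X, u Y)), given
   by its values on the basis e_i /\ e_j: as trace (u Z) = 0 for every
   derivation u and every Z, (X, Y) |-> Q(X, u Y) is alternating. *)
Definition so3_map_at (w : ext2 J30) (u : subvs_of so3) : K^o :=
  \sum_p w p * jQ (vbasis J30)`_(val p).1 (vsval u (vbasis J30)`_(val p).2).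

Definition so3_form (w : ext2 J30) : 'Hom(subvs_of so3, K^o) :=
  linfun (so3_map_at w).

Definition so3_map : 'Hom(ext2 J30, 'Hom(subvs_of so3, K^o)) :=
  linfun so3_form.

Definition redU : {vspace ext2 J30} := lker so3_map.

Lemma jQPr c (X Y Y' : J3) : jQ X (c *: Y + Y') = c * jQ X Y + jQ X Y'.
Proof. by rewrite /jQ jmulPr linearP. Qed.

Lemma so3_map_at_is_linear w : linear (so3_map_at w).
Proof.
move=> c u v; rewrite /so3_map_at scaler_sumr -big_split; apply: eq_bigr => p _.
by rewrite linearP /= add_lfunE scale_lfunE jQPr mulrDr mulrCA.
Qed.

HB.instance Definition _ w := GRing.isLinear.Build K (subvs_of so3) K^o *:%R
  (so3_map_at w) (so3_map_at_is_linear w).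

Lemma so3_form_is_linear : linear so3_form.
Proof.
move=> c w w'; apply/lfunP => u; rewrite add_lfunE scale_lfunE !lfunE /=.
rewrite /so3_map_at scaler_sumr -big_split; apply: eq_bigr => p _.
by rewrite !ffunE mulrDl; congr (_ + _); apply/esym/mulrA.
Qed.

HB.instance Definition _ :=
  GRing.isLinear.Build K (ext2 J30) 'Hom(subvs_of so3, K^o) *:%R
    so3_form so3_form_is_linear.

Lemma so3_mapE w u : so3_map w u = so3_map_at w u.
Proof. by rewrite /so3_map lfunE /= /so3_form lfunE. Qed.

End JordanAlgebra.

Arguments severi K n _ : clear implicits.
Arguments reductions K n _ : clear implicits.

(* Main.v *)
(** Write J for J_3(A), T for its trace form and L_x for the multiplication by
    x.  The matrices form a cubic Jordan algebra, and the equality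
    Y_a = G n P(U_a) only uses this.  A simply 3-secant plane through I is
    spanned by three orthogonal idempotents of trace 1, so T(x, u y) = 0 for all
    x, y in it and all derivations u; conversely I, x and x^2 span such a plane
    when x has three distinct eigenvalues.  Hence Y_a is the closure of the set
    of lines spanned by x and the traceless part of x^2.  If x /\ y lies in U_a,
    then L_x and L_y commute, as the inner derivations show, and the
    Cayley-Hamilton identity implies that the line through x and y either is of
    this form or is a first-order limit of such lines.

    For a > 1 consider D = diag(1, 0, -1).  Its image under so_3(A) contains all
    matrices with zero diagonal, and some nonzero derivation u kills D, so
    codim U_a = dim so_3(A) > 3a.  On the other hand dim G <= 6a, and
    dim Y_a >= 3a because of the lines attached to x in D + W, where W runs
    through a flag of matrices with zero diagonal.  Finally x /\ y |-> T(x, u y)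
    vanishes on U_a and on the tangent space of G at D /\ D^2. *)

From HB Require Import structures.
Require Import Defs.
From mathcomp Require Import all_boot all_order all_algebra ring zify.
From mathcomp Require Import mpoly.
From mathcomp Require boolp.
From mathcomp Require Import complex reals.

Set Implicit Arguments.
Unset Strict Implicit.
Unset Printing Implicit Defensive.

Import Order.TTheory GRing.Theory Num.Theory.
Local Open Scope ring_scope.

(** * Cubic Jordan algebras *)

(** The hard inclusion is that of the linear section in Y_a, because neither x nor y need have
    distinct eigenvalues. The cases follow the minimal polynomial of x: three distinct roots, a
    double root, x^3 = 0 with I, x, x^2 independent, or degree at most two. In the first and third
    cases y is a polynomial in x. In degree two only a first-order limit is obtained. For a double
    root the roles are exchanged: x is compared with the powers of y - kx.

    Closures are handled by functions that are polynomial on every line. This class contains all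
    parametrisations in use, needs no coordinates, and two nonzero members have a common point where
    both are nonzero.

    The statement on dimensions needs only inequalities: neither dim Y_a nor dim so_3(A) is
    computed. The matrix D is chosen with distinct eigenvalues, so that derivations move it in all
    off-diagonal directions. The derivation that kills D mixes 1 with an imaginary unit of A, which
    requires a > 1. *)

Section VectorIdentities.
Variables (K : fieldType) (J : vectType K).
Implicit Types u v a b : J.

(** Reduces a vector identity to a scalar one: after a linear form is distributed, each vector atom
    becomes an unknown for [ring]. Linearity is given by plain equations so that it can be used for
    rewriting. *)
Lemma scalar_ext u v :
  (forall f : J -> K,
     [/\ forall a b, f (a + b) = f a + f b, forall a, f (- a) = - f a,
         forall k a, f (k *: a) = k * f a & f 0 = 0] -> f u = f v) -> u = v.
Proof.
move=> h; rewrite (coord_vbasis (memvf u)) (coord_vbasis (memvf v)).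
apply: eq_bigr => i _; congr (_ *: _); apply: (h (coord (vbasis {:J}) i)).
by split=> *; rewrite ?(linearD, linearN, linearZ, linear0).
Qed.

(** Certificates: a goal is proved as a linear combination of known equations, and the scalars
    supplied at each use are the coefficients of the elimination. *)
Lemma lincomb1 c u v a b : u = v -> a - b = c *: (u - v) -> a = b.
Proof. by move=> ->; rewrite subrr scaler0 => /subr0_eq. Qed.

Lemma lincomb2 c u v c' u' v' a b : u = v -> u' = v' ->
  a - b = c *: (u - v) + c' *: (u' - v') -> a = b.
Proof. by move=> -> ->; rewrite !subrr !scaler0 addr0 => /subr0_eq. Qed.

Lemma lincomb3 c u v c' u' v' c2 u2 v2 a b : u = v -> u' = v' -> u2 = v2 ->
  a - b = c *: (u - v) + c' *: (u' - v') + c2 *: (u2 - v2) -> a = b.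
Proof. by move=> -> -> ->; rewrite !subrr !scaler0 !addr0 => /subr0_eq. Qed.

End VectorIdentities.

(* Generalising the atoms first keeps [ring] from trying to convert them into
   one another. *)
Ltac gen_atoms := idtac.
Ltac vprep := let f := fresh "f" in let fD := fresh in let fN := fresh in
  let fZ := fresh in let f0 := fresh in
  apply: scalar_ext => f [fD fN fZ f0];
  rewrite ?(fD, fN, fZ, f0); clear fD fN fZ f0;
  repeat match goal with |- context [f ?u] => generalize (f u); intro end;
  gen_atoms.
Ltac sfield := gen_atoms; field; rewrite //.
Ltac vring := vprep; ring.
Ltac vfield := vprep; field; rewrite //.

Record cubic_jordan (K : numClosedFieldType) (J : vectType K) := CubicJordan {
  cmul : J -> J -> J;
  cone : J;
  ctr : {scalar J};
  cmulC : commutative cmul;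
  cmulPl : forall c x x' y, cmul (c *: x + x') y = c *: cmul x y + cmul x' y;
  cmul1 : forall x, cmul cone x = x;
  ctr1 : ctr cone = 3;
  ctrA : forall x y z, ctr (cmul (cmul x y) z) = ctr (cmul x (cmul y z));
  ctr_nondeg : forall x, (forall y, ctr (cmul x y) = 0) -> x = 0;
  (* The linearisation in [z] of the Cayley-Hamilton identity
     [x^3 - t x^2 + s x - d = 0]. *)
  cayley : forall x z,
    let t := ctr x in let s := (t ^+ 2 - ctr (cmul x x)) / 2 in
    2 *: cmul x (cmul x z) + cmul (cmul x x) z =
      (2 * t) *: cmul x z + ctr z *: cmul x x - s *: z
      + (ctr (cmul x z) - t * ctr z) *: x
      + (ctr (cmul (cmul x x) z) - t * ctr (cmul x z) + s * ctr z) *: cone }.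

Section TraceForm.
Variables (K : numClosedFieldType) (J : vectType K) (A : cubic_jordan J).
Implicit Types x y z u v w a b c : J.
Local Notation "x ** y" := (cmul A x y) (at level 40, left associativity).
Local Notation "'e" := (cone A).
Local Notation tr := (ctr A).

Definition tform x y : K := tr (x ** y).
Local Notation T := tform.

Lemma cmulZD k x x' y : (k *: x + x') ** y = k *: (x ** y) + x' ** y.
Proof. exact: cmulPl. Qed.
Lemma cmul0l y : 0 ** y = 0.
Proof. by have := cmulZD (-1) 0 0 y; rewrite scaler0 addr0 scaleN1r addNr. Qed.
Lemma cmulDl x x' y : (x + x') ** y = x ** y + x' ** y.
Proof. by have := cmulZD 1 x x' y; rewrite !scale1r. Qed.
Lemma cmulZl k x y : (k *: x) ** y = k *: (x ** y).
Proof. by have := cmulZD k x 0 y; rewrite cmul0l !addr0. Qed.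
Lemma cmulNl x y : (- x) ** y = - (x ** y).
Proof. by rewrite -!scaleN1r cmulZl. Qed.
Lemma cmulDr x x' y : y ** (x + x') = y ** x + y ** x'.
Proof. by rewrite !(cmulC _ y) cmulDl. Qed.
Lemma cmulZr k x y : y ** (k *: x) = k *: (y ** x).
Proof. by rewrite !(cmulC _ y) cmulZl. Qed.
Lemma cmulNr x y : y ** (- x) = - (y ** x).
Proof. by rewrite !(cmulC _ y) cmulNl. Qed.
Lemma cmul0r y : y ** 0 = 0.
Proof. by rewrite cmulC cmul0l. Qed.
Lemma cmul1l x : 'e ** x = x.
Proof. exact: cmul1. Qed.
Lemma cmul1r x : x ** 'e = x.
Proof. by rewrite cmulC cmul1. Qed.
Definition mulE := (cmulDl, cmulDr, cmulNl, cmulNr, cmulZl, cmulZr, cmul1l, cmul1r, cmul0l, cmul0r).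

Lemma TC x y : T x y = T y x.
Proof. by rewrite /T cmulC. Qed.
Lemma TA x y z : T (x ** y) z = T x (y ** z).
Proof. exact: ctrA. Qed.
Lemma TDl x x' y : T (x + x') y = T x y + T x' y.
Proof. by rewrite /T cmulDl linearD. Qed.
Lemma TDr x x' y : T y (x + x') = T y x + T y x'.
Proof. by rewrite /T cmulDr linearD. Qed.
Lemma TZl k x y : T (k *: x) y = k * T x y.
Proof. by rewrite /T cmulZl linearZ. Qed.
Lemma TZr k x y : T y (k *: x) = k * T y x.
Proof. by rewrite /T cmulZr linearZ. Qed.
Lemma TNl x y : T (- x) y = - T x y.
Proof. by rewrite /T cmulNl linearN. Qed.
Lemma TNr x y : T y (- x) = - T y x.
Proof. by rewrite /T cmulNr linearN. Qed.
Lemma T1l x : T 'e x = tr x.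
Proof. by rewrite /T cmul1l. Qed.
Lemma T1r x : T x 'e = tr x.
Proof. by rewrite /T cmul1r. Qed.
Lemma T0l x : T 0 x = 0.
Proof. by rewrite /T cmul0l linear0. Qed.
Lemma T0r x : T x 0 = 0.
Proof. by rewrite /T cmul0r linear0. Qed.
Definition TE := (TDl, TDr, TNl, TNr, TZl, TZr, T1l, T1r, T0l, T0r).
Lemma trD x y : tr (x + y) = tr x + tr y. Proof. exact: linearD. Qed.
Lemma trN x : tr (- x) = - tr x. Proof. exact: linearN. Qed.
Lemma trZ k x : tr (k *: x) = k * tr x. Proof. exact: linearZ. Qed.
Definition trE := (trD, trN, trZ).
Lemma trM x y : tr (x ** y) = T x y.
Proof. by []. Qed.

End TraceForm.

Ltac gen_atoms ::=
  repeat match goal with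
  | |- context [@tform ?K ?J ?A ?x ?y] => generalize (@tform K J A x y); intro
  | |- context [@GRing.Linear.sort ?a ?b ?c ?d (@ctr ?K ?J ?A) ?u] =>
      generalize (@GRing.Linear.sort a b c d (@ctr K J A) u); intro
  end.

Section JordanIdentity.
Variables (K : numClosedFieldType) (J : vectType K) (A : cubic_jordan J).
Implicit Types x y z u v w a b c : J.
Local Notation "x ** y" := (cmul A x y) (at level 40, left associativity).
Local Notation "'e" := (cone A).
Local Notation tr := (ctr A).
Local Notation T := (tform A).

Lemma T_nondeg x : (forall y, T x y = 0) -> x = 0.
Proof. exact: ctr_nondeg. Qed.

Lemma cayleyT x z : let t := tr x in let s := (t ^+ 2 - T x x) / 2 in
  2 *: (x ** (x ** z)) + x ** x ** z =
      (2 * t) *: (x ** z) + tr z *: (x ** x) - s *: z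
      + (T x z - t * tr z) *: x
      + (T (x ** x) z - t * T x z + s * tr z) *: 'e.
Proof. exact: cayley. Qed.

(** The term 2x(x(xz)) cancels between the Cayley-Hamilton identity at xz and x times the one at z.
    What remains is a multiple of the cubic equation of x, once the trace of x^2(xz) is evaluated by
    that same equation. *)
Lemma jordan x z : (x ** x) ** (x ** z) = x ** ((x ** x) ** z).
Proof.
have h1 := cayleyT x (x ** z).
have /= := congr1 (cmul A x) (cayleyT x z); rewrite !mulE => h2.
have h3 := cayleyT x x.
have e1 : T x (x ** z) = T (x ** x) z by rewrite TA.
have h4 : (3 : K) *: (x ** (x ** x)) = (3 * tr x) *: (x ** x)
   - (3 * ((tr x ^+ 2 - T x x) / 2)) *: x + 
   (T (x ** x) x - tr x * T x x + (tr x ^+ 2 - T x x) / 2 * tr x) *: 'e.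
  apply: (lincomb1 (c := 1) h3); rewrite (cmulC _ (x ** x) x); vfield.
have e2 : T (x ** x) (x ** z) = tr x * T (x ** x) z
  - ((tr x ^+ 2 - T x x) / 2) * T x z + 
   (T (x ** x) x - tr x * T x x + (tr x ^+ 2 - T x x) / 2 * tr x) / 3 * tr z.
  rewrite -TA (cmulC _ (x ** x) x).
  have n3 : (3 : K) != 0 by rewrite pnatr_eq0.
  apply: (mulfI n3); rewrite -(TZl _ 3 (x ** (x ** x)) z) h4 !TE; sfield.
apply: (lincomb3 (c := 1) (c' := -1) (c2 := - tr z / 3) h1 h2 h4).
rewrite e1 e2 trM; vfield.
Qed.

(** The trilinear part of the Jordan identity, extracted by inclusion-exclusion; every product
    occurs twice, hence the coefficient 1/2. *)
Lemma jordan_lin a b c z :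
  (a ** b) ** (c ** z) + (b ** c) ** (a ** z) + (a ** c) ** (b ** z) =
  c ** ((a ** b) ** z) + a ** ((b ** c) ** z) + b ** ((a ** c) ** z).
Proof.
pose P x := x ** x ** (x ** z) - x ** (x ** x ** z).
have P0 x : P x = 0 by apply/eqP; rewrite subr_eq0 jordan.
have h : P (a + b + c) - P (a + b) - P (a + c) - P (b + c) + P a + P b + P c = 0.
  by rewrite !P0 !subr0 !addr0.
apply: (lincomb1 (c := 1 / 2) h); rewrite /P !mulE.
rewrite (cmulC _ b a) (cmulC _ c a) (cmulC _ c b); vfield.
Qed.

Lemma inner_derivation x y a b :
  x ** (y ** (a ** b)) - y ** (x ** (a ** b)) =
  (x ** (y ** a) - y ** (x ** a)) ** b + a ** (x ** (y ** b) - y ** (x ** b)).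
Proof.
have h1 := jordan_lin a y b x; have h2 := jordan_lin a x b y.
apply: (lincomb2 (c := 1) (c' := -1) h1 h2); rewrite !mulE.
have C := cmulC A.
rewrite (C b x) (C b y) (C a x) (C a y) (C y x).
rewrite (C (x ** b) (y ** a)) (C (x ** a) (y ** b)).
rewrite (C (a ** b) x) (C (a ** b) y) (C (y ** a) x) (C (x ** a) y).
rewrite (C (y ** b) x) (C (x ** b) y) (C b (x ** (y ** a))) (C b (y ** (x ** a))).
vring.
Qed.
End JordanIdentity.

(** * Commuting pairs of traceless elements *)

Section Commuting.
Variables (K : numClosedFieldType) (J : vectType K) (A : cubic_jordan J).
Implicit Types x y z u v w a b c : J.
Local Notation "x ** y" := (cmul A x y) (at level 40, left associativity).
Local Notation "'e" := (cone A).
Local Notation tr := (ctr A).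
Local Notation T := (tform A).
Let C := cmulC A.

Definition commuting x y := forall z, x ** (y ** z) = y ** (x ** z).

Lemma commutingC x y : commuting x y -> commuting y x.
Proof. by move=> h z; rewrite h. Qed.

(** By associativity of T, pairing x /\ y with the inner derivation [L_a, L_b] gives T([L_y, L_x] a,
    b); nondegeneracy of T concludes. *)
Lemma commuting_of_inner x y :
  (forall a b, T x (a ** (b ** y) - b ** (a ** y)) = 0) -> commuting x y.
Proof.
move=> h z; apply/subr0_eq/(@T_nondeg _ _ A) => w.
have e1 : T (x ** (y ** z)) w = T (x ** w) (y ** z) by rewrite (C x) TA TC.
have e2 : T (y ** (x ** z)) w = T (x ** z) (y ** w) by rewrite (C y) TA.
have := h z w; rewrite !TE -!(TA A x) e1 e2 (C y w) (C y z) => /subr0_eq ->.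
by rewrite subrr.
Qed.

Lemma jordan_lin2 x y z :
  2 *: ((x ** y) ** (x ** z)) + (x ** x) ** (y ** z) =
  2 *: (x ** ((x ** y) ** z)) + y ** ((x ** x) ** z).
Proof.
apply: (lincomb1 (c := 1) (jordan_lin A x y x z)); rewrite (C y x); vring.
Qed.

Section Traceless.
Variable x : J.
Hypothesis tx : tr x = 0.
Let q := T x x / 2.
Let d := T (x ** x) x / 3.

Lemma cayley0 z : 2 *: (x ** (x ** z)) + x ** x ** z =
  tr z *: (x ** x) + q *: z + T x z *: x + (T (x ** x) z - q * tr z) *: 'e.
Proof.
apply: (lincomb1 (c := 1) (cayleyT A x z)); rewrite tx /q; vfield.
Qed.

(** The characteristic polynomial of a traceless x is X^3 - qX - d, with T(x, x) = 2q and T(x^2, x)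
    = 3d. Its discriminant is 4q^3 - 27d^2. *)
Lemma cube_traceless : x ** (x ** x) = q *: x + d *: 'e.
Proof.
apply: (lincomb1 (c := 1 / 3) (cayley0 x)); rewrite (C (x ** x) x) tx /q /d; vfield.
Qed.

Lemma traceless_indep (a0 a1 a2 : K) : x != 0 -> (forall a b : K, x ** x <> a *: x + b *: 'e) ->
  a0 *: 'e + a1 *: x + a2 *: (x ** x) = 0 -> [/\ a0 = 0, a1 = 0 & a2 = 0].
Proof.
move=> x0 nq h.
have a20 : a2 = 0.
  apply/eqP/negPn/negP => a20; apply: (nq (- a1 / a2) (- a0 / a2)).
  apply: (lincomb1 (c := a2^-1) h); vfield.
move: h; rewrite a20 scale0r addr0 => h.
have := congr1 tr h; rewrite linearD !linearZ /= ctr1 tx linear0 mulr0 addr0.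
move/eqP; rewrite mulf_eq0 pnatr_eq0 orbF => /eqP a00.
by move: h; rewrite a00 scale0r add0r => /eqP; rewrite scaler_eq0 (negPf x0) orbF => /eqP.
Qed.
End Traceless.

Lemma cayley_polar x y z : tr x = 0 -> tr y = 0 ->
  2 *: (x ** (y ** z)) + 2 *: (y ** (x ** z)) + 2 *: (x ** y ** z) =
  (2 * tr z) *: (x ** y) + T x y *: z + T x z *: y + T y z *: x
  + (2 * T (x ** y) z - T x y * tr z) *: 'e.
Proof.
move=> tx ty; have txy : tr (x + y) = 0 by rewrite linearD /= tx ty addr0.
have := cayley0 txy z; rewrite !(mulE, TE) => h.
apply: (lincomb3 (c := 1) (c' := -1) (c2 := -1) h (cayley0 tx z) (cayley0 ty z)).
rewrite (C y x) (TC _ y x); vfield.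
Qed.

Section CommutingPair.
Variables x y : J.
Hypotheses (tx : tr x = 0) (ty : tr y = 0) (xy : commuting x y).
Let w := x ** y.
Let q := T x x / 2.
Let d := T (x ** x) x / 3.
Let tau := T x y.
Let sigma := T (x ** x) y.

Lemma comm_sq : x ** (x ** y) = x ** x ** y.
Proof. by rewrite (C (x ** x)) -xy (C y x). Qed.

Lemma commE2 : 3 *: (x ** (x ** y)) = q *: y + tau *: x + sigma *: 'e.
Proof.
apply: (lincomb1 (c := 1) (cayley0 tx y)); rewrite ty -comm_sq /q /tau /sigma; vfield.
Qed.

(** Two evaluations of x(x(xy)): x times [commE2], and y times the cubic equation of x. *)
Lemma commE1 : (2 * q) *: (x ** y) + (3 * d) *: y = tau *: (x ** x) + sigma *: x.
Proof.
have h1 := congr1 (cmul A x) commE2.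
have h2 := congr1 (cmul A y) (cube_traceless tx).
move: h1 h2; rewrite -/q -/d !mulE (C y x) -(xy (x ** x)) (C y (x ** x)) -comm_sq => h1 h2.
by apply: (lincomb2 (c := 1) (c' := -3) h1 h2); vring.
Qed.

Lemma comm_polar z : 4 *: (x ** (y ** z)) =
  - (2 *: (x ** y ** z)) + (2 * tr z) *: (x ** y) + tau *: z + T x z *: y + T y z *: x
  + (2 * T (x ** y) z - tau * tr z) *: 'e.
Proof.
by apply: (lincomb1 (c := 1) (cayley_polar z tx ty)); rewrite -xy /tau; vring.
Qed.

(** [commE1], its product with x, and [commE2] are linear equations in y, xy and x(xy) whose
    right-hand sides lie in the span of I, x and x^2. Their determinant is 27d^2 - 4q^3. *)
Lemma comm_disc : 4 * q ^+ 3 - 27 * d ^+ 2 != 0 ->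
  exists a b c : K, y = a *: 'e + b *: x + c *: (x ** x).
Proof.
move=> D0; have h1 := commE1.
have h2 := congr1 (cmul A x) h1; move: h2; rewrite !mulE (cube_traceless tx) -/q -/d => h2.
have h3 := commE2.
have h : (27 * d ^+ 2 - 4 * q ^+ 3) *: y = (4 * q ^+ 2 * sigma - 6 * q * tau * d) *: 'e +
    (9 * d * sigma - 2 * q ^+ 2 * tau) *: x + (9 * d * tau - 6 * q * sigma) *: (x ** x).
  apply: (lincomb3 (c := 9 * d) (c' := - 6 * q) (c2 := 4 * q ^+ 2) h1 h2 h3).
  rewrite /tau /sigma /d /q; vfield.
have D'0 : 27 * d ^+ 2 - 4 * q ^+ 3 != 0 by rewrite -oppr_eq0 opprB.
rewrite -[y](scalerK D'0) h !scalerDr !scalerA; by do 3!eexists.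
Qed.
End CommutingPair.

Lemma commuting_lin x y (k : K) : commuting x y -> commuting x (y + k *: x).
Proof. by move=> h z; rewrite !mulE h. Qed.

(* The two ways in which the line through [x] and [y] is a limit of lines through
   some [z] and [z ** z]: it is such a line, or [y] is a first-order variation
   of [x ** x]. *)
Definition on_powers x y := exists a b c : K, y = a *: 'e + b *: x + c *: (x ** x).
Definition power_limit x y := exists al be : K, exists z, exists a b : K,
  x ** x = al *: x + be *: 'e /\ y = 2 *: (x ** z) - al *: z + a *: x + b *: 'e.

Lemma exists_tform1 x : x != 0 -> exists z, T x z = 1.
Proof.
move=> x0; have [[z hz]|h] := boolp.pselect (exists z, T x z != 0).
  by exists ((T x z)^-1 *: z); rewrite TZr mulVf.
case/eqP: x0; apply/(@T_nondeg _ _ A) => z.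
by apply/eqP/negPn/negP => hz; apply: h; exists z.
Qed.

Section CommQuadratic.
Variables (x y : J) (al be : K).
Hypotheses (x0 : x != 0) (tx : tr x = 0) (ty : tr y = 0) (xy : commuting x y).
Hypothesis xx : x ** x = al *: x + be *: 'e.

(** Comparison with the cubic equation shows that X^2 - al X - be = (X - 2 al)(X + al): the
    eigenvalues of x are 2 al, - al, - al. *)
Lemma quadratic_coef : be = 2 * al ^+ 2 /\ T x x = 6 * al ^+ 2.
Proof.
have qE : T x x = 3 * be by rewrite /tform xx linearD !linearZ /= tx ctr1; ring.
have h := cube_traceless tx; rewrite {1}xx !mulE xx qE in h.
have h1 := congr1 tr h; rewrite !(linearD, linearZ) /= ctr1 tx in h1.
set D := T (al *: x + be *: 'e) x / 3 in h h1.
have DE : D = al * be by apply: (mulIf (_ : (3 : K) != 0)); [rewrite pnatr_eq0 | ring: h1].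
have : (al ^+ 2 - be / 2) *: x = 0.
  by apply: (lincomb1 (c := 1) h); rewrite DE; vfield.
move/eqP; rewrite scaler_eq0 (negPf x0) orbF subr_eq0 => /eqP h2.
have bE : be = 2 * al ^+ 2 by rewrite h2; field.
by split=> //; rewrite qE bE; ring.
Qed.

Lemma power_limit_semisimple : al != 0 -> power_limit x y.
Proof.
move=> al0; have [bE qE] := quadratic_coef.
have h1 := commE2 tx ty xy; have h2 := comm_sq xy; rewrite h2 xx qE !mulE in h1.
pose t := T x y / (3 * al); pose s := T (al *: x + be *: 'e) y / (3 * al).
(* [commE2] gives xy = - al y modulo I and x, so that 2xz - al z = - 3 al z modulo I and x for any
   multiple z of y. *)
exists al, be, (- (3 * al)^-1 *: y), (2 / (3 * al) * t), (2 / (3 * al) * s).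
split=> //; apply: (lincomb1 (c := 2 / (9 * al ^+ 2)) h1).
by rewrite /t /s bE !mulE; vprep; field; rewrite al0.
Qed.
End CommQuadratic.

Lemma commuting_T_sym x w : commuting x w -> forall z v,
  T (x ** (w ** z)) v = T (x ** (w ** v)) z.
Proof. by move=> h z v; rewrite (C x (w ** z)) TA (C w z) TA -h TC. Qed.

Lemma prop_of_T x w z0 : T x z0 = 1 -> (forall z v, T x z * T w v = T x v * T w z) ->
  w = T w z0 *: x.
Proof.
move=> h1 h; apply/subr0_eq/(@T_nondeg _ _ A) => v.
by rewrite !TE [T w z0 * _]mulrC -h h1 mul1r subrr.
Qed.

Section CommNil.
Variables x y : J.
Hypotheses (x0 : x != 0) (tx : tr x = 0) (ty : tr y = 0) (xy : commuting x y).
Hypothesis xx : x ** x = 0.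

Lemma nil_comm_T : [/\ T x y = 0, x ** (x ** y) = 0 & T x x = 0].
Proof.
have qE : T x x = 0 by rewrite /tform xx linear0.
have xw : x ** (x ** y) = 0 by rewrite comm_sq // xx cmul0l.
have := commE2 tx ty xy; rewrite xw qE xx T0l !(scaler0, mul0r, cmul0l, scale0r) addr0 add0r.
by move/esym/eqP; rewrite scaler_eq0 (negPf x0) orbF => /eqP.
Qed.

(* With w = xy, the form T(x (w z), v) is symmetric in z and v because L_x and
   L_w commute, and it equals T(x, z) T(w, v) / 2. *)
Lemma nil_comm_prod : exists k, x ** y = k *: x.
Proof.
have [tau0 xw qE] := nil_comm_T.
have h z : 2 *: (x ** (x ** y ** z)) = T x z *: (x ** y).
  have h1 := congr1 (cmul A x) (comm_polar tx ty xy z).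
  have h2 := cayley0 tx (y ** z).
  rewrite !mulE xw xx tau0 in h1; rewrite xx !mulE qE !TE -TA in h2.
  by apply: (lincomb2 (c := 1) (c' := -2) h1 h2); vring.
have cxw : commuting x (x ** y).
  move=> z; have := jordan_lin2 x y z; rewrite xx !mulE => h1.
  by apply: (lincomb1 (c := - 1 / 2) h1); vfield.
have [z0 z01] := exists_tform1 x0.
exists (T (x ** y) z0); apply: (prop_of_T z01) => z v.
by rewrite -!TZl -!h !TZl (commuting_T_sym cxw).
Qed.

Lemma power_limit_nil : power_limit x y.
Proof.
have [tau0 xw qE] := nil_comm_T; have [k wE] := nil_comm_prod.
have [z z1] := exists_tform1 x0.
(* Read off from [comm_polar] at z: as xy = kx, T(x, y) = 0 and T(x, z) = 1, y occurs there with
   coefficient 1, and every other term is a product with x or a multiple of x or I. *)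
exists 0, 0, (2 *: (y ** z) + k *: z), (- 2 * tr z * k - T y z), (- 2 * k).
split; first by rewrite xx !scale0r addr0.
apply: (lincomb1 (c := -1) (comm_polar tx ty xy z)).
by rewrite wE tau0 z1 !mulE !TE z1; vring.
Qed.
End CommNil.

Lemma power_limit_quadratic x y (al be : K) : x != 0 -> tr x = 0 -> tr y = 0 ->
  commuting x y -> x ** x = al *: x + be *: 'e -> power_limit x y.
Proof.
move=> x0 tx ty xy xx; have [al0|al0] := eqVneq al 0; last exact: power_limit_semisimple xx al0.
have [bE _] := quadratic_coef x0 tx xx.
by apply: power_limit_nil => //; rewrite xx bE al0 expr0n /= mulr0 !scale0r addr0.
Qed.

Section CommRegular.
Variable x : J.
Hypotheses (x0 : x != 0) (tx : tr x = 0).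
Hypothesis nq : forall a b : K, x ** x <> a *: x + b *: 'e.
Let q := T x x / 2.
Let d := T (x ** x) x / 3.

Section DoubleRoot.
Variable lam : K.
Hypotheses (lam0 : lam != 0) (qE : q = 3 * lam ^+ 2) (dE : d = - 2 * lam ^+ 3).
Variable y : J.
Hypotheses (ty : tr y = 0) (xy : commuting x y) (tau0 : T x y = 0).

(** Here X^3 - qX - d = (X - lam)^2 (X + 2 lam). Elimination of y and its products yields s (x -
    lam)(x + 2 lam) = 0 with s = T(x^2, y). As x satisfies no quadratic equation, s = 0, and
    [commE1] becomes the claim. *)
Lemma double_root_eigen : x ** y = lam *: y.
Proof.
have h1 := commE1 tx ty xy; have h2 := commE2 tx ty xy.
rewrite -/q -/d qE dE tau0 in h1; rewrite -/q qE tau0 in h2.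
have h3 := congr1 (cmul A x) h1; rewrite !mulE in h3.
set s := T (x ** x) y in h1 h2 h3.
have h : (- 2 * lam ^+ 2 * s) *: 'e + (lam * s) *: x + s *: (x ** x) = 0.
  apply: (lincomb3 (c := - lam) (c' := 2 * lam ^+ 2) (c2 := -1) h1 h2 h3).
  by clearbody s; vprep; field.
have [_ _ s0] := traceless_indep tx x0 nq h.
apply: (lincomb1 (c := (6 * lam ^+ 2)^-1) h1).
by rewrite s0; vprep; field; rewrite lam0.
Qed.

(** The Cayley-Hamilton identity of y at x reads 3 lam y^2 = (k / 2) x + lam k I with k = T(y, y).
    For k nonzero it exhibits x as a polynomial in y; for k = 0 it gives y^2 = 0, and
    [power_limit_nil] applies to y. *)
Lemma double_root_pair : [\/ y = 0, on_powers y x | power_limit y x].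
Proof.
have [->|y0] := eqVneq y 0; first by constructor 1.
have wE := double_root_eigen.
have h := cayley0 ty x.
rewrite (C (y ** y)) (xy y) (C y x) wE !mulE tx (TC _ y x) tau0 TA (C y x) wE TZr in h.
have [k kE] : exists k, T y y = k by exists (T y y).
rewrite kE in h; have [qy0|qy0] := eqVneq k 0; last first.
  constructor 2; exists (- 2 * lam), 0, (6 * lam / k).
  by apply: (lincomb1 (c := - 2 / k) h); vprep; field.
have yy : y ** y = 0.
  by apply: (lincomb1 (c := (3 * lam)^-1) h); rewrite qy0; vprep; field; rewrite lam0.
by constructor 3; apply: power_limit_nil (commutingC xy) yy.
Qed.
End DoubleRoot.

Section NilpotentRegular.
Hypotheses (q0 : T x x = 0) (d0 : T (x ** x) x = 0).
Local Notation m := (x ** x).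

Let x3 : x ** m = 0.
Proof. by rewrite cube_traceless // q0 d0 !mul0r !scale0r addr0. Qed.
Let m0 : m != 0.
Proof. by apply/eqP => mE; apply: (nq (a := 0) (b := 0)); rewrite mE !scale0r addr0. Qed.

Lemma nilpotent_regular_T y : tr y = 0 -> commuting x y ->
  [/\ T x y = 0, T m y = 0, x ** (x ** y) = 0 & m ** y = 0].
Proof.
move=> ty xy; have h := commE1 tx ty xy; rewrite q0 d0 in h.
have h1 : 0 *: 'e + T m y *: x + T x y *: m = 0.
  by apply: (lincomb1 (c := -1) h); vfield.
have [_ s0 t0] := traceless_indep tx x0 nq h1.
have xw : x ** (x ** y) = 0.
  by apply: (lincomb1 (c := 1 / 3) (commE2 tx ty xy)); rewrite s0 t0 q0; vfield.
by split=> //; rewrite -comm_sq.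
Qed.

(** The Cayley-Hamilton identity of x at yz, minus y times the one at z: the terms 2x(x(yz)) and
    2y(x(xz)) agree because L_x and L_y commute. *)
Lemma nilpotent_regular_bracket y z : tr y = 0 -> commuting x y ->
  m ** (y ** z) - y ** (m ** z) =
  T (x ** y) z *: x - T x z *: (x ** y) + T y z *: m - T m z *: y.
Proof.
move=> ty xy; have [t0 s0 xw my] := nilpotent_regular_T ty xy.
have h1 := cayley0 tx (y ** z).
have h2 := congr1 (cmul A y) (cayley0 tx z).
rewrite !mulE (C y m) my (C y x) in h2.
rewrite trM q0 -!(TA A) my T0l !(xy z) (xy (x ** z)) in h1.
by apply: (lincomb2 (c := 1) (c' := -1) h1 h2); rewrite q0; vfield.
Qed.

(* As in [nil_comm_prod], for the form T(m (w z), v). *)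
Lemma nilpotent_regular_prod y : tr y = 0 -> commuting x y -> exists k, x ** y = k *: m.
Proof.
move=> ty xy; have [t0 s0 xw my] := nilpotent_regular_T ty xy.
have mw : m ** (x ** y) = 0 by rewrite jordan my cmul0r.
have tw : tr (x ** y) = 0 by [].
have h z : 2 *: (m ** (x ** y ** z)) = T m z *: (x ** y).
  have h1 := jordan_lin2 x y z.
  have h2 := cayley_polar z tx tw.
  rewrite xw cmul0l -TA s0 in h2.
  have h3 := nilpotent_regular_bracket z ty xy.
  (* Multiplied by x, this evaluates x(x(wz)) for w = xy; the Cayley-Hamilton identity of x at wz
     converts the result into m(wz). *)
  have h4 : 4 *: (x ** (x ** y ** z)) = (2 * T (x ** y) z) *: x + T y z *: m - T m z *: y.
    by apply: (lincomb3 (c := -1) (c' := 1) (c2 := 1) h1 h2 h3); rewrite TE; vfield.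
  have h5 := congr1 (cmul A x) h4; rewrite !mulE x3 in h5.
  have h6 := cayley0 tx (x ** y ** z).
  rewrite -!(TA A) xw mw !T0l q0 trM in h6.
  by apply: (lincomb2 (c := -1) (c' := 2) h5 h6); vfield.
have cmw : commuting m (x ** y).
  move=> z; have := jordan_lin A x y m z; rewrite x3 (C y) my !cmul0l !cmul0r => h1.
  by apply: (lincomb1 (c := -1) h1); vring.
have [z0 z01] := exists_tform1 m0.
exists (T (x ** y) z0); apply: (prop_of_T z01) => z v.
by rewrite -!TZl -!h !TZl (commuting_T_sym cmw).
Qed.

(** After subtraction of kx the product with x vanishes, so [jordan_lin2] gives m(y'z) = y'(mz). The
    bracket formula at a z with T(m, z) = 1 then reads y' = T(y', z) m. *)
Lemma nilpotent_regular_powers y : tr y = 0 -> commuting x y -> on_powers x y.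
Proof.
move=> ty xy; have [k kE] := nilpotent_regular_prod ty xy.
pose y' := y + (- k) *: x.
have ty' : tr y' = 0 by rewrite linearD linearZ /= ty tx mulr0 addr0.
have xy' : commuting x y' by apply: commuting_lin.
have w0 : x ** y' = 0 by rewrite !mulE kE scaleNr subrr.
have [z z1] := exists_tform1 m0.
have h1 := nilpotent_regular_bracket z ty' xy'; have h2 := jordan_lin2 x y' z.
rewrite w0 T0l z1 in h1; rewrite w0 !cmul0l cmul0r in h2.
exists 0, k, (T y' z); apply: (lincomb2 (c := 1) (c' := -1) h1 h2).
by rewrite /y'; vring.
Qed.
End NilpotentRegular.
End CommRegular.

Theorem commuting_pair_cases x y : x != 0 -> tr x = 0 -> tr y = 0 -> commuting x y ->
  exists x' y' k, (x' = x /\ y' = y \/ x' = y + (- k) *: x /\ y' = x) /\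
    (on_powers x' y' \/ power_limit x' y').
Proof.
move=> x0 tx ty xy.
have [[al [be xx]]|nq'] := boolp.pselect (exists al be : K, x ** x = al *: x + be *: 'e).
  by exists x, y, 0; split; [left|right; apply: power_limit_quadratic xx].
have nq (al be : K) : x ** x <> al *: x + be *: 'e.
  by move=> xx; apply: nq'; exists al, be.
pose q := T x x / 2; pose d := T (x ** x) x / 3.
have [D0|D0] := eqVneq (4 * q ^+ 3 - 27 * d ^+ 2) 0; last first.
  by exists x, y, 0; split; [left|left; apply: comm_disc D0].
have [q0|q0] := eqVneq q 0.
  have d0 : d = 0.
    move/eqP: D0; rewrite q0 expr0n mulr0 sub0r oppr_eq0 mulf_eq0 pnatr_eq0 /=.
    by rewrite expf_eq0 => /eqP.
  exists x, y, 0; split; [left|left] => //; apply: nilpotent_regular_powers => //.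
    by apply/eqP; move/eqP: q0; rewrite mulf_eq0 invr_eq0 pnatr_eq0 orbF.
  by apply/eqP; move/eqP: d0; rewrite mulf_eq0 invr_eq0 pnatr_eq0 orbF.
have d0 : d != 0.
  apply: contra_eq_neq D0 => ->; rewrite expr0n mulr0 subr0 mulf_eq0 pnatr_eq0 /=.
  by rewrite expf_eq0.
(* The polynomial (X - lam)^2 (X + 2 lam) has q = 3 lam^2 and d = - 2 lam^3, which determines
   lam. *)
pose lam := - 3 * d / (2 * q).
have [q' qE] : exists q', q' = q by exists q.
have [d' dE] : exists d', d' = d by exists d.
have D1 : 4 * q' ^+ 3 = 27 * d' ^+ 2 by rewrite qE dE; apply/subr0_eq.
have lamE : 3 * lam ^+ 2 = q'.
  apply: (mulfI (_ : 4 * q' ^+ 2 != 0)).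
    by rewrite mulf_neq0 ?pnatr_eq0 // qE expf_neq0.
  rewrite -[RHS]mulrA -exprSr D1 /lam -qE -dE; field; rewrite ?qE ?q0 //.
have lam3 : - 2 * lam ^+ 3 = d'.
  apply: (mulfI (_ : 3 != 0 :> K)); first by rewrite pnatr_eq0.
  transitivity (- 2 * (3 * lam ^+ 2) * lam); first by ring.
  rewrite lamE /lam -qE -dE; field; rewrite ?qE ?q0 //.
have lam0 : lam != 0.
  rewrite /lam -qE -dE mulf_eq0 invr_eq0 !mulf_eq0 oppr_eq0 !pnatr_eq0 qE dE.
  by rewrite (negPf q0) (negPf d0).
(* Subtracting kx makes y' orthogonal to x, as the double-root case requires, and does not change x
   /\ y. *)
pose k := T x y / T x x.
have xx0 : T x x != 0 by move: q0; rewrite mulf_eq0 negb_or => /andP[].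
pose y' := y + (- k) *: x.
have ty' : tr y' = 0 by rewrite linearD linearZ /= ty tx mulr0 addr0.
have xy' : commuting x y' by apply: commuting_lin.
have t0 : T x y' = 0 by rewrite !TE /k mulNr mulfVK // subrr.
have [y0|h|h] := double_root_pair x0 tx nq lam0 (esym (etrans lamE qE))
  (esym (etrans lam3 dE)) ty' xy' t0.
- exists x, y, 0; split; [left|left] => //.
  by exists 0, k, 0; apply: (lincomb1 (c := 1) y0); rewrite /y'; vring.
- by exists y', x, k; split; [right|left].
- by exists y', x, k; split; [right|right].
Qed.
End Commuting.

(** * Frames of idempotents *)

Section Frames.
Variables (K : numClosedFieldType) (J : vectType K) (A : cubic_jordan J).
Implicit Types x y z v w a b : J.
Local Notation "x ** y" := (cmul A x y) (at level 40, left associativity).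
Local Notation "'e" := (cone A).
Local Notation tr := (ctr A).
Local Notation T := (tform A).
Let C := cmulC A.

Definition derivation (u : J -> J) :=
  (forall a b, u (a ** b) = u a ** b + a ** u b) /\ (forall x, tr (u x) = 0).

Lemma inner_is_derivation x y : derivation (fun z => x ** (y ** z) - y ** (x ** z)).
Proof.
split=> [a b|z]; first exact: inner_derivation.
by rewrite linearB /= !trM -!TA (C x y) subrr.
Qed.

Lemma derivation_skew u x y : derivation u -> T (u x) y = - T x (u y).
Proof. by move=> [uM ut]; have := ut (x ** y); rewrite uM linearD => /eqP; rewrite addr_eq0 => /eqP. Qed.

Record frame (e1 e2 e3 : J) : Prop := Frame {
  frame11 : e1 ** e1 = e1; frame22 : e2 ** e2 = e2; frame33 : e3 ** e3 = e3;
  frame12 : e1 ** e2 = 0; frame13 : e1 ** e3 = 0; frame23 : e2 ** e3 = 0;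
  frame_tr1 : tr e1 = 1; frame_tr2 : tr e2 = 1; frame_tr3 : tr e3 = 1;
  frame_sum : e1 + e2 + e3 = 'e }.

Definition comb3 (e1 e2 e3 : J) (c1 c2 c3 : K) := c1 *: e1 + c2 *: e2 + c3 *: e3.

Section OneFrame.
Variables e1 e2 e3 : J.
Hypothesis fr : frame e1 e2 e3.
Local Notation comb := (comb3 e1 e2 e3).

Lemma frame_mul c1 c2 c3 d1 d2 d3 :
  comb c1 c2 c3 ** comb d1 d2 d3 = comb (c1 * d1) (c2 * d2) (c3 * d3).
Proof.
case: fr => f1 f2 f3 f12 f13 f23 _ _ _ _; rewrite /comb3 !mulE f1 f2 f3.
by rewrite (C e2 e1) (C e3 e1) (C e3 e2) f12 f13 f23; vring.
Qed.

Lemma frame_tr c1 c2 c3 : tr (comb c1 c2 c3) = c1 + c2 + c3.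
Proof. by rewrite !(linearD, linearZ) /= !(frame_tr1 fr, frame_tr2 fr, frame_tr3 fr) !mulr1. Qed.

Lemma frame_one : 'e = comb 1 1 1.
Proof. by rewrite /comb3 !scale1r (frame_sum fr). Qed.

Lemma comb_inj c1 c2 c3 d1 d2 d3 : comb c1 c2 c3 = comb d1 d2 d3 ->
  [/\ c1 = d1, c2 = d2 & c3 = d3].
Proof.
move=> h; have k f1 f2 f3 := congr1 (fun z => tr (comb f1 f2 f3 ** z)) h.
move: (k 1 0 0) (k 0 1 0) (k 0 0 1); rewrite /= !frame_mul !frame_tr.
by rewrite !(mul0r, mul1r, addr0, add0r).
Qed.

(** For an idempotent f the Leibniz rule gives T(f, u f) = 2 T(f, u f). For orthogonal idempotents f
    and g it gives f (u g) = - (u f) g, and T(f, (u f) g) = T(fg, u f) = 0. *)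
Lemma frame_derivation (u : 'End(J)) c1 c2 c3 d1 d2 d3 : derivation u ->
  T (comb c1 c2 c3) (u (comb d1 d2 d3)) = 0.
Proof.
move=> du; have [uM _] := du; have [f1 f2 f3 f12 f13 f23 _ _ _ _] := fr.
have k1 f : f ** f = f -> T f (u f) = 0.
  move=> ff; have := congr1 (T f) (uM f f); rewrite TDr -!TA.
  rewrite [T (f ** u f) f]TC -TA ff.
  by move/eqP; rewrite -subr_eq0 opprD addrA subrr sub0r oppr_eq0 => /eqP.
have k2 f g : f ** f = f -> g ** g = g -> f ** g = 0 -> T f (u g) = 0.
  move=> ff gg fg; have h := uM f g; rewrite fg linear0 in h.
  rewrite -ff TA [f ** u g](_ : _ = - (u f ** g)); last by apply/eqP; rewrite -addr_eq0 addrC -h.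
  by rewrite TNr (C (u f)) -TA fg T0l oppr0.
have f21 : e2 ** e1 = 0 by rewrite C.
have f31 : e3 ** e1 = 0 by rewrite C.
have f32 : e3 ** e2 = 0 by rewrite C.
by rewrite /comb3 !(linearD, linearZ) /= !TE !(k1, k2) // !mulr0 !addr0.
Qed.
End OneFrame.

Section RankOneSum.
Variables (y1 y2 y3 : J).
Hypotheses (h1 : y1 ** y1 = tr y1 *: y1) (h2 : y2 ** y2 = tr y2 *: y2)
  (h3 : y3 ** y3 = tr y3 *: y3) (h : y1 + y2 + y3 = 'e).
Hypothesis ind : forall c1 c2 c3, c1 *: y1 + c2 *: y2 + c3 *: y3 = 0 ->
  [/\ c1 *: y1 = 0, c2 *: y2 = 0 & c3 *: y3 = 0].

Lemma rank1_products :
  [/\ 2 *: (y1 ** y2) = (1 - tr y1) *: y1 + (1 - tr y2) *: y2 - (1 - tr y3) *: y3,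
    2 *: (y1 ** y3) = (1 - tr y1) *: y1 - (1 - tr y2) *: y2 + (1 - tr y3) *: y3 &
    2 *: (y2 ** y3) = - (1 - tr y1) *: y1 + (1 - tr y2) *: y2 + (1 - tr y3) *: y3].
Proof.
have k1 := congr1 (cmul A y1) h; have k2 := congr1 (cmul A y2) h.
have k3 := congr1 (cmul A y3) h.
rewrite !mulE ?h1 ?h2 ?h3 (C y2 y1) in k1 k2 k3; rewrite (C y3 y1) (C y3 y2) in k3.
split.
- by apply: (lincomb3 (c := 1) (c' := 1) (c2 := -1) k1 k2 k3); vring.
- by apply: (lincomb3 (c := 1) (c' := -1) (c2 := 1) k1 k2 k3); vring.
- by apply: (lincomb3 (c := -1) (c' := 1) (c2 := 1) k1 k2 k3); vring.
Qed.

(** As T(y1, y1) = tr(y1)^2, the Cayley-Hamilton identity of y1 at y2 has s = 0. Comparison with y1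
    times the formula for y1 y2 leaves a linear relation between y1, y2 and y3 in which y2 has
    coefficient 1 - tr y2. *)
Lemma rank1_sum_half : (1 - tr y2) *: y2 = 0.
Proof.
have [p12 p13 _] := rank1_products.
have c := cayleyT A y1 y2; rewrite h1 !mulE /= in c.
have T11 : T y1 y1 = tr y1 ^+ 2 by rewrite /tform h1 linearZ expr2.
rewrite TZl T11 subrr mul0r in c.
have k := congr1 (cmul A y1) p12; rewrite !mulE h1 in k.
have ts : tr y3 = 3 - tr y1 - tr y2.
  by have := congr1 tr h; rewrite !linearD /= ctr1 => <-; ring.
have k' : (1 - tr y2 - tr y1) *: (y1 ** y2) - (1 - tr y3) *: (y1 ** y3) =
    (T y1 y2 - (1 - tr y1) * tr y1) *: y1.
  by apply: (lincomb2 (c := -1) (c' := 1) k c); vring.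
have k2 : (2 * (T y1 y2 - (1 - tr y1) * tr y1) - (1 - tr y2 - tr y1) * (1 - tr y1)
     + (1 - tr y3) * (1 - tr y1)) *: y1 + (1 - tr y2) *: y2 + (- (1 - tr y3)) *: y3 = 0.
  apply: (lincomb3 (c := 1 - tr y2 - tr y1) (c' := - (1 - tr y3)) (c2 := -2) p12 p13 k').
  by rewrite ts; vring.
by have [] := ind k2.
Qed.
End RankOneSum.

(** Each summand is zero or has trace 1, and the traces add up to 3. The independence hypothesis
    tolerates zero summands: in the application each is a coefficient times a given vector, and the
    coefficient is not known in advance to be nonzero. *)
Lemma rank1_sum_frame y1 y2 y3 :
  y1 ** y1 = tr y1 *: y1 -> y2 ** y2 = tr y2 *: y2 -> y3 ** y3 = tr y3 *: y3 ->
  y1 + y2 + y3 = 'e ->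
  (forall c1 c2 c3, c1 *: y1 + c2 *: y2 + c3 *: y3 = 0 ->
    [/\ c1 *: y1 = 0, c2 *: y2 = 0 & c3 *: y3 = 0]) -> frame y1 y2 y3.
Proof.
move=> h1 h2 h3 h ind.
have a2 := rank1_sum_half h1 h2 h3 h ind.
have a1 : (1 - tr y1) *: y1 = 0.
  apply: (@rank1_sum_half y2 y1 y3) => //; first by rewrite (addrC y2).
  by move=> c1 c2 c3; rewrite [c1 *: _ + _]addrC => /ind[].
have a3 : (1 - tr y3) *: y3 = 0.
  apply: (@rank1_sum_half y1 y3 y2) => //; first by rewrite addrAC.
  by move=> c1 c2 c3; rewrite addrAC => /ind[].
have [p12 p13 p23] := rank1_products h1 h2 h3 h.
rewrite a1 a2 a3 !(addr0, subr0) in p12 p13; rewrite scaleNr a1 a2 a3 !(addr0, oppr0) in p23.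
have z2 v : 2 *: v = 0 -> v = 0.
  by move/eqP; rewrite scaler_eq0 pnatr_eq0 => /eqP.
have tr01 v : (1 - tr v) *: v = 0 -> tr v = 0 \/ tr v = 1.
  move/eqP; rewrite scaler_eq0 subr_eq0 => /orP[/eqP <-|/eqP ->]; first by right.
  by left; rewrite linear0.
have ts : tr y1 + tr y2 + tr y3 = 3 by rewrite -!linearD h ctr1.
have nN (n : nat) : (n < 3)%N -> n%:R <> 3 :> K.
  by move=> n3 /eqP; rewrite eqr_nat => /eqP n3'; rewrite n3' in n3.
have [t1 t2 t3] : [/\ tr y1 = 1, tr y2 = 1 & tr y3 = 1].
  move: (tr01 _ a1) (tr01 _ a2) (tr01 _ a3) ts => [->|->] [->|->] [->|->] //=;
    rewrite ?add0r ?addr0 => /esym/esym hn; exfalso;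
    by [apply: (nN 0%N) | apply: (nN 1%N) | apply: (nN 2%N)].
by split; rewrite ?h1 ?h2 ?h3 ?t1 ?t2 ?t3 ?scale1r //; apply: z2.
Qed.

(** The frame consists of the Lagrange idempotents (x - s)(x - t) / ((r - s)(r - t)) at the three
    roots. As the roots have sum 0, the numerator is x^2 + rx + st. *)
Lemma spectral x : tr x = 0 ->
  4 * (T x x / 2) ^+ 3 - 27 * (T (x ** x) x / 3) ^+ 2 != 0 ->
  exists e1 e2 e3, frame e1 e2 e3 /\ exists r1 r2 r3,
    [/\ x = comb3 e1 e2 e3 r1 r2 r3, r1 != r2, r1 != r3 & r2 != r3].
Proof.
move=> tx; have cube := cube_traceless tx.
have [q qE] : exists q, T x x / 2 = q by exists (T x x / 2).
have [d dE] : exists d, T (x ** x) x / 3 = d by exists (T (x ** x) x / 3).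
rewrite qE dE in cube *; move=> D0.
have [r1 r1E] := @solve_monicpoly K 3 (fun i => if i == 0%N then d else if i == 1%N then q else 0) isT.
rewrite 3!big_ord_recr big_ord0 /= add0r expr0 expr1 mulr1 mul0r addr0 in r1E.
(* The other two roots solve X^2 + r1 X + r1^2 - q = 0, whose discriminant this is. *)
pose de := sqrtC (4 * q - 3 * r1 ^+ 2).
have deE : de ^+ 2 = 4 * q - 3 * r1 ^+ 2 by rewrite sqrtCK.
have [r2 r2E] : exists r2, r2 = (- r1 + de) / 2 by exists ((- r1 + de) / 2).
have [r3 r3E] : exists r3, r3 = (- r1 - de) / 2 by exists ((- r1 - de) / 2).
have s1 : r1 = - r2 - r3 by rewrite r2E r3E; field.
have s2 : q = - (r1 * r2 + r1 * r3 + r2 * r3).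
  rewrite r2E r3E; apply: (mulfI (_ : 4 != 0 :> K)); first by rewrite pnatr_eq0.
  transitivity (de ^+ 2 + 3 * r1 ^+ 2); first by rewrite deE; ring.
  by field.
have s3 : d = r1 * r2 * r3.
  have -> : d = r1 ^+ 3 - q * r1 by rewrite r1E; ring.
  by rewrite s2 s1; ring.
have DE : 4 * q ^+ 3 - 27 * d ^+ 2 = ((r1 - r2) * (r1 - r3) * (r2 - r3)) ^+ 2.
  by rewrite s3 s2 s1; ring.
rewrite DE expf_eq0 /= !mulf_eq0 !subr_eq0 !negb_or -!andbA in D0.
case/and3P: D0 => n12 n13 n23.
have x3 : x ** (x ** x) = - (r1 * r2 + r1 * r3 + r2 * r3) *: x + (r1 * r2 * r3) *: 'e.
  by rewrite cube s2 s3.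
have x4 : (x ** x) ** (x ** x) = - (r1 * r2 + r1 * r3 + r2 * r3) *: (x ** x) + (r1 * r2 * r3) *: x.
  by rewrite jordan (C (x ** x) x) x3 !mulE.
have x3' : (x ** x) ** x = - (r1 * r2 + r1 * r3 + r2 * r3) *: x + (r1 * r2 * r3) *: 'e by rewrite C.
pose N r s t := x ** x + r *: x + (s * t) *: 'e.
pose E r s t := ((r - s) * (r - t))^-1 *: N r s t.
have trN r s t : tr (N r s t) = 2 * q + 3 * (s * t).
  by rewrite !linearD !linearZ /= tx ctr1 -qE trM; field.
have tr1 r s t : r != s -> r != t -> r + s + t = 0 -> 2 * q = - 2 * (r * s + r * t + s * t) ->
    tr (E r s t) = 1.
  move=> rs rt z0 q2; rewrite linearZ /= trN q2.
  have rE : r = - s - t by rewrite -[RHS]addr0 -z0; ring.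
  by rewrite rE -subr_eq0 in rs; rewrite rE -subr_eq0 in rt; rewrite rE; field; rewrite rs rt.
have z0 : r1 + r2 + r3 = 0 by rewrite s1; ring.
have NN r s t : r + s + t = 0 -> - (r1 * r2 + r1 * r3 + r2 * r3) = - (r * s + r * t + s * t) ->
    r1 * r2 * r3 = r * s * t ->
    N r s t ** N r s t = ((r - s) * (r - t)) *: N r s t /\ N r s t ** N s r t = 0.
  move=> z q1 d1; have rE : r = - s - t by rewrite -[RHS]addr0 -z; ring.
  by split; rewrite /N !mulE x4 x3 x3' q1 d1 rE; vring.
have EE r s t : r != s -> r != t -> r + s + t = 0 ->
    - (r1 * r2 + r1 * r3 + r2 * r3) = - (r * s + r * t + s * t) ->
    r1 * r2 * r3 = r * s * t -> E r s t ** E r s t = E r s t /\ E r s t ** E s r t = 0.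
  move=> rs rt z q1 d1; have [h1 h2] := NN r s t z q1 d1.
  rewrite /E !(cmulZl, cmulZr) h1 h2 !scaler0; split=> //; rewrite scalerK //.
  by rewrite mulf_neq0 // subr_eq0.
have Esym r s t : E r s t = E r t s by rewrite /E /N mulrC (mulrC s).
have n21 : r2 != r1 by rewrite eq_sym.
have n31 : r3 != r1 by rewrite eq_sym.
have n32 : r3 != r2 by rewrite eq_sym.
have [f11 f12] : E r1 r2 r3 ** E r1 r2 r3 = E r1 r2 r3 /\ E r1 r2 r3 ** E r2 r1 r3 = 0.
  by apply: EE.
have [f33 f31] : E r3 r1 r2 ** E r3 r1 r2 = E r3 r1 r2 /\ E r3 r1 r2 ** E r1 r3 r2 = 0.
  by apply: EE => //; rewrite ?s1; ring.
have [f22 f23] : E r2 r3 r1 ** E r2 r3 r1 = E r2 r3 r1 /\ E r2 r3 r1 ** E r3 r2 r1 = 0.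
  by apply: EE => //; rewrite ?s1; ring.
have d1 : - r2 - r3 - r2 != 0 by move: n12; rewrite -subr_eq0 s1.
have d2 : - r2 - r3 - r3 != 0 by move: n13; rewrite -subr_eq0 s1.
have d3 : r2 - (- r2 - r3) != 0 by rewrite -s1 subr_eq0.
have d4 : r3 - (- r2 - r3) != 0 by rewrite -s1 subr_eq0.
have d5 : r2 - r3 != 0 by rewrite subr_eq0.
have d6 : r3 - r2 != 0 by rewrite subr_eq0.
exists (E r1 r2 r3), (E r2 r1 r3), (E r3 r1 r2); split; last first.
  exists r1, r2, r3; split=> //.
  by rewrite /comb3 /E /N s1; vprep; field; rewrite d1 d2 d3 d4 d5 d6.
split=> //.
- by rewrite !(Esym r2 r1).
- by rewrite C (Esym r1).
- by rewrite (Esym r2 r1) (Esym r3 r1).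
- by apply: tr1 => //; rewrite s2; ring.
- by apply: tr1 => //; rewrite ?s2 ?s1; ring.
- by apply: tr1 => //; rewrite ?s2 ?s1; ring.
by rewrite /E /N s1; vprep; field; rewrite d1 d2 d3 d4 d5 d6.
Qed.
End Frames.

(** * Functions that are polynomial along lines *)

Section PolynomialFunctions.
Variable K : numFieldType.

Lemma poly_grid_eq0 (p : {poly K}) d : (size p <= d.+1)%N ->
  (forall n : 'I_d.+1, p.[n%:R] = 0) -> p = 0.
Proof.
move=> sp h; apply/eqP/negPn/negP => p0.
have := @max_poly_roots _ p [seq n%:R | n <- iota 0 d.+1] p0.
rewrite size_map size_iota ltnNge sp => /(_ _ _)/negP; case=> //.
  apply/allP => _ /mapP[n + ->]; rewrite mem_iota add0n /= => nd.
  by rewrite rootE (h (Ordinal nd)).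
rewrite map_inj_uniq ?iota_uniq // => m n /eqP.
by rewrite eqr_nat => /eqP.
Qed.

Section OnModule.
Variable W : lmodType K.
Implicit Types (g h : W -> K) (w v : W).

(** Degrees are bounded on lines only. This is stable under sums, products and substitution into
    forms, and it suffices for density arguments. *)
Definition pline d g := forall w v, exists p : {poly K},
  (size p <= d.+1)%N /\ forall t, p.[t] = g (w + t *: v).

Lemma pline_ext d g h : g =1 h -> pline d g -> pline d h.
Proof. by move=> gh pg w v; have [p [sp pE]] := pg w v; exists p; split=> // t; rewrite pE gh. Qed.

Lemma pline_le d d' g : (d <= d')%N -> pline d g -> pline d' g.
Proof.
move=> dd pg w v; have [p [sp pE]] := pg w v.
by exists p; split=> //; apply: leq_trans sp _.
Qed.

Lemma pline_cst c : pline 0 (fun _ => c).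
Proof. by move=> w v; exists c%:P; split=> [|t]; rewrite ?hornerC // size_polyC leq_b1. Qed.

Lemma pline_lin (f : {scalar W}) : pline 1 f.
Proof.
move=> w v; exists ((f w)%:P + f v *: 'X); split=> [|t].
  rewrite (leq_trans (size_polyD _ _)) // geq_max size_polyC (leq_trans (leq_b1 _)) //=.
  by rewrite (leq_trans (size_scale_leq _ _)) // size_polyX.
by rewrite !hornerE linearD linearZ /= mulrC.
Qed.

Lemma plineD d g h : pline d g -> pline d h -> pline d (fun w => g w + h w).
Proof.
move=> pg ph w v; have [p [sp pE]] := pg w v; have [q [sq qE]] := ph w v.
exists (p + q); split=> [|t]; last by rewrite hornerD pE qE.
by rewrite (leq_trans (size_polyD _ _)) // geq_max sp.
Qed.

Lemma plineM d d' g h : pline d g -> pline d' h -> pline (d + d') (fun w => g w * h w).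
Proof.
move=> pg ph w v; have [p [sp pE]] := pg w v; have [q [sq qE]] := ph w v.
exists (p * q); split=> [|t]; last by rewrite hornerM pE qE.
apply: leq_trans (size_polyMleq _ _) _.
by have := leq_add sp sq; rewrite addSn addnS; case: (size p + size q)%N.
Qed.

Lemma plineZ d c g : pline d g -> pline d (fun w => c * g w).
Proof. by move=> pg; apply: (@plineM 0 d) => //; apply: pline_cst. Qed.

Lemma plineX d n g : pline d g -> pline (d * n) (fun w => g w ^+ n).
Proof.
move=> pg; elim: n => [|n IH].
  by rewrite muln0; apply: pline_ext (pline_cst 1) => w; rewrite expr0.
by rewrite mulnS; apply: pline_ext (plineM pg IH) => w; rewrite exprS.
Qed.

Lemma pline_sum d (I : Type) (r : seq I) (P : pred I) (g : I -> W -> K) :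
  (forall i, P i -> pline d (g i)) -> pline d (fun w => \sum_(i <- r | P i) g i w).
Proof.
move=> pg; elim: r => [|i r IH].
  by apply: pline_ext (pline_le (leq0n d) (pline_cst 0)) => w; rewrite big_nil.
have [Pi|Pi] := boolP (P i).
  by apply: pline_ext (plineD (pg i Pi) IH) => w; rewrite big_cons Pi.
by apply: pline_ext IH => w; rewrite big_cons (negPf Pi).
Qed.

Lemma pline_prod (I : Type) (r : seq I) (d : I -> nat) (g : I -> W -> K) :
  (forall i, pline (d i) (g i)) -> pline (\sum_(i <- r) d i) (fun w => \prod_(i <- r) g i w).
Proof.
move=> pg; elim: r => [|i r IH].
  by rewrite big_nil; apply: pline_ext (pline_cst 1) => w; rewrite big_nil.
by rewrite big_cons; apply: pline_ext (plineM (pg i) IH) => w; rewrite big_cons.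
Qed.

Lemma pline_meval n d k (f : {mpoly K[n]}) (h : W -> 'I_n -> K) :
  f \is d.-homog -> (forall i, pline k (h^~ i)) -> pline (k * d) (fun w => f.@[h w]).
Proof.
move=> /dhomogP fd ph.
have : pline (k * d) (fun w => \sum_(m <- msupp f | m \in msupp f) f@_m * \prod_i h w i ^+ m i).
  apply: pline_sum => m /fd /= md; apply: plineZ.
  rewrite -md mdegE big_distrr; apply: pline_prod => i; exact: plineX.
by apply: pline_ext => w; rewrite mevalE [in RHS]big_seq_cond; apply: eq_bigl => m; rewrite andbT.
Qed.

(** On the line through w and w' both functions are nonzero polynomials, so some integer parameter
    is no root of their product. This plays the part of the irreducibility of affine space. *)
Lemma pline_nz2 d d' g h w w' : pline d g -> pline d' h -> g w != 0 -> h w' != 0 ->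
  exists v, g v != 0 /\ h v != 0.
Proof.
move=> pg ph gw hw; have [p [sp pE]] := pg w (w' - w); have [q [sq qE]] := ph w (w' - w).
have p0 : p != 0 by apply: contra_neq gw => p0; rewrite -[w]addr0 -(scale0r (w' - w)) -pE p0 horner0.
have q0 : q != 0.
  apply: contra_neq hw => q0; rewrite -[w'](subrK w) addrC -(scale1r (w' - w)) -qE q0 horner0 //.
have pq : p * q != 0 by rewrite mulf_neq0.
have [t|nt] := pickP (fun n : 'I_(size (p * q)).+1 => (p * q).[n%:R] != 0).
  rewrite hornerM mulf_eq0 negb_or pE qE => /andP[? ?].
  by exists (w + t%:R *: (w' - w)).
case/negP: pq; apply/eqP/(@poly_grid_eq0 _ (size (p * q))) => // n.
by apply/eqP; have /negbFE := nt n.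
Qed.

End OnModule.

Section PolynomialMaps.
Variables (W : lmodType K) (E : vectType K).

Definition pmap d (phi : W -> E) := forall f : {scalar E}, pline d (fun w => f (phi w)).

Lemma pmap_ext d (phi psi : W -> E) : phi =1 psi -> pmap d phi -> pmap d psi.
Proof. by move=> e p f; apply: pline_ext (p f) => w; rewrite e. Qed.

Lemma pmap_le d d' (phi : W -> E) : (d <= d')%N -> pmap d phi -> pmap d' phi.
Proof. by move=> dd p f; apply: pline_le (p f). Qed.

Lemma pmap_cst v : pmap 0 (fun _ => v).
Proof. by move=> f; apply: pline_cst. Qed.

Lemma pmapD d (phi psi : W -> E) : pmap d phi -> pmap d psi -> pmap d (fun w => phi w + psi w).
Proof. by move=> p q f; apply: pline_ext (plineD (p f) (q f)) => w; rewrite linearD. Qed.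

Lemma pmap_coords d (phi : W -> E) i : pmap d phi -> pline d (fun w => coords (phi w) i).
Proof. by move=> p; apply: (p (coord (vbasis {:E}) i : {scalar E})). Qed.

End PolynomialMaps.

Lemma pmap_linear (W : lmodType K) (E : vectType K) (phi : {linear W -> E}) : pmap 1 phi.
Proof. by move=> f; apply: (pline_lin (f \o phi : {scalar W})). Qed.

Lemma pmapZ (W : lmodType K) (E : vectType K) d d' (g : W -> K) (phi : W -> E) :
  pline d g -> pmap d' phi -> pmap (d + d') (fun w => g w *: phi w).
Proof.
move=> pg p f; apply: pline_ext (plineM pg (p f)) => w; by rewrite linearZ.
Qed.

Lemma pmap_bilinear (W : lmodType K) (E1 E2 E : vectType K) (b : E1 -> E2 -> E)
    (phi : W -> E1) (psi : W -> E2) d d' :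
  (forall y, linear (b^~ y)) -> (forall x, linear (b x)) ->
  pmap d phi -> pmap d' psi -> pmap (d + d') (fun w => b (phi w) (psi w)).
Proof.
move=> bl br pp pq f.
pose X i := (vbasis {:E1})`_i; pose Y j := (vbasis {:E2})`_j.
have bs1 y (I : finType) (c : I -> K) (z : I -> E1) : b (\sum_i c i *: z i) y = \sum_i c i *: b (z i) y.
  pose B : {linear E1 -> E} := HB.pack (b^~ y) (GRing.isLinear.Build K E1 E *:%R (b^~ y) (bl y)).
  by rewrite -[LHS]/(B _) linear_sum; apply: eq_bigr => i _; rewrite linearZ.
have bs2 x (I : finType) (c : I -> K) (z : I -> E2) : b x (\sum_i c i *: z i) = \sum_i c i *: b x (z i).
  pose B : {linear E2 -> E} := HB.pack (b x) (GRing.isLinear.Build K E2 E *:%R (b x) (br x)).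
  by rewrite -[LHS]/(B _) linear_sum; apply: eq_bigr => i _; rewrite linearZ.
have : pline (d + d') (fun w => \sum_i \sum_j coords (phi w) i * coords (psi w) j * f (b (X i) (Y j))).
  apply: pline_sum => i _; apply: pline_sum => j _.
  rewrite -[(d + d')%N]addn0; apply: plineM; last exact: pline_cst.
  by apply: plineM; apply: pmap_coords.
apply: pline_ext => w.
rewrite {2}(coord_vbasis (memvf (phi w))) {2}(coord_vbasis (memvf (psi w))) bs1 linear_sum.
apply: eq_bigr => i _; rewrite bs2 scaler_sumr linear_sum; apply: eq_bigr => j _.
by rewrite scalerA linearZ.
Qed.
End PolynomialFunctions.

(** * Zariski closures *)

Section Closures.
Variables (K : numFieldType) (E : vectType K).
Implicit Types (l : {vspace E}) (Z C : {vspace E} -> Prop) (v : E).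
Local Notation form := {mpoly K[\dim {:E}]}.
Implicit Types f g : form.

Lemma homogeneousM f g : homogeneous f -> homogeneous g -> homogeneous (f * g).
Proof. by move=> [d fd] [d' gd]; exists (d + d')%N; apply: dhomogM. Qed.

Lemma coordsZ c v i : coords (c *: v) i = c * coords v i.
Proof. by rewrite /coords linearZ. Qed.

Lemma meval_coordsZ d f c v : f \is d.-homog ->
  f.@[coords (c *: v)] = c ^+ d * f.@[coords v].
Proof.
move=> /dhomogP fd; rewrite !mevalE mulr_sumr; apply: eq_big_seq => m /fd /= md.
rewrite mulrCA; congr (_ * _); rewrite -md mdegE -prodrXr -big_split /=.
by apply: eq_bigr => i _; rewrite coordsZ exprMn.
Qed.

Lemma vanishes_line f v : homogeneous f -> vanishes_at f <[v]> <-> f.@[coords v] = 0.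
Proof.
move=> [d fd]; split=> [h|h _ /vlineP[c ->]]; first by apply: h; rewrite memv_line.
by rewrite (meval_coordsZ _ _ fd) h mulr0.
Qed.

Lemma dim1_line l : \dim l = 1%N -> exists2 v, v != 0 & l = <[v]>%VS.
Proof.
move=> l1; have l0 : l != 0%VS by rewrite -dimv_eq0 l1.
exists (vpick l); first by rewrite vpick0.
apply/eqP; rewrite eq_sym eqEdim l1 dim_vline vpick0 l0 andbT.
by rewrite -memvE memv_pick.
Qed.

Lemma dim_line v : v != 0 -> \dim <[v]> = 1%N.
Proof. by move=> v0; rewrite dim_vline v0. Qed.

Lemma meval_coords_lin (lam : {scalar E}) : exists2 f : form,
  f \is 1.-homog & forall v, f.@[coords v] = lam v.
Proof.
exists (\sum_(i < \dim {:E}) lam (vbasis {:E})`_i *: 'X_i).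
  by apply: rpred_sum => i _; apply: rpredZ; rewrite dhomogX; apply/eqP/mdeg1.
move=> v; rewrite raddf_sum /= {2}(coord_vbasis (memvf v)) linear_sum.
by apply: eq_bigr => i _; rewrite mevalZ mevalXU linearZ mulrC.
Qed.

Lemma exists_scalar v : v != 0 -> exists lam : {scalar E}, lam v != 0.
Proof.
move=> v0; apply: boolp.contrapT => h; case/eqP: v0.
rewrite (coord_vbasis (memvf v)); apply: big1 => i _.
have [->|ci] := eqVneq (coord (vbasis {:E}) i v) 0; first by rewrite scale0r.
by case: h; exists (coord (vbasis {:E}) i : {scalar E}).
Qed.

Lemma zclosureE Z l : (forall m, Z m -> \dim m = 1%N) ->
  zclosure Z l <-> \dim l = 1%N /\
    forall f, homogeneous f -> (forall m, Z m -> vanishes_at f m) -> vanishes_at f l.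
Proof.
move=> Z1; split=> [h|[l1 h] C [F [Fh CE]] ZC].
  apply: (h (fun l => \dim l = 1%N /\ forall f, homogeneous f ->
    (forall m, Z m -> vanishes_at f m) -> vanishes_at f l)) => [|m Zm]; last first.
    by split; [exact: Z1|move=> f _; apply].
  exists (fun f => homogeneous f /\ forall m, Z m -> vanishes_at f m).
  split=> [f []//|m]; split=> -[-> hm]; split=> // f; first by case; apply: hm.
  by move=> hf Zf; apply: hm.
apply/CE; split=> // f Ff; apply: h; first exact: Fh.
by move=> m /ZC /CE[_]; apply.
Qed.

Lemma zclosed_zclosure Z : (forall m, Z m -> \dim m = 1%N) -> zclosed (zclosure Z).
Proof.
move=> Z1; exists (fun f => homogeneous f /\ forall m, Z m -> vanishes_at f m).
split=> [f []//|m]; rewrite zclosureE //.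
by split=> -[-> hm]; split=> // f; [case|move=> ? ?]; apply: hm.
Qed.

Lemma subset_zclosure Z l : Z l -> zclosure Z l.
Proof. by move=> Zl C _; apply. Qed.

Lemma zclosed_dim C l : zclosed C -> C l -> \dim l = 1%N.
Proof. by move=> [F [_ CE]] /CE[]. Qed.

Lemma zclosed_sep C l : zclosed C -> \dim l = 1%N -> ~ C l ->
  exists f, [/\ homogeneous f, forall m, C m -> vanishes_at f m & ~ vanishes_at f l].
Proof.
move=> [F [Fh CE]] l1 Cl; apply: boolp.contrapT => h; apply/Cl/CE; split=> // f Ff.
apply: boolp.contrapT => fl; apply: h; exists f; split=> // [|m /CE[_]]; first exact: Fh.
exact.
Qed.

Lemma zclosed_vanish (F : form -> Prop) : (forall f, F f -> homogeneous f) ->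
  zclosed (fun l => \dim l = 1%N /\ forall f, F f -> vanishes_at f l).
Proof. by move=> Fh; exists F; split. Qed.

Lemma zclosed_ext C C' : (forall l, C l <-> C' l) -> zclosed C -> zclosed C'.
Proof. by move=> h [F [Fh CE]]; exists F; split=> // l; rewrite -h. Qed.

Lemma zclosedI C C' : zclosed C -> zclosed C' -> zclosed (fun l => C l /\ C' l).
Proof.
move=> [F [Fh CE]] [F' [Fh' CE']]; exists (fun f => F f \/ F' f); split=> [f []|l].
- exact: Fh.
- exact: Fh'.
rewrite CE CE'; split=> [[[-> h] [_ h']]|[-> h]].
  by split=> // f [/h|/h'].
by split; split=> // f Ff; apply: h; [left|right].
Qed.

Lemma zirreducible_form f g C : zirreducible C -> homogeneous f -> homogeneous g ->
  (forall l, C l -> \dim l = 1%N) ->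
  (forall l, C l -> vanishes_at (f * g) l) ->
  (forall l, C l -> vanishes_at f l) \/ (forall l, C l -> vanishes_at g l).
Proof.
move=> [_ irr] fh gh C1 fg.
have [] := irr (fun l => \dim l = 1%N /\ forall f', f' = f -> vanishes_at f' l)
  (fun l => \dim l = 1%N /\ forall f', f' = g -> vanishes_at f' l).
- by apply: zclosed_vanish => _ ->.
- by apply: zclosed_vanish => _ ->.
- move=> l Cl; have l1 := C1 l Cl; have [v v0 lE] := dim1_line l1.
  have := fg l Cl; rewrite lE => /vanishes_line.
  move=> /(_ (homogeneousM fh gh)); rewrite mevalM => /eqP.
  rewrite mulf_eq0 => /orP[] /eqP h; [left|right]; split; rewrite -?lE // => _ ->;
    by rewrite lE; apply/vanishes_line.
- by move=> h; left=> l /h[_]; apply.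
by move=> h; right=> l /h[_]; apply.
Qed.

Section Parametrised.
Variables (W : lmodType K) (phi : W -> E) (d : nat).
Hypothesis phiP : pmap d phi.

Lemma pline_form k f : f \is k.-homog -> pline (d * k) (fun w => f.@[coords (phi w)]).
Proof. by move=> fk; apply: pline_meval fk _ => i; apply: pmap_coords. Qed.

(** A form that is nonzero at phi w would also be nonzero at some phi v with g v nonzero. The factor
    [lam (phi w)] ensures that phi v is nonzero, hence defines a point. *)
Lemma pmap_limit C k (g : W -> K) w1 : zclosed C -> pline k g -> g w1 != 0 ->
  (forall w, g w != 0 -> phi w != 0 -> C <[phi w]>%VS) ->
  forall w, phi w != 0 -> C <[phi w]>%VS.
Proof.
move=> [F [Fh CE]] pg g1 h w w0; apply/CE; split=> [|f Ff]; first exact: dim_line.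
have [k' fk] := Fh f Ff; apply/vanishes_line; first exact: Fh.
apply/eqP/negPn/negP => fw; have [lam lw] := exists_scalar w0.
have p1 := plineM (pline_form fk) (phiP lam).
have n1 : f.@[coords (phi w)] * lam (phi w) != 0 by rewrite mulf_neq0.
have [v [+ gv]] := pline_nz2 p1 pg n1 g1.
rewrite mulf_eq0 negb_or => /andP[fv lv].
have v0 : phi v != 0 by apply: contra_neq lv => ->; rewrite linear0.
have /CE[_ /(_ f Ff)] := h v gv v0.
by move/(vanishes_line _ (Fh f Ff)) => /eqP; rewrite (negPf fv).
Qed.

Definition param_closure := zclosure (fun l => exists2 w, phi w != 0 & l = <[phi w]>%VS).

Lemma param_dim m : (exists2 w, phi w != 0 & m = <[phi w]>%VS) -> \dim m = 1%N.
Proof. by move=> [w w0 ->]; apply: dim_line. Qed.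

Lemma zclosed_param : zclosed param_closure.
Proof. exact: zclosed_zclosure param_dim. Qed.

Lemma param_closure_vanish f : homogeneous f ->
  (forall w, f.@[coords (phi w)] = 0) -> forall l, param_closure l -> vanishes_at f l.
Proof.
move=> fh h l; rewrite /param_closure zclosureE; last exact: param_dim.
by move=> [_]; apply=> // _ [w _ ->]; apply/vanishes_line.
Qed.

(** If neither closed set contained the closure, two forms vanishing on them would be nonzero at
    points of the image, and by [pline_nz2] at a common one. *)
Lemma zirreducible_param w0 : phi w0 != 0 -> zirreducible param_closure.
Proof.
move=> n0; split; first by exists <[phi w0]>%VS; apply: subset_zclosure; exists w0.
move=> A B Ac Bc AB; apply: boolp.contrapT => /boolp.not_orP[].
have sep D : zclosed D -> ~ (forall l, param_closure l -> D l) ->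
    exists f k w, [/\ homogeneous f, pline k (fun w => f.@[coords (phi w)]),
      f.@[coords (phi w)] != 0, phi w != 0 & forall l, D l -> vanishes_at f l].
  move=> Dc nD; have [w [w0' Dw]] : exists w, phi w != 0 /\ ~ D <[phi w]>%VS.
    apply: boolp.contrapT => h; apply: nD => l; apply=> // _ [w w1 ->].
    by apply: boolp.contrapT => Dw; apply: h; exists w.
  have [f [fh fD fw]] := zclosed_sep Dc (dim_line w0') Dw.
  have [k fk] := fh; exists f, (d * k)%N, w; split=> //; first exact: pline_form.
  by apply/eqP => fw0; apply: fw; apply/vanishes_line.
move=> /(sep _ Ac)[f [k [w [fh fp fw w1 fA]]]] /(sep _ Bc)[g [k' [w' [gh gp gw w1' gB]]]].
have [lam lw] := exists_scalar w1.
have n1 : f.@[coords (phi w)] * lam (phi w) != 0 by rewrite mulf_neq0.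
have [v [+ gv]] := pline_nz2 (plineM fp (phiP lam)) gp n1 gw.
rewrite mulf_eq0 negb_or => /andP[fv lv].
have v0 : phi v != 0 by apply: contra_neq lv => ->; rewrite linear0.
have [] := AB <[phi v]>%VS; first by apply: subset_zclosure; exists v.
- by move/fA/(vanishes_line _ fh)/eqP; rewrite (negPf fv).
by move/gB/(vanishes_line _ gh)/eqP; rewrite (negPf gv).
Qed.
End Parametrised.
End Closures.

(** * Krull dimension *)

Section Chains.
Variables (K : numFieldType) (E : vectType K).
Implicit Types (l : {vspace E}) (Z C : {vspace E} -> Prop) (v : E).
Local Notation form := {mpoly K[\dim {:E}]}.
Implicit Types f g : form.

Lemma pline_grid (S : finType) d (g : {ffun S -> K^o} -> K) : pline d g ->
  (forall n : {ffun S -> 'I_d.+1}, g [ffun x => (n x)%:R] = 0) -> forall a, g a = 0.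
Proof.
move=> pg h.
(* Coordinates are released from the grid one at a time; s lists those that are already
   arbitrary. *)
have step (s : seq S) : forall a : {ffun S -> K^o},
    (forall x, x \notin s -> exists n : 'I_d.+1, a x = n%:R) -> g a = 0.
  elim: s => [|x s IH] a ha.
    have [n nE] := boolp.choice (fun x => ha x isT).
    by rewrite -[RHS](h [ffun x => n x]); congr (g _); apply/ffunP => x; rewrite !ffunE.
  pose dx : {ffun S -> K^o} := [ffun y => (y == x)%:R].
  have [p [sp pE]] := pg (a - (a x : K) *: dx) dx.
  suff p0 : p = 0 by rewrite -[a](subrK ((a x : K) *: dx)) -pE p0 horner0.
  apply: poly_grid_eq0 sp _ => n; rewrite pE; apply: IH => y ys.
  have ev : (a - (a x : K) *: dx + n%:R *: dx) y =
      (a y : K) - (a x : K) * (y == x)%:R + n%:R * (y == x)%:R by rewrite !ffunE.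
  rewrite ev; have [->|yx] := eqVneq y x; first by exists n; rewrite /= !mulr1 subrr add0r.
  have [|k ak] := ha y; first by rewrite inE negb_or yx.
  by exists k; rewrite /= !mulr0 subr0 addr0.
by move=> a; apply: (step (enum S)) => x; rewrite mem_enum.
Qed.

(** Linear independence in the homogeneous coordinate ring of C. *)
Definition indep_on C (B : finType) (g : B -> form) := forall c : B -> K,
  (forall l, C l -> vanishes_at (\sum_b c b *: g b) l) -> forall b, c b = 0.

Lemma vanishesM f g l : vanishes_at f l -> vanishes_at (f * g) l.
Proof. by move=> h v /h; rewrite mevalM => ->; rewrite mul0r. Qed.

Lemma vanishesB f g l : vanishes_at (f + g) l -> vanishes_at g l -> vanishes_at f l.
Proof. by move=> h h' v vl; have := h v vl; rewrite mevalD h' // addr0. Qed.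

Lemma zirreducibleX f n C : zirreducible C -> homogeneous f ->
  (forall l, C l -> \dim l = 1%N) ->
  (forall l, C l -> vanishes_at (f ^+ n) l) -> forall l, C l -> vanishes_at f l.
Proof.
move=> irr fh C1; elim: n => [h l Cl|n IH h].
  have [v v0 lE] := dim1_line (C1 l Cl).
  have := h l Cl v; rewrite lE memv_line expr0 meval1 => /(_ isT)/eqP.
  by rewrite oner_eq0.
have [d fd] := fh.
have gh : homogeneous (f ^+ n) by exists (d * n)%N; apply: dhomogMn.
have h' l : C l -> vanishes_at (f * f ^+ n) l by move=> Cl; rewrite -exprS; apply: h.
by have [//|/IH] := zirreducible_form irr fh gh C1 h'.
Qed.

Section Step.
Variables (C C' : {vspace E} -> Prop) (B : finType) (g : B -> form) (D m : nat) (f f0 : form).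
Hypotheses (irrC : zirreducible C) (irrC' : zirreducible C').
Hypotheses (C1 : forall l, C l -> \dim l = 1%N) (C1' : forall l, C' l -> \dim l = 1%N).
Hypothesis CC' : forall l, C l -> C' l.
Hypotheses (gD : forall b, g b \is D.-homog) (fm : f \is m.-homog) (f0m : f0 \is m.-homog).
Hypotheses (fC : forall l, C l -> vanishes_at f l) (fC' : ~ forall l, C' l -> vanishes_at f l).
Hypotheses (f0C : ~ forall l, C l -> vanishes_at f0 l) (ind : indep_on C g).

Let h (c : B -> K) := \sum_b c b *: g b.

Let hD c : h c \is D.-homog.
Proof. by apply: rpred_sum => b _; apply/dhomogZ/gD. Qed.

(** On C, where f vanishes, only the term j = 0 survives, and cancelling f0 there gives c 0 = 0.
    What is left is divisible by f, which can be cancelled on the irreducible C' since f is not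
    identically zero there. The powers of f0 equalise the degrees. *)
Lemma indep_step N (c : nat -> B -> K) :
  (forall l, C' l -> vanishes_at (\sum_(j < N) f ^+ j * f0 ^+ (N - j) * h (c j)) l) ->
  forall j, (j < N)%N -> forall b, c j b = 0.
Proof.
elim: N c => [//|N IH] c hc.
pose r : form := \sum_(j < N) f ^+ j * f0 ^+ (N - j) * h (c j.+1).
have rh : r \is (m * N + D).-homog.
  apply: rpred_sum => j _; apply: dhomogM (hD _).
  have -> : (m * N = m * j + m * (N - j))%N by rewrite -mulnDr subnKC // ltnW.
  by apply: dhomogM; apply: dhomogMn.
have e : \sum_(j < N.+1) f ^+ j * f0 ^+ (N.+1 - j) * h (c j) = f0 ^+ N.+1 * h (c 0%N) + f * r.
  rewrite big_ord_recl expr0 mul1r subn0; congr (_ + _); rewrite /r mulr_sumr.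
  by apply: eq_bigr => j _; rewrite /= /bump /= add1n subSS exprS !mulrA.
have c0 : forall b, c 0%N b = 0.
  apply: ind; have [] := @zirreducible_form _ _ (f0 ^+ N.+1) (h (c 0%N)) C irrC.
  - by exists (m * N.+1)%N; apply: dhomogMn.
  - by exists D.
  - exact: C1.
  - move=> l Cl; apply: (@vanishesB _ (f * r)); last by apply: vanishesM; apply: fC.
    by rewrite -e; apply/hc/CC'.
  - by move=> h0; case: f0C; apply: zirreducibleX h0 => //; exists m.
  by [].
have h0 : h (c 0%N) = 0 by apply: big1 => b _; rewrite c0 scale0r.
case=> [//|j]; rewrite ltnS => jN; apply: (IH (fun j => c j.+1)) => //.
have [] := @zirreducible_form _ _ f r C' irrC'.
- by exists m.
- by eexists; exact: rh.
- exact: C1'.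
- by move=> l Cl; have := hc l Cl; rewrite e h0 mulr0 add0r.
- by move=> ff; case: fC'.
by [].
Qed.

Lemma indep_product N : indep_on C' (fun jb : 'I_N * B => f ^+ jb.1 * f0 ^+ (N - jb.1) * g jb.2).
Proof.
move=> c hc [j b].
pose c' (i : nat) b := if insub i is Some i' then c (i', b) else 0.
have c'E (i : 'I_N) b' : c' i b' = c (i, b') by rewrite /c' valK.
rewrite -c'E; apply: (@indep_step N c') => // l Cl; have := hc l Cl.
congr vanishes_at; rewrite (eq_bigr (fun p => c (p.1, p.2) *: (f ^+ p.1 * f0 ^+ (N - p.1) * g p.2)));
  last by case.
rewrite -(pair_bigA _ (fun i b => c (i, b) *: (f ^+ i * f0 ^+ (N - i) * g b))) /=.
apply: eq_bigr => i _; rewrite /h mulr_sumr; apply: eq_bigr => b' _.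
by rewrite c'E scalerAr.
Qed.
End Step.

Section ChainIndependence.
Variables (C : nat -> {vspace E} -> Prop) (d : nat).
Hypothesis Ccl : forall i, (i <= d)%N -> zclosed (C i).
Hypothesis Cirr : forall i, (i <= d)%N -> zirreducible (C i).
Hypothesis Clt : forall i, (i < d)%N ->
  (forall l, C i l -> C i.+1 l) /\ (exists l, C i.+1 l /\ ~ C i l).

(** Growth of the Hilbert function: each strict inclusion multiplies the number of independent forms
    by N and raises their degree by mN, where m is the degree of a form that vanishes on the smaller
    set only. *)
Lemma chain_indep i : (i <= d)%N -> exists M, forall N, exists (B : finType) (g : B -> form),
  [/\ #|B| = (N ^ i)%N, forall b, g b \is (M * N).-homog & indep_on (C i) g].
Proof.
elim: i => [|i IH] id.
  exists 0%N => N; exists unit, (fun _ => 1); split; first by rewrite card_unit expn0.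
    by move=> _; rewrite mul0n dhomog1.
  move=> c hc []; have [[l Cl] _] := Cirr id.
  have [v v0 lE] := dim1_line (zclosed_dim (Ccl id) Cl).
  have := hc l Cl v; rewrite lE memv_line (bigD1 tt) //= big1 => [|[]//].
  by rewrite addr0 mevalZ meval1 mulr1; apply.
have id' := ltnW id; have [M IHM] := IH id'.
have [CC [l [Cl nCl]]] := Clt id.
have l1 := zclosed_dim (Ccl id) Cl.
have [f [[m fm] fC fl]] := zclosed_sep (Ccl id') l1 nCl.
have [[l0 Cl0] _] := Cirr id'.
have [v v0 l0E] := dim1_line (zclosed_dim (Ccl id') Cl0).
have [lam lv] := exists_scalar v0; have [g0 g01 g0E] := meval_coords_lin lam.
exists (M + m)%N => N; have [B [g [cB gh gi]]] := IHM N.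
exists (('I_N * B)%type : finType), (fun jb : 'I_N * B => f ^+ jb.1 * (g0 ^+ m) ^+ (N - jb.1) * g jb.2); split.
- by rewrite card_prod card_ord cB expnS.
- move=> [j b] /=; rewrite mulnDl addnC; apply: dhomogM (gh b).
  have -> : (m * N = m * j + m * (N - j))%N by rewrite -mulnDr subnKC // ltnW.
  apply: dhomogM; apply: dhomogMn => //.
  by have := dhomogMn m g01; rewrite mul1n.
apply: (@indep_product (C i) (C i.+1) B g (M * N)%N m) => //; try exact: Cirr.
- by move=> l2; apply: zclosed_dim; apply: Ccl.
- by move=> l2; apply: zclosed_dim; apply: Ccl.
- by have := dhomogMn m g01; rewrite mul1n.
- by move=> h; apply/fl/h.
move=> h; have := h l0 Cl0 v; rewrite l0E memv_line rmorphXn /= g0E => /(_ isT)/eqP.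
by rewrite expf_eq0 (negPf lv) andbF.
Qed.
End ChainIndependence.

(* A chain of length d gives, for each N, N^d independent forms of degree O(N).
   On a chart with at most r parameters such forms are determined by their
   values at the O(N^r) points of a grid. *)
Lemma zchain_bound r Z d :
  (forall l, Z l -> exists (S : finType) (p : form) k (phi : {ffun S -> K^o} -> E),
    [/\ (#|S| <= r)%N, homogeneous p, pmap k phi, ~ vanishes_at p l &
      forall m, Z m -> ~ vanishes_at p m -> exists a, m = <[phi a]>%VS]) ->
  zchain Z d -> (d <= r)%N.
Proof.
move=> chart [C [Cp Clt]]; rewrite leqNgt; apply/negP => rd.
have Ccl i : (i <= d)%N -> zclosed (C i) by case/Cp.
have Cirr i : (i <= d)%N -> zirreducible (C i) by case/Cp.
have [Cd_cl Cd_irr CdZ] := Cp d (leqnn d).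
have [[l Cl] _] := Cd_irr.
have [S [p [k [phi [Sr ph pphi pl pchart]]]]] := chart l (CdZ l Cl).
have Sd := leq_ltn_trans Sr rd.
have [M HM] := chain_indep Ccl Cirr Clt (leqnn d).
(* The grid has at most ((kM + 1) N)^e points and there are N^d forms, with d > e. The choice of N
   gives (kM + 1)^e < N, so the forms outnumber the points. *)
set e := #|S| in Sd; pose N := ((k * M).+1 ^ e).+1.
have [B [g [cB gh gi]]] := HM N.
pose D := (k * (M * N))%N.
pose pt (n : {ffun S -> 'I_D.+1}) : {ffun S -> K^o} := [ffun x => (n x)%:R].
pose A := \matrix_(b < #|B|, n < #|{: {ffun S -> 'I_D.+1}}|)
   (g (enum_val b)).@[coords (phi (pt (enum_val n)))].
have small : (#|{: {ffun S -> 'I_D.+1}}| < #|B|)%N.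
  rewrite card_ffun card_ord cB -/e.
  have N0 : (0 < N)%N by [].
  apply: (@leq_trans (N ^ e.+1)); last by rewrite leq_pexp2l.
  rewrite expnS; apply: (@leq_ltn_trans (((k * M).+1 * N) ^ e)).
    have DN : (D.+1 <= (k * M).+1 * N)%N by rewrite mulSn /D mulnA -add1n leq_add2r.
    by case: (e) => [|e']; rewrite ?expn0 ?leq_exp2r.
  by rewrite expnMn ltn_pmul2r ?expn_gt0 ?N0.
(* A vector of the left kernel is a combination of the forms that vanishes on the grid, hence on the
   chart. Its product with p vanishes on C d, and irreducibility removes p. *)
have : kermx A != 0.
  rewrite -mxrank_eq0 mxrank_ker -lt0n subn_gt0.
  by apply: leq_ltn_trans small; apply: rank_leq_col.
case/rowV0Pn => c /sub_kermxP cA c0.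
pose c' b := c 0 (enum_rank b).
have h0 : forall a, (\sum_b c' b *: g b).@[coords (phi a)] = 0.
  have hh : \sum_b c' b *: g b \is (M * N).-homog.
    by apply: rpred_sum => b _; apply/dhomogZ/gh.
  apply: (pline_grid (pline_form pphi hh)) => n.
  rewrite -/(pt n) raddf_sum /=.
  transitivity ((c *m A) 0 (enum_rank n)); last by rewrite cA mxE.
  rewrite mxE.
  rewrite (reindex (@enum_val B predT)) /=; last by apply: onW_bij; apply: enum_val_bij.
  by apply: eq_bigr => b _; rewrite mevalZ /c' enum_valK !mxE enum_rankK.
suff c'0 : forall b, c' b = 0.
  case/eqP: c0; apply/rowP => b; rewrite mxE -[b]enum_valK; exact: c'0.
apply: gi => m Cm.
have := @zirreducible_form _ _ p (\sum_b c' b *: g b) (C d) Cd_irr ph.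
case=> //.
- by exists (M * N)%N; apply: rpred_sum => b _; apply/dhomogZ/gh.
- by move=> l'; apply: zclosed_dim.
- move=> l' Cl'; have [pv|pv] := boolp.pselect (vanishes_at p l'); first exact: vanishesM.
  rewrite mulrC; apply: vanishesM; have [a ->] := pchart l' (CdZ l' Cl') pv.
  apply/vanishes_line => //; exists (M * N)%N; apply: rpred_sum => b _; exact/dhomogZ/gh.
- by move=> h; case: pl; apply: h.
by apply.
Qed.

Lemma has_dim_ex Z d0 b : zchain Z d0 -> (forall e, zchain Z e -> (e <= b)%N) ->
  exists2 d, has_dim Z d & (d0 <= d)%N.
Proof.
move=> c0 cb; pose P := fun d => boolp.asbool (zchain Z d).
have exP : exists d, P d by exists d0; apply/boolp.asboolP.
have Pb d : P d -> (d <= b)%N by move/boolp.asboolP/cb.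
have [d /boolp.asboolP Zd dmax] := ex_maxnP exP Pb.
exists d; last by apply/dmax/boolp.asboolP.
by split=> // e Ze; apply/dmax/boolp.asboolP.
Qed.

Lemma zchain_sub Z Z' d : (forall l, Z l -> Z' l) -> zchain Z d -> zchain Z' d.
Proof.
move=> ZZ [C [h1 h2]]; exists C; split=> // i /h1[h3 h4 h5]; split=> // l /h5; exact: ZZ.
Qed.

Section Flag.
Variables (O : vectType K) (phi : O -> E) (d k : nat) (h : O -> K).
Hypotheses (phiP : pmap d phi) (hP : pline k h) (h0 : h 0 != 0) (phi0 : phi 0 != 0).
Hypothesis lamP : forall i : 'I_(\dim {:O}), exists lam : {scalar E},
  forall w, lam (phi w) = coord (vbasis {:O}) i w * h w.

Let P (i : nat) (w : O) : O := \sum_(j < \dim {:O} | (j < i)%N) coord (vbasis {:O}) j w *: (vbasis {:O})`_j.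

Let Plin i : linear (P i).
Proof.
move=> c v w; rewrite /P scaler_sumr -big_split; apply: eq_bigr => j _ /=.
by rewrite linearP scalerDl scalerA.
Qed.

Let coordP i j w : coord (vbasis {:O}) j (P i w) = if (j < i)%N then coord (vbasis {:O}) j w else 0.
Proof.
have fr := basis_free (vbasisP {:O}).
rewrite /P linear_sum /= big_mkcond /= (bigD1 j) //= big1 ?addr0 => [|j' jj']; case: ifP => // _.
  by rewrite linearZ /= coord_free // eqxx mulr1.
by rewrite linearZ /= coord_free // (negbTE jj') mulr0.
Qed.

Let P_P i j w : (i <= j)%N -> P j (P i w) = P i w.
Proof.
move=> ij; rewrite [P j _]/P [RHS](coord_vbasis (memvf _)).
rewrite big_mkcond; apply: eq_bigr => s _; case: ifP => // sj.
by rewrite coordP ifF ?scale0r //; apply: contraFF sj => si; apply: leq_trans si ij.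
Qed.

Let pmapP i : pmap d (phi \o P i).
Proof.
move=> f w v; have [p [sp pE]] := phiP f (P i w) (P i v).
by exists p; split=> // t; rewrite pE /= [w + _]addrC Plin addrC.
Qed.

(** The members are the closures of the images of the spans of the first i basis vectors. The form
    [lam] for the next coordinate vanishes on one member and not on the following one, because h,
    being nonzero at 0, is generically nonzero on each span. *)
Lemma flag_chain Z : zclosed Z -> (forall w, phi w != 0 -> Z <[phi w]>%VS) ->
  zchain Z (\dim {:O}).
Proof.
move=> Zcl Zphi; exists (fun i => param_closure (phi \o P i)); split=> [i _|i ilt].
  have P0 : P i 0 = 0 by have := Plin i (-1) 0 0; rewrite scaler0 addr0 scaleN1r addNr.
  split; first exact: zclosed_param.
    by apply: (zirreducible_param (pmapP i) (w0 := 0)); rewrite /= P0.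
  by move=> l; apply=> // _ [w w0 ->]; apply: Zphi.
split=> [l|].
  apply; first exact: zclosed_param.
  move=> _ [w w0 ->]; apply: subset_zclosure; exists (P i w) => /=; by rewrite (P_P _ (leqnSn i)).
have [lam lamE] := lamP (Ordinal ilt).
pose b := (vbasis {:O})`_i.
have pc : pline 1 (fun w => coord (vbasis {:O}) (Ordinal ilt) w).
  exact: (pline_lin (coord (vbasis {:O}) (Ordinal ilt) : {scalar O})).
have ph : pline k (fun w => h (P i.+1 w)).
  move=> w v; have [p [sp pE]] := hP (P i.+1 w) (P i.+1 v).
  by exists p; split=> // t; rewrite pE [w + _]addrC Plin addrC.
have nb : coord (vbasis {:O}) (Ordinal ilt) b != 0.
  by rewrite (coord_free (Ordinal ilt) (Ordinal ilt)) ?(basis_free (vbasisP _)) // eqxx oner_eq0.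
have nh : h (P i.+1 0) != 0.
  by have := Plin i.+1 (-1) 0 0; rewrite scaler0 addr0 scaleN1r addNr => ->.
have [w [cw hw]] := pline_nz2 pc ph nb nh.
have lw : lam (phi (P i.+1 w)) != 0 by rewrite lamE coordP /= ltnSn mulf_neq0.
have w0 : phi (P i.+1 w) != 0 by apply: contra_neq lw => ->; rewrite linear0.
exists <[phi (P i.+1 w)]>%VS; split; first by apply: subset_zclosure; exists w.
have [f f1 fE] := meval_coords_lin lam.
have fh : homogeneous f by exists 1%N.
move/(@param_closure_vanish _ _ _ (phi \o P i) f fh) => fv.
have : vanishes_at f <[phi (P i.+1 w)]>%VS.
  by apply: fv => v; rewrite fE /= lamE coordP /= ltnn mul0r.
by move/(vanishes_line _ fh); rewrite fE; apply/eqP.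
Qed.
End Flag.
End Chains.

(** * The Grassmannian of lines *)

Section QuadraticForms.
Variables (K : numFieldType) (E : vectType K).
Local Notation form := {mpoly K[\dim {:E}]}.

(** Quadratic equations are produced together with their differentials, as needed for tangent
    spaces. *)
Lemma quadric_form (b : E -> E -> K) :
  (forall y, linear_for *%R (b^~ y)) -> (forall x, linear_for *%R (b x)) ->
  exists f : form, [/\ f \is 2.-homog, forall v, f.@[coords v] = b v v &
    forall p v, \sum_i (f^`M(i)).@[coords p] * coords v i = b p v + b v p].
Proof.
move=> bl br; pose X (i : 'I_(\dim {:E})) := (vbasis {:E})`_i.
have bE x y : b x y = \sum_i \sum_j coords x i * coords y j * b (X i) (X j).
  pose B1 y : {scalar E} := HB.pack (b^~ y) (GRing.isLinear.Build K E K *%R (b^~ y) (bl y)).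
  pose B2 x : {scalar E} := HB.pack (b x) (GRing.isLinear.Build K E K *%R (b x) (br x)).
  rewrite -[LHS]/(B1 y x) {1}(coord_vbasis (memvf x)) linear_sum; apply: eq_bigr => i _.
  rewrite linearZ /= -[b _ y]/(B2 (X i) y) {1}(coord_vbasis (memvf y)) linear_sum mulr_sumr.
  by apply: eq_bigr => j _; rewrite linearZ mulrA.
exists (\sum_i \sum_j (b (X i) (X j)) *: ('X_i * 'X_j)); split.
- apply: rpred_sum => i _; apply: rpred_sum => j _; apply: dhomogZ.
  by rewrite (_ : 2%N = (1 + 1)%N) //; apply: dhomogM; rewrite dhomogX; apply/eqP/mdeg1.
- move=> v; rewrite bE raddf_sum; apply: eq_bigr => i _ /=; rewrite raddf_sum; apply: eq_bigr => j _ /=.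
  by rewrite mevalZ mevalM !mevalXU mulrC.
move=> p v.
pose D (g : form) : K := \sum_k (g^`M(k)).@[coords p] * coords v k.
have Dl : linear_for *%R D.
  move=> c g h; rewrite /D mulr_sumr -big_split; apply: eq_bigr => k _ /=.
  by rewrite mderivD mderivZ mevalD mevalZ mulrDl mulrA.
pose D' : {linear form -> K | *%R} := HB.pack D (GRing.isLinear.Build K form K *%R D Dl).
have DX i j : D ('X_i * 'X_j) = coords p i * coords v j + coords v i * coords p j.
  have dX (i' k : 'I_(\dim {:E})) : (('X_i' : form)^`M(k)).@[coords p] = (k == i')%:R.
    rewrite mderivX mevalZ mnm1E eq_sym; have [->|_] := eqVneq k i'; last by rewrite mul0r.
    by rewrite mevalX big1 ?mulr1 // => s _; rewrite mnmBE subnn expr0.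
  have sX i' : \sum_k (k == i')%:R * coords v k = coords v i'.
    rewrite (bigD1 i') //= eqxx mul1r big1 ?addr0 // => k /negbTE ->; by rewrite mul0r.
  rewrite /D (eq_bigr (fun k => coords p i * ((k == j)%:R * coords v k) + coords p j * ((k == i)%:R * coords v k))).
    by rewrite big_split /= -!mulr_sumr !sX [coords v i * _]mulrC.
  by move=> k _; rewrite mderivM mevalD !mevalM !dX !mevalXU; ring.
rewrite -/(D _) -[D _]/(D' _) linear_sum [b p v]bE [b v p]bE -big_split; apply: eq_bigr => i _ /=.
rewrite -[D _]/(D' _) linear_sum -big_split; apply: eq_bigr => j _ /=.
by rewrite -[D _]/(D' _) linearZ /= DX; ring.
Qed.
End QuadraticForms.

Lemma regular_scale (K : fieldType) (c : K) (z : K^o) : c *: z = c * z.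
Proof. by []. Qed.

Section Wedge.
Variables (K : numFieldType) (E : vectType K) (V : {vspace E}).
Implicit Types (x y v : E) (w : ext2 V).
Local Notation m := (\dim V).
Local Notation b i := (vbasis V)`_i.
Local Notation wedge := (wedge V).

(** The antisymmetric matrix of the bivector, whose coordinates are stored for i < j only; an absent
    pair counts as 0. *)
Definition entry w (i j : 'I_m) : K :=
  (if insub (i, j) is Some p then w p : K else 0) - (if insub (j, i) is Some p then w p : K else 0).

(** Contraction with the i-th coordinate form. *)
Definition contract w (i : 'I_m) : E := \sum_k entry w i k *: b k.

Let coordLin c x y i : coord (vbasis V) i (c *: x + y) = c * coord (vbasis V) i x + coord (vbasis V) i y.
Proof. by rewrite linearP. Qed.

Lemma wedge_linl y : linear (wedge^~ y).
Proof.
move=> c x x'; apply/ffunP => p; rewrite !ffunE /= !coordLin.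
by rewrite regular_scale; ring.
Qed.

Lemma wedge_linr x : linear (wedge x).
Proof.
move=> c y y'; apply/ffunP => p; rewrite !ffunE /= !coordLin.
by rewrite regular_scale; ring.
Qed.

Lemma wedgeC x y : wedge y x = - wedge x y.
Proof. by apply/ffunP => p; rewrite !ffunE /= opprB [in RHS]mulrC; congr (_ - _); rewrite mulrC. Qed.

Lemma wedgexx x : wedge x x = 0.
Proof. by apply/ffunP => p; rewrite !ffunE /= mulrC subrr. Qed.

Lemma wedgeDl x x' y : wedge (x + x') y = wedge x y + wedge x' y.
Proof. by have := wedge_linl y 1 x x'; rewrite !scale1r. Qed.
Lemma wedgeDr x y y' : wedge x (y + y') = wedge x y + wedge x y'.
Proof. by have := wedge_linr x 1 y y'; rewrite !scale1r. Qed.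
Lemma wedge0l y : wedge 0 y = 0.
Proof. by have := wedge_linl y (-1) 0 0; rewrite scaler0 addr0 scaleN1r addNr. Qed.
Lemma wedge0r x : wedge x 0 = 0.
Proof. by rewrite wedgeC wedge0l oppr0. Qed.
Lemma wedgeZl c x y : wedge (c *: x) y = c *: wedge x y.
Proof. by have := wedge_linl y c x 0; rewrite wedge0l !addr0. Qed.
Lemma wedgeZr c x y : wedge x (c *: y) = c *: wedge x y.
Proof. by have := wedge_linr x c y 0; rewrite wedge0r !addr0. Qed.
Definition wedgeE := (wedgeDl, wedgeDr, wedgeZl, wedgeZr, wedgexx).

Lemma entryP w p : w p = entry w (val p).1 (val p).2.
Proof.
rewrite /entry; have -> : insub ((val p).1, (val p).2) = Some p.
  by rewrite -surjective_pairing valK.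
rewrite insubF ?subr0 //=; apply/negbTE; rewrite -leqNgt; exact: ltnW (valP p).
Qed.

Lemma entryC w i j : entry w i j = - entry w j i.
Proof. by rewrite /entry opprB. Qed.

Lemma entry_lin i j : linear_for *%R (fun w => entry w i j).
Proof.
move=> c w w'; rewrite /entry; case: insub => [p|]; case: insub => [q|];
  rewrite ?ffunE /= ?regular_scale; ring.
Qed.

Lemma entry_wedge x y i j : entry (wedge x y) i j =
  coord (vbasis V) i x * coord (vbasis V) j y - coord (vbasis V) j x * coord (vbasis V) i y.
Proof.
rewrite /entry; case: insubP => [p ij pE|ij]; case: insubP => [q ji qE|ji] /=.
- by have := ltn_trans ij ji; rewrite ltnn.
- by rewrite ffunE pE /= subr0.
- by rewrite ffunE qE /= sub0r opprB.
move: ij ji; rewrite /= -!leqNgt => ji ij.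
have ijE : i = j by apply: ord_inj; apply/eqP; rewrite eqn_leq ij ji.
by rewrite ijE !subrr.
Qed.

Lemma contract_lin i : linear (fun w => contract w i).
Proof.
move=> c w w'; rewrite /contract scaler_sumr -big_split; apply: eq_bigr => k _ /=.
by rewrite entry_lin scalerDl scalerA.
Qed.

Lemma contract_mem w i : contract w i \in V.
Proof. by apply: memv_suml => k _; apply/memvZ/vbasis_mem/mem_nth; rewrite size_tuple. Qed.

Lemma contract_wedge x y i : x \in V -> y \in V ->
  contract (wedge x y) i = coord (vbasis V) i x *: y - coord (vbasis V) i y *: x.
Proof.
move=> xV yV; rewrite {2}(coord_vbasis yV) {3}(coord_vbasis xV) !scaler_sumr -sumrB.
by apply: eq_bigr => k _; rewrite entry_wedge scalerBl !scalerA [coord _ k x * _]mulrC.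
Qed.

(** Both contractions lie in the plane of x and y, and [entry w i j] is the determinant that
    expresses them in terms of x and y. These are the Pluecker relations. *)
Lemma wedge_plucker x y i j : x \in V -> y \in V -> let w := wedge x y in
  entry w i j *: w = wedge (contract w i) (contract w j).
Proof.
move=> xV yV /=; rewrite !contract_wedge // entry_wedge -!scaleNr !wedgeE (wedgeC x y).
move: (coord _ i x) (coord _ j x) (coord _ i y) (coord _ j y) => a1 a2 a3 a4.
by vring.
Qed.

Lemma entry_neq0 w : w != 0 -> exists p, w p != 0.
Proof.
move=> w0; apply: boolp.contrapT => h; case/eqP: w0; apply/ffunP => p; rewrite ffunE.
by apply/eqP/negPn/negP => wp; apply: h; exists p.
Qed.

Lemma wedge_eq0 x y : x \in V -> y \in V -> x != 0 -> wedge x y = 0 -> exists k, y = k *: x.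
Proof.
move=> xV yV x0 xy0; have [i xi] : exists i, coord (vbasis V) i x != 0.
  apply: boolp.contrapT => h; case/eqP: x0; rewrite (coord_vbasis xV); apply: big1 => i _.
  have [->|xi] := eqVneq (coord (vbasis V) i x) 0; first by rewrite scale0r.
  by case: h; exists i.
have := contract_wedge i xV yV; rewrite xy0 /contract big1 => [/esym/subr0_eq h|k _].
  exists (coord (vbasis V) i y / coord (vbasis V) i x).
  by rewrite mulrC -scalerA -h scalerK.
by rewrite -(wedgexx 0) entry_wedge !linear0 !mul0r subrr scale0r.
Qed.

Lemma wedge_neq0_indep x y a c : wedge x y != 0 -> a *: x + c *: y = 0 -> a = 0 /\ c = 0.
Proof.
move=> n0 h; have h1 := congr1 (wedge x) h; have h2 := congr1 (wedge^~ y) h.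
rewrite wedge0r !wedgeE scaler0 add0r in h1; rewrite wedge0l !wedgeE scaler0 addr0 in h2.
by move/eqP: h1; move/eqP: h2; rewrite !scaler_eq0 (negPf n0) !orbF => /eqP -> /eqP ->.
Qed.

Lemma wedge_dim2 x y : wedge x y != 0 -> \dim (<[x]> + <[y]>)%VS = 2%N.
Proof.
move=> n0; have : free [:: x; y].
  apply/freeP => c; rewrite !big_ord_recl big_ord0 addr0 /= => /(wedge_neq0_indep n0)[c0 c1] i.
  case: i => [[|[|//]] hi]; [rewrite -c0|rewrite -c1]; congr c; exact: val_inj.
by rewrite /free span_cons span_seq1 => /eqP.
Qed.

Lemma plucker_wedge (L : {vspace E}) x y : (L <= V)%VS -> \dim L = 2%N ->
  x \in L -> y \in L -> wedge x y != 0 -> plucker V L = <[wedge x y]>%VS.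
Proof.
move=> LV L2 xL yL n0; rewrite /plucker.
have sb : size (vbasis L) = 2%N by rewrite size_tuple.
have ex v : v \in L -> exists a c, v = a *: (vbasis L)`_0 + c *: (vbasis L)`_1.
  move=> vL; move: (coord_vbasis vL); move: (coord (vbasis L)) (vbasis L); rewrite L2 => f B.
  by rewrite !big_ord_recl big_ord0 addr0 /= => ->; do 2!eexists.
have [a [c xE]] := ex x xL; have [a' [c' yE]] := ex y yL.
have wE : wedge x y = (a * c' - c * a') *: wedge (vbasis L)`_0 (vbasis L)`_1.
  rewrite xE yE !wedgeE (wedgeC (vbasis L)`_0 (vbasis L)`_1) !scaler0 add0r addr0 !scalerN !scalerA.
  by rewrite -scalerBl.
have k0 : a * c' - c * a' != 0 by apply: contra_neq n0 => k0; rewrite wE k0 scale0r.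
apply/eqP; rewrite wE eqEsubv -!memvE; apply/andP; split; last by rewrite memvZ ?memv_line.
by apply/vlineP; exists (a * c' - c * a')^-1; rewrite scalerK.
Qed.

Lemma grass2_wedge x y : x \in V -> y \in V -> wedge x y != 0 -> grass2 V <[wedge x y]>%VS.
Proof.
move=> xV yV n0; have LV : (<[x]> + <[y]> <= V)%VS by rewrite subv_add -!memvE xV.
exists (<[x]> + <[y]>)%VS; split=> //; first exact: wedge_dim2.
rewrite (@plucker_wedge _ x y) ?wedge_dim2 //.
  by rewrite memvE addvSl.
by rewrite memvE addvSr.
Qed.

Lemma grass2P l : grass2 V l <->
  exists x y, [/\ x \in V, y \in V, wedge x y != 0 & l = <[wedge x y]>%VS].
Proof.
split=> [[L [LV L2 ->]]|[x [y [xV yV n0 ->]]]]; last exact: grass2_wedge.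
have sb : size (vbasis L) = 2%N by rewrite size_tuple.
have xL : (vbasis L)`_0 \in L by apply/vbasis_mem/mem_nth; rewrite sb.
have yL : (vbasis L)`_1 \in L by apply/vbasis_mem/mem_nth; rewrite sb.
have xV := subvP LV _ xL; have yV := subvP LV _ yL.
exists (vbasis L)`_0, (vbasis L)`_1; split=> //; apply/negP => /eqP w0.
have LE : L = (<[(vbasis L)`_0]> + <[(vbasis L)`_1]>)%VS.
  rewrite -{1}(span_basis (vbasisP L)); case: (tval (vbasis L)) sb => [|x [|y []]] //= _.
  by rewrite span_cons span_seq1.
have small (v : E) (U : {vspace E}) : (L <= <[v]>)%VS -> False.
  by move/dimvS; rewrite L2 dim_vline; case: (_ == _).
have [x0|x0] := eqVneq (vbasis L)`_0 0.
  by apply: (small (vbasis L)`_1 L); rewrite {1}LE x0 subv_add subvv andbT -memvE mem0v.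
have [k yE] := wedge_eq0 xV yV x0 w0.
apply: (small (vbasis L)`_0 L); rewrite {1}LE subv_add subvv /= -memvE yE memvZ ?memv_line //.
Qed.

Lemma grass2_dim l : grass2 V l -> \dim l = 1%N.
Proof. by move/grass2P => [x [y [_ _ n0 ->]]]; apply: dim_line. Qed.

(* The Pluecker relations, polarised. *)
Lemma plucker_quadric (B : {scalar ext2 V}) i j :
  exists f : {mpoly K[\dim {:ext2 V}]}, [/\ f \is 2.-homog,
    forall w, f.@[coords w] = entry w i j * B w - B (wedge (contract w i) (contract w j)) &
    forall w t, \sum_k (f^`M(k)).@[coords w] * coords t k =
      entry w i j * B t + entry t i j * B w
      - B (wedge (contract w i) (contract t j)) - B (wedge (contract t i) (contract w j))].
Proof.
pose be w w' := entry w i j * B w' - B (wedge (contract w i) (contract w' j)).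
have bl w' : linear_for *%R (be^~ w').
  by move=> c u v; rewrite /be entry_lin contract_lin wedgeDl wedgeZl linearP /=; ring.
have br w : linear_for *%R (be w).
  by move=> c u v; rewrite /be contract_lin wedgeDr wedgeZr !linearP /=; ring.
have [f [f2 fE fD]] := quadric_form bl br; exists f; split=> // w t.
by rewrite fD /be; ring.
Qed.

Lemma zclosed_grass2 : zclosed (grass2 V).
Proof.
apply: (zclosed_ext (C := fun l => \dim l = 1%N /\ forall f, (homogeneous f /\
  forall x y, x \in V -> y \in V -> f.@[coords (wedge x y)] = 0) -> vanishes_at f l)).
  move=> l; split=> [[l1 h]|]; last first.
    move=> /grass2P [x [y [xV yV n0 ->]]]; split; first exact: dim_line.
    by move=> f [fh fE]; apply/vanishes_line => //; apply: fE.
  have [w w0 lE] := dim1_line l1; have [p wp] := entry_neq0 w0.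
  rewrite entryP in wp; set i := (val p).1 in wp; set j := (val p).2 in wp.
  (* The relations for a single pair with [entry w i j] nonzero suffice, as they already write w as
     a wedge of two vectors of V. *)
  have wE : entry w i j *: w = wedge (contract w i) (contract w j).
    apply/subr0_eq/eqP/negPn/negP => n0; have [B /eqP Bn] := exists_scalar n0.
    have [f [f2 fE _]] := plucker_quadric B i j; have fh : homogeneous f by exists 2%N.
    apply: Bn; rewrite linearB linearZ /= -fE; apply/vanishes_line => //.
    rewrite -lE; apply: h; split=> // x y xV yV.
    by rewrite fE -wedge_plucker // linearZ subrr.
  apply/grass2P; exists ((entry w i j)^-1 *: contract w i), (contract w j).
  have e : wedge ((entry w i j)^-1 *: contract w i) (contract w j) = w.
    by rewrite wedgeZl -wE scalerK.
  by rewrite e; split=> //; rewrite ?memvZ ?contract_mem.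
by apply: zclosed_vanish => f [].
Qed.

Section Chart.
Variables (i j : 'I_m) (ij : (i < j)%N).
Let S : finType := (bool * {k : 'I_m | (k != i) && (k != j)})%type.

Let coef (s : bool) (a : {ffun S -> K^o}) (k : 'I_m) : K :=
  if insub k is Some k' then a (s, k') else 0.

Let half s (u : E) (a : {ffun S -> K^o}) : E := u + \sum_k coef s a k *: b k.

Let half_pmap s u : pmap 1 (half s u).
Proof.
have L : linear (fun a : {ffun S -> K^o} => \sum_k coef s a k *: b k).
  move=> c a a'; rewrite scaler_sumr -big_split; apply: eq_bigr => k _ /=.
  rewrite scalerA -scalerDl /coef; congr (_ *: _); case: insub => [k'|]; rewrite ?ffunE ?mulr0 ?addr0 //.
pose F : {linear {ffun S -> K^o} -> E} := HB.pack (fun a : {ffun S -> K^o} => \sum_k coef s a k *: b k)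
  (GRing.isLinear.Build K {ffun S -> K^o} E *:%R _ L).
have pu : pmap 1 (fun _ : {ffun S -> K^o} => u) := pmap_le (leq0n 1) (@pmap_cst _ _ _ u).
exact: (pmap_ext _ (pmapD pu (pmap_linear F))).
Qed.

(** Once the (i, j) entry is 1, the two contractions are b_j and - b_i plus combinations of the
    remaining basis vectors, whose coefficients are the 2 (m - 2) parameters. *)
Lemma grass2_chart : exists phi : {ffun S -> K^o} -> ext2 V, pmap 2 phi /\
  forall w, entry w i j = 1 -> w = wedge (contract w i) (contract w j) -> exists a, w = phi a.
Proof.
exists (fun a => wedge (half false (b j) a) (half true (- b i) a)); split.
  apply: (pmap_bilinear (d := 1) (d' := 1) wedge_linl wedge_linr); exact: half_pmap.
move=> w wij wE; exists [ffun s => entry w (if s.1 then j else i) (val s.2)].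
have ji : j != i by rewrite neq_ltn ij orbT.
rewrite {1}wE; congr (wedge _ _); rewrite /half /contract.
  rewrite (bigD1 i) //= [X in _ = _ + X](bigD1 i) //=.
  rewrite (bigD1 j) //= [X in _ = _ + (_ + X)](bigD1 j) //=.
  rewrite {1 2}/coef !insubF ?eqxx ?andbF // !scale0r !add0r wij scale1r.
  have -> : entry w i i = 0 by rewrite /entry subrr.
  rewrite scale0r add0r; congr (_ + _); apply: eq_bigr => k /andP[ki kj]; congr (_ *: _).
  by rewrite /coef insubT ?ki ?kj // => kk; rewrite ffunE /=.
rewrite (bigD1 i) //= [X in _ = _ + X](bigD1 i) //=.
rewrite (bigD1 j) //= [X in _ = _ + (_ + X)](bigD1 j) //=.
rewrite {1 2}/coef !insubF ?eqxx ?andbF // !scale0r !add0r.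
have -> : entry w j j = 0 by rewrite /entry subrr.
have -> : entry w j i = -1 by rewrite entryC wij.
rewrite scale0r add0r scaleN1r; congr (_ + _); apply: eq_bigr => k /andP[ki kj]; congr (_ *: _).
by rewrite /coef insubT ?ki ?kj // => kk; rewrite ffunE /=.
Qed.

Lemma card_chart : #|S| = (2 * (m - 2))%N.
Proof.
rewrite card_prod card_bool card_sig; congr (_ * _)%N.
have c := cardC [pred k : 'I_m | (k != i) && (k != j)]; rewrite card_ord in c.
have c2 : #|[predC [pred k : 'I_m | (k != i) && (k != j)]]| = 2%N.
  transitivity #|[set i; j]|; first by apply: eq_card => k; rewrite !inE negb_and !negbK.
  by rewrite cards2 neq_ltn ij.
by rewrite -[LHS](addnK 2) -[X in (_ + X)%N]c2 c.
Qed.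
End Chart.

Lemma zchain_grass2 d : zchain (grass2 V) d -> (d <= 2 * (m - 2))%N.
Proof.
apply: zchain_bound => l /grass2P [x [y [xV yV n0 lE]]].
have [p wp] := entry_neq0 n0; have ij := valP p.
have [phi [phiP phiE]] := grass2_chart ij.
pose lp : {scalar ext2 V} := HB.pack (fun w => entry w (val p).1 (val p).2)
  (GRing.isLinear.Build K (ext2 V) K *%R _ (entry_lin (val p).1 (val p).2)).
have [f f1 fE] := meval_coords_lin lp; have fh : homogeneous f by exists 1%N.
exists (bool * {k : 'I_m | (k != (val p).1) && (k != (val p).2)})%type, f, 2%N, phi; split=> //.
- by rewrite (card_chart ij).
- by rewrite lE vanishes_line // fE /= -entryP; apply/eqP.
move=> _ /grass2P [x' [y' [xV' yV' n0' ->]]]; rewrite vanishes_line // fE /= => /eqP e0.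
set w := wedge x' y' in e0 *; pose w1 := (entry w (val p).1 (val p).2)^-1 *: w.
have w11 : entry w1 (val p).1 (val p).2 = 1.
  have := entry_lin (val p).1 (val p).2 (entry w (val p).1 (val p).2)^-1 w 0; rewrite addr0 => ->.
  by rewrite mulVf // /entry; do 2!case: insub => [?|]; rewrite ?ffunE ?subr0 addr0.
have [|a aE] := phiE w1 w11.
  have w1E : w1 = wedge ((entry w (val p).1 (val p).2)^-1 *: x') y' by rewrite wedgeZl.
  by rewrite -[LHS]scale1r -w11 w1E wedge_plucker // memvZ.
exists a; rewrite -aE /w1.
apply/eqP; rewrite eqEsubv -!memvE; apply/andP; split; last by rewrite memvZ ?memv_line.
by apply/vlineP; exists (entry w (val p).1 (val p).2); rewrite scalerA divff ?scale1r.
Qed.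
End Wedge.

(** * Cayley-Dickson algebras *)

Section CubicIdentity.
Variables (K : numClosedFieldType) (J : vectType K) (mul : J -> J -> J) (e : J) (tr : {scalar J}).
Local Notation "x ** y" := (mul x y) (at level 40, left associativity).
Hypothesis mulC : commutative mul.
Hypothesis mulP : forall c x x' y, (c *: x + x') ** y = c *: (x ** y) + x' ** y.
Hypothesis mul1 : forall x, e ** x = x.
Hypothesis tr1 : tr e = 3.
Hypothesis trA : forall x y z, tr ((x ** y) ** z) = tr (x ** (y ** z)).
Hypothesis cubic : forall x, exists d,
  x ** (x ** x - tr x *: x + ((tr x ^+ 2 - tr (x ** x)) / 2) *: e) = d *: e.

Lemma cayley_of_cubic x z :
  let t := tr x in let s := (t ^+ 2 - tr (x ** x)) / 2 in
    2 *: (x ** (x ** z)) + (x ** x) ** z =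
      (2 * t) *: (x ** z) + tr z *: (x ** x) - s *: z
      + (tr (x ** z) - t * tr z) *: x
      + (tr ((x ** x) ** z) - t * tr (x ** z) + s * tr z) *: e.
Proof.
have m0 y : 0 ** y = 0 by have := mulP (-1) 0 0 y; rewrite scaler0 addr0 scaleN1r addNr.
have mD x1 x2 y : (x1 + x2) ** y = x1 ** y + x2 ** y by have := mulP 1 x1 x2 y; rewrite !scale1r.
have mZ c x1 y : (c *: x1) ** y = c *: (x1 ** y) by have := mulP c x1 0 y; rewrite m0 !addr0.
have mN x1 y : (- x1) ** y = - (x1 ** y) by rewrite -!scaleN1r mZ.
have mDr x1 x2 y : y ** (x1 + x2) = y ** x1 + y ** x2 by rewrite !(mulC y) mD.
have mZr c x1 y : y ** (c *: x1) = c *: (y ** x1) by rewrite !(mulC y) mZ.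
have mNr x1 y : y ** (- x1) = - (y ** x1) by rewrite !(mulC y) mN.
have m1 y : y ** e = y by rewrite mulC mul1.
have mE := (mD, mZ, mN, mDr, mZr, mNr, mul1, m1).
have tD y y' : tr (y + y') = tr y + tr y' by rewrite linearD.
have tN y : tr (- y) = - tr y by rewrite linearN.
have tZ c y : tr (c *: y) = c * tr y by rewrite linearZ.
have tE := (tD, tN, tZ).
pose s y := (tr y ^+ 2 - tr (y ** y)) / 2.
(* The cubic equation times 3; its trace determines d, which is thereby eliminated. *)
pose P y := 3 *: (y ** (y ** y)) - (3 * tr y) *: (y ** y) + (3 * s y) *: y
  - (tr (y ** (y ** y)) - tr y * tr (y ** y) + s y * tr y) *: e.
have P0 y : P y = 0.
  have [d dE] := cubic y; have := congr1 tr dE; rewrite !mE !tE tr1 => h.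
  rewrite !mE in dE; apply: (lincomb1 (c := 3) dE); rewrite /P /s.
  have -> : tr (y ** (y ** y)) - tr y * tr (y ** y) + (tr y ^+ 2 - tr (y ** y)) / 2 * tr y = 3 * d.
    by rewrite [3 * d]mulrC -h; ring.
  vring.
(* The left side is twice the part of P (x + z) that is linear in z. As P carries a factor 3, the
   coefficient 1/6 follows. *)
have h : P (x + z) - P (x - z) - 2 *: P z = 0 by rewrite !P0 scaler0 !subr0.
rewrite /=; apply: (lincomb1 (c := 1 / 6) h); rewrite /P /s !mE.
have C1 : z ** x = x ** z by rewrite mulC.
have t1 : tr (x ** (x ** z)) = tr (x ** x ** z) by rewrite trA.
have t2 : tr (z ** (x ** x)) = tr (x ** x ** z) by rewrite mulC.
have t3 : tr (z ** (x ** z)) = tr (x ** (z ** z)) by rewrite mulC trA.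
have t4 : tr (z ** (z ** x)) = tr (x ** (z ** z)) by rewrite C1 t3.
rewrite !tE C1 !t1 !t2 !t3 (mulC (x ** x) z).
vprep; move: (tr x) (tr z) (tr (x ** z)) (tr (x ** x)) (tr (z ** z)) => *.
generalize (tr (x ** x ** z)) (tr (x ** (z ** z))) (tr (x ** (x ** x))) (tr (z ** (z ** z))).
by move=> *; field.
Qed.
End CubicIdentity.

Section CayleyDicksonTheory.
Variable K : numClosedFieldType.
Implicit Types n : nat.

Lemma cdmulDl n (x y z : cd K n) : cdmul (x + y) z = cdmul x z + cdmul y z.
Proof. by have := cdmulPl 1 x y z; rewrite !scale1r. Qed.
Lemma cdmulDr n (x y z : cd K n) : cdmul z (x + y) = cdmul z x + cdmul z y.
Proof. by have := cdmulPr 1 x y z; rewrite !scale1r. Qed.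
Lemma cdmul0l n (z : cd K n) : cdmul 0 z = 0.
Proof. by have := cdmulPl (-1) 0 0 z; rewrite scaler0 addr0 scaleN1r addNr. Qed.
Lemma cdmul0r n (z : cd K n) : cdmul z 0 = 0.
Proof. by have := cdmulPr (-1) 0 0 z; rewrite scaler0 addr0 scaleN1r addNr. Qed.
Lemma cdmulZl n c (x z : cd K n) : cdmul (c *: x) z = c *: cdmul x z.
Proof. by have := cdmulPl c x 0 z; rewrite cdmul0l !addr0. Qed.
Lemma cdmulZr n c (x z : cd K n) : cdmul z (c *: x) = c *: cdmul z x.
Proof. by have := cdmulPr c x 0 z; rewrite cdmul0r !addr0. Qed.
Lemma cdmulNl n (x z : cd K n) : cdmul (- x) z = - cdmul x z.
Proof. by rewrite -!scaleN1r cdmulZl. Qed.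
Lemma cdmulNr n (x z : cd K n) : cdmul z (- x) = - cdmul z x.
Proof. by rewrite -!scaleN1r cdmulZr. Qed.

Lemma cdmul1 n (x : cd K n) : cdmul (cdone K n) x = x /\ cdmul x (cdone K n) = x.
Proof.
elim: n x => [|n IH] x /=; first by rewrite mul1r mulr1.
have IHl y := (IH y).1; have IHr y := (IH y).2.
rewrite !cdconj1 raddf0 !(cdmul0r, cdmul0l, IHl, IHr) !subr0 add0r addr0.
by case: x.
Qed.
Lemma cdmul1l n (x : cd K n) : cdmul (cdone K n) x = x. Proof. by have [] := cdmul1 x. Qed.
Lemma cdmul1r n (x : cd K n) : cdmul x (cdone K n) = x. Proof. by have [] := cdmul1 x. Qed.

Definition cdmulE := (cdmulDl, cdmulDr, cdmulNl, cdmulNr, cdmulZl, cdmulZr, cdmul0l, cdmul0r,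
  cdmul1l, cdmul1r).

Lemma cdreD n (x y : cd K n) : cdre (x + y) = cdre x + cdre y. Proof. exact: linearD. Qed.
Lemma cdreN n (x : cd K n) : cdre (- x) = - cdre x. Proof. exact: linearN. Qed.
Lemma cdreZ n c (x : cd K n) : cdre (c *: x) = c * cdre x. Proof. exact: linearZ. Qed.
Lemma cdconjD n (x y : cd K n) : cdconj (x + y) = cdconj x + cdconj y. Proof. exact: linearD. Qed.
Lemma cdconjN n (x : cd K n) : cdconj (- x) = - cdconj x. Proof. exact: linearN. Qed.
Lemma cdconjZ n c (x : cd K n) : cdconj (c *: x) = c *: cdconj x. Proof. exact: linearZ. Qed.
Lemma cdre1 n : cdre (cdone K n) = 1. Proof. by elim: n. Qed.
Lemma cdre_conj n (x : cd K n) : cdre (cdconj x) = cdre x.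
Proof. by elim: n x => [|n IH] x //=. Qed.

Lemma cdreMC n (x y : cd K n) : cdre (cdmul x y) = cdre (cdmul y x).
Proof.
elim: n x y => [|n IH] x y /=; first by rewrite mulrC.
by rewrite !cdreD !cdreN IH -[cdre (cdmul _ x.2)]cdre_conj cdconjM cdconjK.
Qed.

Lemma cdreMA n (x y z : cd K n) : cdre (cdmul (cdmul x y) z) = cdre (cdmul x (cdmul y z)).
Proof.
elim: n x y z => [|n IH] x y z /=; first by rewrite mulrA.
have cyc (a b c : cd K n) : cdre (cdmul (cdmul a b) c) = cdre (cdmul (cdmul b c) a).
  by rewrite IH cdreMC.
rewrite [cdconj (_ + _)]raddfD /= !cdconjM cdconjK !(cdmulDl, cdmulDr, cdmulNl, cdmulNr) !(cdreD, cdreN) -!IH.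
rewrite (cyc x.1 (cdconj z.2)) (cyc (cdconj y.1)) (cyc z.1).
by ring.
Qed.

Lemma cd_conj_sum n (x : cd K n) : x + cdconj x = (2 * cdre x) *: cdone K n.
Proof.
elim: n x => [|n IH] x /=; first by rewrite regular_scale; ring.
by apply: injective_projections; rewrite /= ?IH // scaler0 subrr.
Qed.

Lemma cd_self_conj n (x : cd K n) : cdconj x = x -> x = cdre x *: cdone K n.
Proof.
move=> h; have := cd_conj_sum x; rewrite h => h2.
by apply: (lincomb1 (c := 1 / 2) h2); vfield.
Qed.

(** The symmetric bilinear form with value q(x) at (x, x). *)
Definition cdform n (x y : cd K n) : K := cdre (cdmul x (cdconj y)).

Lemma cdformC n (x y : cd K n) : cdform x y = cdform y x.
Proof. by rewrite /cdform -cdre_conj cdconjM cdconjK. Qed.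
Lemma cdform_conj n (x y : cd K n) : cdform (cdconj x) (cdconj y) = cdform x y.
Proof. by rewrite /cdform cdconjK cdreMC -cdre_conj cdconjM cdconjK. Qed.
Lemma cdformDl n (x y z : cd K n) : cdform (x + y) z = cdform x z + cdform y z.
Proof. by rewrite /cdform cdmulDl cdreD. Qed.
Lemma cdformZl n c (x z : cd K n) : cdform (c *: x) z = c * cdform x z.
Proof. by rewrite /cdform cdmulZl cdreZ. Qed.
Lemma cdformNl n (x z : cd K n) : cdform (- x) z = - cdform x z.
Proof. by rewrite -scaleN1r cdformZl mulN1r. Qed.
Lemma cdformDr n (x y z : cd K n) : cdform z (x + y) = cdform z x + cdform z y.
Proof. by rewrite !(cdformC z) cdformDl. Qed.
Lemma cdformZr n c (x z : cd K n) : cdform z (c *: x) = c * cdform z x.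
Proof. by rewrite !(cdformC z) cdformZl. Qed.
Lemma cdformNr n (x z : cd K n) : cdform z (- x) = - cdform z x.
Proof. by rewrite !(cdformC z) cdformNl. Qed.
Lemma cdform0l n (z : cd K n) : cdform 0 z = 0.
Proof. by rewrite -[0](scale0r z) cdformZl mul0r. Qed.
Lemma cdform0r n (z : cd K n) : cdform z 0 = 0.
Proof. by rewrite cdformC cdform0l. Qed.
Definition cdformE := (cdformDl, cdformDr, cdformNl, cdformNr, cdformZl, cdformZr, cdform0l, cdform0r).

Lemma cdform_cyc n (u v w : cd K n) :
  cdform (cdconj (cdmul v w)) u = cdform (cdconj (cdmul w u)) v.
Proof.
rewrite -[LHS]cdform_conj -[RHS]cdform_conj !cdconjK /cdform !cdconjK.
by rewrite cdreMA cdreMC.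
Qed.

Lemma cd_polar n (x y : cd K n) :
  cdmul x (cdconj y) + cdmul y (cdconj x) = (2 * cdform x y) *: cdone K n.
Proof.
have := cd_conj_sum (cdmul x (cdconj y)); by rewrite cdconjM cdconjK.
Qed.

Lemma cdform_nondeg n (x : cd K n) : (forall y, cdform x y = 0) -> x = 0.
Proof.
elim: n x => [|n IH] x h.
  by have := h (1 : K^o); rewrite /cdform /= mulr1.
apply: injective_projections => /=; apply: IH => y.
  by have := h (y, 0); rewrite /cdform /= oppr0 raddf0 cdmul0l subr0.
have := h (0, y); rewrite /cdform /= raddf0 cdmul0r sub0r [cdconj (- _)]raddfN cdmulNl opprK.
by rewrite cdreMC.
Qed.

(** Alternativity combined with the norm relation, checked in coordinates for each n; it fails
    beyond the octonions, which is the source of the bound on n. *)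
Lemma cdmul_altl n (x y : cd K n) : (n <= 3)%N ->
  cdmul x (cdmul (cdconj x) y) = cdform x x *: y.
Proof.
rewrite /cdform; case: n x y => [|[|[|[|//]]]].
- by move=> x y _ /=; rewrite regular_scale; ring.
- move=> [x1 x2] [y1 y2] _.
  by apply: injective_projections; rewrite /= regular_scale; ring.
- move=> [[x1 x2] [x3 x4]] [[y1 y2] [y3 y4]] _.
  by do 2!apply: injective_projections; rewrite /= regular_scale; ring.
move=> [[[x1 x2] [x3 x4]] [[x5 x6] [x7 x8]]] [[[y1 y2] [y3 y4]] [[y5 y6] [y7 y8]]] _.
by do 3!apply: injective_projections; rewrite /= regular_scale; ring.
Qed.

Lemma cdmul_altr n (x y : cd K n) : (n <= 3)%N ->
  cdmul (cdmul y (cdconj x)) x = cdform x x *: y.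
Proof.
move=> n3; apply: (can_inj (@cdconjK K n)); rewrite !cdconjM cdconjK linearZ /=.
by have := cdmul_altl (cdconj x) (cdconj y) n3; rewrite cdconjK cdform_conj.
Qed.
End CayleyDicksonTheory.

(** * Hermitian matrices *)

Section Coordinates.
Variables (K : numClosedFieldType) (n : nat).
Local Notation A := (cd K n).
Local Notation J := (J3 K n).
Implicit Types (a b c : K) (u v w : A) (X Y Z : J).

Let o0 : 'I_3 := Ordinal (isT : 0 < 3)%N.
Let o1 : 'I_3 := Ordinal (isT : 1 < 3)%N.
Let o2 : 'I_3 := Ordinal (isT : 2 < 3)%N.

Lemma ord3_sum (V : nmodType) (F : 'I_3 -> V) : \sum_i F i = F o0 + F o1 + F o2.
Proof.
rewrite !big_ord_recl big_ord0 addr0 addrA.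
by congr (_ + _ + _); congr F; apply: val_inj.
Qed.

Lemma ord3_ind (P : 'I_3 -> Prop) : P o0 -> P o1 -> P o2 -> forall i, P i.
Proof.
move=> h0 h1 h2 [[|[|[|//]]] i3].
- by rewrite (_ : Ordinal i3 = o0) //; apply: val_inj.
- by rewrite (_ : Ordinal i3 = o1) //; apply: val_inj.
by rewrite (_ : Ordinal i3 = o2) //; apply: val_inj.
Qed.

(** Freudenthal coordinates: u, v, w sit at (1, 2), (2, 0), (0, 1), so that all product formulas are
    invariant under cyclic rotation. *)
Definition mkfun a b c u v w (i j : nat) : A :=
  match i, j with
  | 0, 0 => a *: cdone K n | 1, 1 => b *: cdone K n | 2, 2 => c *: cdone K n
  | 1, 2 => u | 2, 1 => cdconj u
  | 2, 0 => v | 0, 2 => cdconj v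
  | 0, 1 => w | 1, 0 => cdconj w
  | _, _ => 0
  end.

Definition mkmat a b c u v w : mat3 K n := [ffun p => mkfun a b c u v w (p.1 : 'I_3) (p.2 : 'I_3)].

Lemma mk_herm a b c u v w : mkmat a b c u v w \in herm3 K n.
Proof.
apply/herm3P/ffunP => -[i j]; rewrite !ffunE /=.
by elim/ord3_ind: i; elim/ord3_ind: j; rewrite /= ?linearZ /= ?cdconj1 ?cdconjK.
Qed.

Definition mk a b c u v w : J := Subvs (mk_herm a b c u v w).

Lemma val_mk a b c u v w (i j : 'I_3) : vsval (mk a b c u v w) (i, j) = mkfun a b c u v w i j.
Proof. by rewrite /= ffunE. Qed.

Lemma J3_eq X Y : (forall i j, vsval X (i, j) = vsval Y (i, j)) -> X = Y.
Proof. by move=> h; apply/val_inj/ffunP => -[i j]; apply: h. Qed.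

Lemma J3_mk X : exists a b c u v w, X = mk a b c u v w.
Proof.
have hX i j : cdconj (vsval X (j, i)) = vsval X (i, j).
  by have /herm3P/ffunP/(_ (i, j)) := subvsP X; rewrite ffunE.
exists (cdre (vsval X (o0, o0))), (cdre (vsval X (o1, o1))), (cdre (vsval X (o2, o2))),
  (vsval X (o1, o2)), (vsval X (o2, o0)), (vsval X (o0, o1)).
apply: J3_eq => i j; rewrite val_mk.
by elim/ord3_ind: i; elim/ord3_ind: j; rewrite /= -?cd_self_conj ?hX.
Qed.

Lemma mk_lin k a b c u v w a' b' c' u' v' w' :
  k *: mk a b c u v w + mk a' b' c' u' v' w' =
  mk (k * a + a') (k * b + b') (k * c + c') (k *: u + u') (k *: v + v') (k *: w + w').
Proof.
apply: J3_eq => i j; rewrite val_mk.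
rewrite [LHS](_ : _ = k *: mkfun a b c u v w i j + mkfun a' b' c' u' v' w' i j).
  by elim/ord3_ind: i; elim/ord3_ind: j; rewrite /= ?linearP //= scalerA -scalerDl.
by rewrite /= !ffunE.
Qed.

Lemma mk0 : mk 0 0 0 0 0 0 = 0.
Proof.
have := mk_lin (-1) 0 0 0 0 0 0 0 0 0 0 0 0; rewrite !mulr0 !addr0 !scaler0 => <-.
by rewrite scaleN1r addNr.
Qed.

Lemma mkZ k a b c u v w : k *: mk a b c u v w = mk (k * a) (k * b) (k * c) (k *: u) (k *: v) (k *: w).
Proof. by have := mk_lin k a b c u v w 0 0 0 0 0 0; rewrite mk0 !addr0. Qed.

Lemma mkD a b c u v w a' b' c' u' v' w' : mk a b c u v w + mk a' b' c' u' v' w' =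
  mk (a + a') (b + b') (c + c') (u + u') (v + v') (w + w').
Proof. by have := mk_lin 1 a b c u v w a' b' c' u' v' w'; rewrite !scale1r !mul1r. Qed.

Lemma jtrace_mk a b c u v w : jtrace (mk a b c u v w) = a + b + c.
Proof. by rewrite /jtrace ord3_sum !val_mk /= !cdreZ !cdre1 !mulr1. Qed.

Lemma jone_mk : jone K n = mk 1 1 1 0 0 0.
Proof.
apply: J3_eq => i j; rewrite val_mk /= ffunE /=.
by elim/ord3_ind: i; elim/ord3_ind: j; rewrite /= ?raddf0 ?scale1r.
Qed.

Lemma jmul_mk a b c u v w a' b' c' u' v' w' :
  jmul (mk a b c u v w) (mk a' b' c' u' v' w') =
  mk (a * a' + cdform v v' + cdform w w') (b * b' + cdform u u' + cdform w w')
     (c * c' + cdform u u' + cdform v v')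
     (2^-1 *: ((b + c) *: u' + (b' + c') *: u + cdconj (cdmul v w') + cdconj (cdmul v' w)))
     (2^-1 *: ((c + a) *: v' + (c' + a') *: v + cdconj (cdmul w u') + cdconj (cdmul w' u)))
     (2^-1 *: ((a + b) *: w' + (a' + b') *: w + cdconj (cdmul u v') + cdconj (cdmul u' v))).
Proof.
apply: J3_eq => i j; rewrite val_mk.
pose M := mkfun a b c u v w; pose M' := mkfun a' b' c' u' v' w'.
rewrite [LHS](_ : _ = 2^-1 *: ((cdmul (M i 0%N) (M' 0%N j) + cdmul (M i 1%N) (M' 1%N j) + cdmul (M i 2%N) (M' 2%N j)) +
   (cdmul (M' i 0%N) (M 0%N j) + cdmul (M' i 1%N) (M 1%N j) + cdmul (M' i 2%N) (M 2%N j)))); last first.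
  by rewrite /= !ffunE !ord3_sum !ffunE.
rewrite {}/M {}/M'.
have pol := @cd_polar K n.
have polr x y : cdmul (cdconj x) y + cdmul (cdconj y) x = (2 * cdform x y) *: cdone K n.
  by have := cd_polar (cdconj x) (cdconj y); rewrite !cdconjK cdform_conj.
elim/ord3_ind: i; elim/ord3_ind: j;
  rewrite /= ?linearZ /= ?[cdconj (_ + _)]raddfD /= ?cdconjM ?cdconjK !cdmulE.
- by apply: (lincomb2 (c := 1 / 2) (c' := 1 / 2) (pol w w') (polr v v')); vfield.
- by vfield.
- by rewrite ?raddfD /= ?linearZ /= ?cdconjM ?cdconjK; vfield.
- by rewrite ?raddfD /= ?linearZ /= ?cdconjM ?cdconjK; vfield.
- by apply: (lincomb2 (c := 1 / 2) (c' := 1 / 2) (pol u u') (polr w w')); vfield.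
- by vfield.
- by vfield.
- by rewrite ?raddfD /= ?linearZ /= ?cdconjM ?cdconjK; vfield.
- by apply: (lincomb2 (c := 1 / 2) (c' := 1 / 2) (pol v v') (polr u u')); vfield.
Qed.

Lemma jtrace_jmul_mk a b c u v w a' b' c' u' v' w' :
  jtrace (jmul (mk a b c u v w) (mk a' b' c' u' v' w')) =
  a * a' + b * b' + c * c' + 2 * cdform u u' + 2 * cdform v v' + 2 * cdform w w'.
Proof. by rewrite jmul_mk jtrace_mk; ring. Qed.

Lemma jmul1 X : jmul (jone K n) X = X.
Proof.
have [a [b [c [u [v [w ->]]]]]] := J3_mk X; rewrite jone_mk jmul_mk !cdmul0l !cdmul0r ?raddf0.
rewrite !cdformE !mul1r ?scaler0 !addr0.
by congr mk; vfield.
Qed.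

Lemma jtrace1 : jtrace (jone K n) = 3.
Proof. by rewrite jone_mk jtrace_mk; ring. Qed.

Lemma jtraceA X Y Z : jtrace (jmul (jmul X Y) Z) = jtrace (jmul X (jmul Y Z)).
Proof.
have [a1 [b1 [c1 [u1 [v1 [w1 ->]]]]]] := J3_mk X; have [a2 [b2 [c2 [u2 [v2 [w2 ->]]]]]] := J3_mk Y.
have [a3 [b3 [c3 [u3 [v3 [w3 ->]]]]]] := J3_mk Z.
rewrite !(jmul_mk a1) !(jmul_mk a2) !jtrace_jmul_mk !cdformE.
have fl (u v w : A) : cdform u (cdconj (cdmul v w)) = cdform (cdconj (cdmul v w)) u by rewrite cdformC.
have t2 (u v w : A) : cdform (cdconj (cdmul w u)) v = cdform (cdconj (cdmul v w)) u by rewrite [RHS]cdform_cyc.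
have t3 (u v w : A) : cdform (cdconj (cdmul u v)) w = cdform (cdconj (cdmul v w)) u := cdform_cyc w u v.
rewrite !fl !(t2 u1 v2 w3, t2 u1 v3 w2, t2 u2 v1 w3, t2 u2 v3 w1, t2 u3 v1 w2, t2 u3 v2 w1).
rewrite !(t3 u1 v2 w3, t3 u1 v3 w2, t3 u2 v1 w3, t3 u2 v3 w1, t3 u3 v1 w2, t3 u3 v2 w1).
repeat match goal with |- context [@cdform ?K ?n ?x ?y] => generalize (@cdform K n x y); intro end.
by field.
Qed.

Lemma jtrace_nondeg X : (forall Y, jtrace (jmul X Y) = 0) -> X = 0.
Proof.
have [a [b [c [u [v [w ->]]]]]] := J3_mk X => h.
have hh a' b' c' u' v' w' := h (mk a' b' c' u' v' w').
have z0 : (2 : K) != 0 by rewrite pnatr_eq0.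
have d0 (x : A) : (forall y, 2 * cdform x y = 0) -> x = 0.
  by move=> hx; apply: cdform_nondeg => y; apply: (mulfI z0); rewrite hx mulr0.
have -> : a = 0 by have := hh 1 0 0 0 0 0; rewrite jtrace_jmul_mk !cdformE; rewrite !(mulr1, mulr0, addr0).
have -> : b = 0 by have := hh 0 1 0 0 0 0; rewrite jtrace_jmul_mk !cdformE; rewrite !(mulr1, mulr0, addr0, add0r).
have -> : c = 0 by have := hh 0 0 1 0 0 0; rewrite jtrace_jmul_mk !cdformE; rewrite !(mulr1, mulr0, addr0, add0r).
have -> : u = 0 by apply: d0 => y; have := hh 0 0 0 y 0 0; rewrite jtrace_jmul_mk !cdformE; rewrite !(mulr0, addr0, add0r).
have -> : v = 0 by apply: d0 => y; have := hh 0 0 0 0 y 0; rewrite jtrace_jmul_mk !cdformE; rewrite !(mulr0, addr0, add0r).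
have -> : w = 0 by apply: d0 => y; have := hh 0 0 0 0 0 y; rewrite jtrace_jmul_mk !cdformE; rewrite !(mulr0, addr0, add0r).
exact: mk0.
Qed.

Hypothesis n3 : (n <= 3)%N.

(* The adjoint X^2 - tr(X) X + s(X) of X has these coordinates, and the product
   of X with it is det(X), where det is the Freudenthal cubic form. *)
Lemma jmul_cubic X : exists d,
  jmul X (jmul X X - jtrace X *: X + ((jtrace X ^+ 2 - jtrace (jmul X X)) / 2) *: jone K n) = d *: jone K n.
Proof.
have [a [b [c [u [v [w ->]]]]]] := J3_mk X.
pose N x := @cdform K n x x.
have adjE : jmul (mk a b c u v w) (mk a b c u v w) - jtrace (mk a b c u v w) *: mk a b c u v w
    + ((jtrace (mk a b c u v w) ^+ 2 - jtrace (jmul (mk a b c u v w) (mk a b c u v w))) / 2) *: jone K n =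
   mk (b * c - N u) (c * a - N v) (a * b - N w) (cdconj (cdmul v w) - a *: u)
     (cdconj (cdmul w u) - b *: v) (cdconj (cdmul u v) - c *: w).
  rewrite jtrace_jmul_mk jtrace_mk jmul_mk jone_mk [_ - _ *: _]addrC -scaleNr mk_lin addrC mk_lin /N.
  congr mk; first [by vfield | repeat match goal with
    | |- context [@cdform ?K ?n ?x ?y] => generalize (@cdform K n x y); intro end; by field].
have altl (x y : A) : cdmul x (cdmul (cdconj x) y) = N x *: y by apply: cdmul_altl.
have altr (x y : A) : cdmul (cdmul y (cdconj x)) x = N x *: y by apply: cdmul_altr.
have fl (x y z : A) : cdform x (cdconj (cdmul y z)) = cdform (cdconj (cdmul y z)) x by rewrite cdformC.
have c1 : cdform (cdconj (cdmul w u)) v = cdform (cdconj (cdmul v w)) u by rewrite [RHS]cdform_cyc.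
have c2 : cdform (cdconj (cdmul u v)) w = cdform (cdconj (cdmul v w)) u by exact: (cdform_cyc w u v).
exists (a * b * c - a * N u - b * N v - c * N w + 2 * cdform (cdconj (cdmul v w)) u).
rewrite adjE jmul_mk jone_mk.
(* The off-diagonal entries of X times its adjoint vanish by alternativity; by cyclic symmetry one
   computation serves for all three. *)
have off (x y z : A) (p q r : K) :
    2^-1 *: ((q + r) *: (cdconj (cdmul y z) - p *: x) + (r * p - N y + (p * q - N z)) *: x
      + cdconj (cdmul y (cdconj (cdmul x y) - r *: z)) + cdconj (cdmul (cdconj (cdmul z x) - q *: y) z)) = 0.
  have h1 : cdmul y (cdconj (cdmul x y)) = N y *: cdconj x by rewrite cdconjM altl.
  have h2 : cdmul (cdconj (cdmul z x)) z = N z *: cdconj x by rewrite cdconjM altr.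
  rewrite !cdmulE h1 h2 !(cdconjD, cdconjN, cdconjZ) !cdconjK.
  by move: (N y) (N z) => *; vfield.
rewrite !off mkZ !scaler0 !mulr1 !cdformE !fl c1 c2 /N.
by congr mk; ring.
Qed.

Definition J3_cubic : cubic_jordan J := CubicJordan (@jmulC K n) (@jmulPl K n) jmul1
  (jtrace1 : (@jtrace K n : {scalar J}) _ = _) jtraceA jtrace_nondeg
  (cayley_of_cubic (@jmulC K n) (@jmulPl K n) jmul1
    (jtrace1 : (@jtrace K n : {scalar J}) _ = _) jtraceA jmul_cubic).
End Coordinates.

Arguments cmul : simpl never.
Arguments ctr : simpl never.
Arguments cone : simpl never.

(** * Derivations *)

Section Reductions.
Variables (K : numClosedFieldType) (n : nat) (n3 : (n <= 3)%N).
Local Notation J := (J3 K n).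
Local Notation A := (J3_cubic K n3).
Local Notation V := (J30 K n).
Implicit Types (x y z : J) (l : {vspace ext2 V}) (P : {vspace J}).
Local Notation "x ** y" := (cmul A x y) (at level 40, left associativity).
Local Notation "'e" := (cone A).
Local Notation tr := (ctr A).
Local Notation T := (tform A).
Local Notation proj := (@proj_one K n).
Let C := cmulC A.

Lemma projE x : proj x = x - (tr x / 3) *: 'e. Proof. by []. Qed.

Lemma tr_proj x : tr (proj x) = 0.
Proof. by rewrite projE !trE ctr1; field. Qed.

Lemma J30E x : x \in V = (tr x == 0).
Proof. by apply/idP/eqP => /J30P. Qed.

Lemma proj_mem x : proj x \in V.
Proof. by rewrite J30E tr_proj. Qed.

Lemma proj_id x : x \in V -> proj x = x.
Proof. by rewrite J30E projE => /eqP ->; rewrite mul0r scale0r subr0. Qed.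

Lemma proj1 : proj 'e = 0.
Proof. by rewrite projE (ctr1 A) divff ?pnatr_eq0 // scale1r subrr. Qed.

Lemma cmul_linl y : linear (fun x => x ** y). Proof. by move=> c x x'; exact: cmulPl. Qed.
Lemma cmul_linr x : linear (fun y => x ** y). Proof. by move=> c y y'; rewrite !mulE. Qed.

Lemma pmapM (W : lmodType K) d d' (f g : W -> J) :
  pmap d f -> pmap d' g -> pmap (d + d') (fun w => f w ** g w).
Proof. exact: pmap_bilinear cmul_linl cmul_linr. Qed.

Definition disc x := 4 * (T x x / 2) ^+ 3 - 27 * (T (x ** x) x / 3) ^+ 2.

Lemma pline_disc (W : lmodType K) d (f : W -> J) : pmap d f -> exists k, pline k (fun w => disc (f w)).
Proof.
move=> pf.
have h2 : pline (d + d) (fun w => T (f w) (f w)) := pmapM pf pf tr.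
have h3 : pline (d + d + d) (fun w => T (f w ** f w) (f w)) := pmapM (pmapM pf pf) pf tr.
pose k := maxn ((d + d) * 3) ((d + d + d) * 2); exists k.
have p2 : pline k (fun w => 4 * (T (f w) (f w) / 2) ^+ 3).
  apply/plineZ/(pline_le (leq_maxl _ _))/plineX.
  by apply: pline_ext (plineZ 2^-1 h2) => w; rewrite mulrC.
have p3 : pline k (fun w => - 27 * (T (f w ** f w) (f w) / 3) ^+ 2).
  apply/plineZ/(pline_le (leq_maxr _ _))/plineX.
  by apply: pline_ext (plineZ 3^-1 h3) => w; rewrite mulrC.
by apply: pline_ext (plineD p2 p3) => w; rewrite mulNr.
Qed.

(** Traceless with distinct eigenvalues: it shows that [disc] is not identically zero on traceless
    elements. *)
Definition D0 : J := mk 1 0 (-1) 0 0 0.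

Lemma tr_D0 : tr D0 = 0.
Proof. by rewrite [LHS]jtrace_mk; ring. Qed.

Lemma D0_sq : D0 ** D0 = mk 1 0 1 0 0 0.
Proof.
have c0 : cdconj (0 : cd K n) = 0 := raddf0 _.
rewrite [LHS]jmul_mk !cdformE !cdmulE !c0 !(scaler0, addr0).
by congr mk; ring.
Qed.

Lemma disc_D0 : disc D0 != 0.
Proof.
rewrite /disc; have -> : T D0 D0 = 2 by rewrite /tform D0_sq [LHS]jtrace_mk; ring.
have -> : T (D0 ** D0) D0 = 0 by rewrite /tform D0_sq [LHS]jtrace_jmul_mk !cdformE; ring.
by rewrite mul0r expr0n /= mulr0 subr0 divff ?pnatr_eq0 // expr1n mulr1 pnatr_eq0.
Qed.

Lemma pmap_proj : pmap 1 proj.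
Proof. exact: (pmap_linear (proj : {linear J -> J})). Qed.

(* Leibniz alone kills the trace of [u x] when [x] is diagonalisable, and such
   [x] are dense. *)
Lemma so3_derivation (u : 'End(J)) : u \in so3 K n -> derivation A u.
Proof.
move/so3P => uM; have {}uM x y : u (x ** y) = u x ** y + x ** u y by apply: uM.
split=> // x.
have idem y : y ** y = y -> tr (u y) = 0.
  move=> yy; have h := uM y y; rewrite yy in h.
  have h1 := congr1 (T y) h; rewrite TDr -!TA [T (y ** u y) y]TC -TA yy in h1.
  have t0 : T y (u y) = 0 by apply: (addrI (T y (u y))); rewrite addr0 -h1.
  by rewrite h trD !trM TC t0 addr0.
have u1 : u 'e = 0.
  by have := uM 'e 'e; rewrite !mulE => h; apply: (addrI (u 'e)); rewrite addr0 -h.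
have gen y : tr y = 0 -> disc y != 0 -> tr (u y) = 0.
  move=> ty /(spectral ty)[e1 [e2 [e3 [fr [r1 [r2 [r3 [-> _ _ _]]]]]]]].
  have -> : u (comb3 e1 e2 e3 r1 r2 r3) = r1 *: u e1 + r2 *: u e2 + r3 *: u e3.
    by rewrite /comb3 !linearD !linearZ.
  rewrite !trE !idem ?mulr0 ?addr0 //.
  - exact: frame33 fr.
  - exact: frame22 fr.
  exact: frame11 fr.
have -> : u x = u (proj x).
  have -> : u (proj x) = u x - (tr x / 3) *: u 'e by rewrite projE linearB linearZ.
  by rewrite u1 scaler0 subr0.
apply/eqP/negPn/negP => ux.
have [k pd] := pline_disc pmap_proj.
have pu : pline 1 (fun w => tr (u (proj w))).
  pose F : {scalar J} := (tr : {scalar J}) \o (u : {linear J -> J}) \o (proj : {linear J -> J}).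
  exact: (pline_lin F).
have dD : disc (proj D0) != 0 by rewrite proj_id ?disc_D0 // J30E tr_D0.
have [w [dw]] := pline_nz2 pd pu dD ux.
by rewrite gen ?eqxx // tr_proj.
Qed.

Lemma so3_map_wedge (u : subvs_of (so3 K n)) x y : x \in V -> y \in V ->
  so3_map K n (wedge V x y) u = T x (vsval u y).
Proof.
move=> xV yV; have du := so3_derivation (subvsP u).
set f := vsval u in du *.
pose b (i : 'I_(\dim V)) := (vbasis V)`_i; pose B i j := T (b i) (f (b j)).
pose xc i := coord (vbasis V) i x; pose yc i := coord (vbasis V) i y.
have Bsk i j : B j i = - B i j by rewrite /B TC (derivation_skew _ _ du).
have Bd i : B i i = 0.
  have h2 : 2 * B i i = 0 by rewrite mulr_natl mulr2n -{1}[B i i]opprK -Bsk addNr.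
  by move/eqP: h2; rewrite mulf_eq0 pnatr_eq0 => /eqP.
transitivity (\sum_i \sum_j xc i * yc j * B i j); last first.
  have -> : f y = \sum_j yc j *: f (b j).
    by rewrite {1}(coord_vbasis yV) linear_sum; apply: eq_bigr => j _; rewrite linearZ.
  rewrite /tform {1}(coord_vbasis xV).
  have sl (I : finType) (c : I -> K) (v : I -> J) z : (\sum_i c i *: v i) ** z = \sum_i c i *: (v i ** z).
    by elim/big_rec2: _ => [|i s t _ <-]; rewrite ?cmul0l // !mulE.
  have sr (I : finType) (c : I -> K) (v : I -> J) z : z ** (\sum_i c i *: v i) = \sum_i c i *: (z ** v i).
    by elim/big_rec2: _ => [|i s t _ <-]; rewrite ?cmul0r // !mulE.
  have st (I : finType) (v : I -> J) : tr (\sum_i v i) = \sum_i tr (v i) by rewrite linear_sum.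
  rewrite sl st; apply: eq_bigr => i _; rewrite trZ sr st mulr_sumr; apply: eq_bigr => j _.
  by rewrite trZ mulrA.
rewrite so3_mapE /so3_map_at.
rewrite (eq_bigr (fun p : {p : 'I_(\dim V) * 'I_(\dim V) | (p.1 < p.2)%N} =>
   (xc (val p).1 * yc (val p).2 - xc (val p).2 * yc (val p).1) * B (val p).1 (val p).2)); last first.
  by move=> p _; rewrite ffunE.
rewrite -(big_sub [pred p : 'I_(\dim V) * 'I_(\dim V) | (p.1 < p.2)%N]
   (fun p => (xc p.1 * yc p.2 - xc p.2 * yc p.1) * B p.1 p.2)) /=.
(* The full double sum splits into i < j, j < i and the diagonal. The diagonal vanishes, and
   exchanging the indices folds the second part into the first. *)
rewrite [RHS]pair_bigA /= [RHS](bigID (fun p : 'I_(\dim V) * 'I_(\dim V) => (p.1 < p.2)%N)) /=.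
rewrite [X in _ = _ + X](bigID (fun p : 'I_(\dim V) * 'I_(\dim V) => (p.2 < p.1)%N)) /=.
rewrite [X in _ = _ + (_ + X)]big1 ?addr0; last first.
  move=> [i j] /= /andP[]; rewrite -!leqNgt => ji ij.
  have -> : i = j by apply: ord_inj; apply/eqP; rewrite eqn_leq ij ji.
  by rewrite Bd mulr0.
rewrite [X in _ = _ + X](reindex_inj (h := fun p : 'I_(\dim V) * 'I_(\dim V) => (p.2, p.1))) /=; last first.
  by move=> [i j] [i' j'] [-> ->].
rewrite [X in _ = _ + X](eq_bigl (fun p : 'I_(\dim V) * 'I_(\dim V) => (p.1 < p.2)%N)); last first.
  by move=> [i j] /=; rewrite andbC; case: ltngtP.
rewrite -big_split; apply: eq_bigr => -[i j] _ /=.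
by rewrite (Bsk i j); ring.
Qed.

Lemma in_redU x y : x \in V -> y \in V ->
  wedge V x y \in redU K n <-> forall u : 'End(J), u \in so3 K n -> T x (u y) = 0.
Proof.
move=> xV yV; rewrite memv_ker; split=> [/eqP h u us|h].
  have := so3_map_wedge (Subvs us) xV yV; by rewrite h lfunE /= => <-.
apply/eqP/lfunP => u; rewrite so3_map_wedge // [RHS]lfunE; apply: h.
exact: subvsP.
Qed.

Lemma commuting_redU x y : x \in V -> y \in V -> wedge V x y \in redU K n -> commuting A x y.
Proof.
move=> xV yV /(in_redU xV yV) h; apply: commuting_of_inner => a b.
pose D z := a ** (b ** z) - b ** (a ** z).
have Dl : linear D by move=> k z z'; rewrite /D !mulE; vring.
pose F : {linear J -> J} := HB.pack D (GRing.isLinear.Build K J J *:%R D Dl).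
have us : linfun F \in so3 K n.
  by apply/so3P => z z'; rewrite !lfunE; apply: (inner_is_derivation A a b).1.
by have := h _ us; rewrite lfunE.
Qed.
End Reductions.

(** * Secant planes *)

Section Secants.
Variables (K : numClosedFieldType) (n : nat) (n3 : (n <= 3)%N).
Local Notation J := (J3 K n).
Local Notation A := (J3_cubic K n3).
Local Notation V := (J30 K n).
Implicit Types (x y z : J) (P : {vspace J}).
Local Notation "x ** y" := (cmul A x y) (at level 40, left associativity).
Local Notation "'e" := (cone A).
Local Notation tr := (ctr A).
Local Notation T := (tform A).
Local Notation proj := (@proj_one K n).
Let C := cmulC A.

Lemma cone_neq0 : 'e != 0.
Proof.
apply/eqP => h; have := ctr1 A; rewrite h linear0 => /esym/eqP.
by rewrite pnatr_eq0.
Qed.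

Lemma proj_plane P : \dim P = 3%N -> 'e \in P ->
  \dim (linfun proj @: P) = 2%N /\ (linfun proj @: P <= V)%VS.
Proof.
move=> P3 eP; split; last by apply/subvP => _ /memv_imgP[x _ ->]; rewrite lfunE /= (proj_mem n3).
have := limg_ker_dim (linfun proj) P; rewrite P3.
have -> : (P :&: lker (linfun proj) = <['e]>)%VS.
  apply/vspaceP => x; rewrite memv_cap memv_ker lfunE /=; apply/andP/vlineP.
    by case=> _; rewrite (projE n3) subr_eq0 => /eqP ->; eexists.
  by case=> k ->; rewrite memvZ // linearZ /= (@proj1 K n n3) scaler0.
by rewrite dim_vline cone_neq0 => /eqP; rewrite eqSS => /eqP.
Qed.

Lemma severiE v : v != 0 -> severi K n <[v]>%VS <-> v ** v = tr v *: v.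
Proof.
move=> v0; split=> [[_]|h]; first by apply; apply: memv_line.
split=> [|_ /vlineP[k ->]]; first exact: dim_line.
change (k *: v ** (k *: v) = tr (k *: v) *: (k *: v)).
by rewrite !mulE h trZ !scalerA; congr (_ *: _); ring.
Qed.

Lemma line_eqP (E : vectType K) (v w : E) : v != 0 -> w != 0 -> <[v]>%VS = <[w]>%VS -> exists2 k, k != 0 & v = k *: w.
Proof.
move=> v0 w0 h; have : v \in <[w]>%VS by rewrite -h memv_line.
case/vlineP=> k vE; exists k => //; apply: contra_neq v0 => k0.
by rewrite vE k0 scale0r.
Qed.

Lemma line_scale (E : vectType K) k (v : E) : k != 0 -> <[k *: v]>%VS = <[v]>%VS.
Proof.
move=> k0; apply/eqP; rewrite eqEsubv -!memvE memvZ ?memv_line //=.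
by apply/vlineP; exists k^-1; rewrite scalerK.
Qed.

(* A third point of the Severi variety on the line through two others forces the
   whole line into the variety. *)
Lemma severi_line x y a b : x ** x = tr x *: x -> y ** y = tr y *: y ->
  a != 0 -> b != 0 -> (a *: x + b *: y) ** (a *: x + b *: y) = tr (a *: x + b *: y) *: (a *: x + b *: y) ->
  forall k, (x + k *: y) ** (x + k *: y) = tr (x + k *: y) *: (x + k *: y).
Proof.
move=> xx yy a0 b0 zz k.
have h : 2 *: (x ** y) = tr x *: y + tr y *: x.
  move: zz; rewrite !mulE !trE xx yy (C y x) => zz.
  by apply: (lincomb1 (c := (a * b)^-1) zz); vprep; field; rewrite ?a0 ?b0.
rewrite !mulE !trE xx yy (C y x).
by apply: (lincomb1 (c := k) h); vring.
Qed.

(** The three points are independent, so they span P and I = c1 x1 + c2 x2 + c3 x3; the summands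
    satisfy the hypotheses of [rank1_sum_frame]. *)
Lemma secant_frame P : simply_3secant (severi K n) P -> 'e \in P ->
  exists e1 e2 e3, frame A e1 e2 e3 /\ forall v, v \in P -> exists c1 c2 c3, v = comb3 e1 e2 e3 c1 c2 c3.
Proof.
move=> [P3 [s [us s3 sE _]]] eP.
case: s us s3 sE => [|l1 [|l2 [|l3 [|]]]] //= us _ sE.
have pt l : l \in [:: l1; l2; l3] -> exists x, [/\ x != 0, l = <[x]>%VS, x \in P & x ** x = tr x *: x].
  move=> /sE[[d1 sev] [_ lP]]; have [x x0 lx] := dim1_line d1.
  exists x; split=> //; first by apply: (subvP lP); rewrite lx memv_line.
  by apply: sev; rewrite lx memv_line.
have [x1 [x10 l1E x1P xx1]] : exists x, [/\ x != 0, l1 = <[x]>%VS, x \in P & x ** x = tr x *: x].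
  by apply: pt; rewrite !inE eqxx.
have [x2 [x20 l2E x2P xx2]] : exists x, [/\ x != 0, l2 = <[x]>%VS, x \in P & x ** x = tr x *: x].
  by apply: pt; rewrite !inE eqxx orbT.
have [x3 [x30 l3E x3P xx3]] : exists x, [/\ x != 0, l3 = <[x]>%VS, x \in P & x ** x = tr x *: x].
  by apply: pt; rewrite !inE eqxx !orbT.
move: us; rewrite !inE negb_or andbT -andbA => /and3P[n12 n13 n23].
have sc x y l l' (k : K) : x != 0 -> y != 0 -> l = <[x]>%VS -> l' = <[y]>%VS -> l != l' -> y <> k *: x.
  move=> x0 y0 -> -> /eqP ll yE; apply: ll; rewrite yE line_scale //.
  by apply: contra_neq y0 => k0; rewrite yE k0 scale0r.
(* If the points were collinear, [severi_line] would place the points x1 + k x2 on the variety, and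
   k = 0, 1, 2, 3 gives four of them where only three are allowed. *)
have nl a b : x3 <> a *: x1 + b *: x2.
  move=> x3E.
  have a0 : a != 0.
    apply/eqP => a0; apply: (sc _ _ _ _ b x20 x30 l2E l3E n23); by rewrite x3E a0 scale0r add0r.
  have b0 : b != 0.
    apply/eqP => b0; apply: (sc _ _ _ _ a x10 x30 l1E l3E n13); by rewrite x3E b0 scale0r addr0.
  have ln := severi_line xx1 xx2 a0 b0; rewrite -x3E in ln; have {}ln := ln xx3.
  pose pk (k : nat) := <[x1 + k%:R *: x2]>%VS.
  have pk0 k : x1 + k%:R *: x2 != 0.
    apply/eqP => h; apply: (sc _ _ _ _ (- k%:R) x20 x10 l2E l1E); first by rewrite eq_sym.
    by apply/eqP; rewrite scaleNr -addr_eq0 h.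
  have : (size [seq pk k | k <- iota 0 4] <= size [:: l1; l2; l3])%N.
    apply: uniq_leq_size => [|_ /mapP[k _ ->]].
      rewrite map_inj_uniq ?iota_uniq // => k k' /(line_eqP (pk0 k) (pk0 k'))[c c0 h].
      have h' : (1 - c) *: x1 + (k%:R - c * k'%:R) *: x2 = 0.
        by apply: (lincomb1 (c := 1) h); vring.
      have c1 : c = 1.
        apply/eqP; rewrite eq_sym -subr_eq0; apply/negPn/negP => c1.
        apply: (sc _ _ _ _ (- (k%:R - c * k'%:R) / (1 - c)) x20 x10 l2E l1E); first by rewrite eq_sym.
        by apply: (lincomb1 (c := (1 - c)^-1) h'); vprep; field.
      move/eqP: h'; rewrite c1 subrr scale0r add0r mul1r scaler_eq0 (negPf x20) orbF subr_eq0.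
      by rewrite eqr_nat => /eqP.
    apply/sE; split; first by apply/severiE => //; apply: ln.
    by split; [exact: dim_line|rewrite -memvE memvD ?memvZ].
  by rewrite size_map.
have ind c1 c2 c3 : c1 *: x1 + c2 *: x2 + c3 *: x3 = 0 -> [/\ c1 = 0, c2 = 0 & c3 = 0].
  move=> h; have c30 : c3 = 0.
    apply/eqP/negPn/negP => c30; apply: (nl (- c1 / c3) (- c2 / c3)).
    by apply: (lincomb1 (c := c3^-1) h); vprep; field.
  move: h; rewrite c30 scale0r addr0 => h.
  have c20 : c2 = 0.
    apply/eqP/negPn/negP => c20; apply: (sc _ _ _ _ (- c1 / c2) x10 x20 l1E l2E n12).
    by apply: (lincomb1 (c := c2^-1) h); vprep; field.
  move/eqP: h; rewrite c20 scale0r addr0 scaler_eq0 (negPf x10) orbF => /eqP; by split.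
have fr : free [:: x1; x2; x3].
  apply/freeP => c; rewrite !big_ord_recl big_ord0 addr0 addrA /= => /ind[c1 c2 c3] i.
  case: i => [[|[|[|//]]] hi]; [rewrite -c1|rewrite -c2|rewrite -c3]; congr c; exact: val_inj.
have PE : P = <<[:: x1; x2; x3]>>%VS.
  apply/esym/eqP; rewrite eqEdim P3; move: fr; rewrite /free => /eqP ->; rewrite leqnn andbT.
  by apply/span_subvP => x; rewrite !inE => /or3P[] /eqP ->.
have spanP v : v \in P -> exists c1 c2 c3, v = c1 *: x1 + c2 *: x2 + c3 *: x3.
  rewrite PE !span_cons span_nil addv0 => /memv_addP[_ /vlineP[c1 ->] [_ /memv_addP[_ /vlineP[c2 ->] [_ /vlineP[c3 ->] ->]] ->]].
  by exists c1, c2, c3; rewrite addrA.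
have [c1 [c2 [c3 oneE]]] := spanP _ eP.
have sq c x : x ** x = tr x *: x -> (c *: x) ** (c *: x) = tr (c *: x) *: (c *: x).
  by move=> xx; rewrite !mulE xx trZ !scalerA; congr (_ *: _); ring.
have F : frame A (c1 *: x1) (c2 *: x2) (c3 *: x3).
  apply: rank1_sum_frame; rewrite ?sq //.
  move=> d1 d2 d3; rewrite !scalerA => /ind[h1 h2 h3].
  by rewrite h1 h2 h3 !scale0r.
exists (c1 *: x1), (c2 *: x2), (c3 *: x3); split=> // v /spanP[d1 [d2 [d3 ->]]].
have nz c x : tr (c *: x) = 1 -> c != 0.
  by move=> h; apply/eqP => c0; move/eqP: h; rewrite c0 trZ mul0r eq_sym oner_eq0.
have nz1 := nz _ _ (frame_tr1 F); have nz2 := nz _ _ (frame_tr2 F); have nz3 := nz _ _ (frame_tr3 F).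
by exists (d1 / c1), (d2 / c2), (d3 / c3); rewrite /comb3 !scalerA !mulfVK.
Qed.

Lemma secant_redU P : simply_3secant (severi K n) P -> 'e \in P ->
  let l := plucker V (linfun proj @: P) in grass2 V l /\ in_lin (redU K n) l.
Proof.
move=> sP eP /=; have [P3 _] := sP; have [L2 LV] := proj_plane P3 eP.
have [e1 [e2 [e3 [fr comb]]]] := secant_frame sP eP.
set L := (linfun proj @: P)%VS in L2 LV *.
have G : grass2 V (plucker V L) by exists L.
split=> //; split; first exact: grass2_dim G.
have sb : size (vbasis L) = 2%N by rewrite size_tuple.
have bL i : (i < 2)%N -> (vbasis L)`_i \in L by move=> i2; apply/vbasis_mem/mem_nth; rewrite sb.
have LP x : x \in L -> x \in P.
  case/memv_imgP => p pP ->; rewrite lfunE /= (projE n3).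
  by rewrite memvB // memvZ.
rewrite -memvE; apply/(in_redU n3); try by apply: (subvP LV); apply: bL.
move=> u us; have [c1 [c2 [c3 ->]]] := comb _ (LP _ (bL 0%N isT)).
have [d1 [d2 [d3 ->]]] := comb _ (LP _ (bL 1%N isT)).
by apply: frame_derivation => //; apply: so3_derivation.
Qed.

(** Differentiates the quadrics B(x^2 - tr(x) x), with B a linear form, which vanish on the Severi
    variety. *)
Lemma tangent_severi p v : p != 0 -> tangent (severi K n) <[p]>%VS v ->
  2 *: (p ** v) = tr p *: v + tr v *: p.
Proof.
move=> p0 tv; apply/subr0_eq/eqP/negPn/negP => n0; have [B Bn] := exists_scalar n0.
have BD x y : B (x + y) = B x + B y by rewrite linearD.
have BZ k x : B (k *: x) = k * B x by rewrite linearZ.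
have BN x : B (- x) = - B x by rewrite linearN.
pose be x y := B (x ** y) - tr x * B y.
have bl y : linear_for *%R (be^~ y).
  by move=> k x x'; rewrite /be cmulPl BD BZ trD trZ; ring.
have br x : linear_for *%R (be x).
  by move=> k y y'; rewrite /be !mulE !BD !BZ; ring.
have [f [f2 fE fD]] := quadric_form bl br.
have fh : homogeneous f by exists 2%N.
have fv m : severi K n m -> vanishes_at f m.
  move=> sm; have [q q0 mE] := dim1_line sm.1; move: sm; rewrite mE => /(severiE q0) qq.
  by apply/vanishes_line => //; rewrite fE /be qq BZ subrr.
have := tv f fh fv p (memv_line p); rewrite fD => h; case/eqP: Bn.
by rewrite !(BD, BN, BZ) -[RHS]h /be (C v p); ring.
Qed.

Section FrameSecant.
Variables e1 e2 e3 : J.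
Hypothesis fr : frame A e1 e2 e3.
Local Notation comb := (comb3 e1 e2 e3).
Let P := (<[e1]> + (<[e2]> + <[e3]>))%VS.

Let comb_mem c1 c2 c3 : comb c1 c2 c3 \in P.
Proof.
rewrite /comb3 -addrA; apply: memv_add; first by rewrite memvZ ?memv_line.
by apply: memv_add; rewrite memvZ ?memv_line.
Qed.

Let memP v : v \in P -> exists c1 c2 c3, v = comb c1 c2 c3.
Proof.
move=> /memv_addP[_ /vlineP[c1 ->] [_ /memv_addP[_ /vlineP[c2 ->] [_ /vlineP[c3 ->] ->]] ->]].
by exists c1, c2, c3; rewrite /comb3 addrA.
Qed.

Let c0 : 0 = comb 0 0 0. Proof. by rewrite /comb3 !scale0r !addr0. Qed.
Let c1 : e1 = comb 1 0 0. Proof. by rewrite /comb3 !scale0r !addr0 scale1r. Qed.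
Let c2 : e2 = comb 0 1 0. Proof. by rewrite /comb3 !scale0r addr0 add0r scale1r. Qed.
Let c3 : e3 = comb 0 0 1. Proof. by rewrite /comb3 !scale0r !add0r scale1r. Qed.

Let nz1 : e1 != 0.
Proof. by apply/eqP => h; have := frame_tr1 fr; rewrite h linear0 => /esym/eqP; rewrite oner_eq0. Qed.
Let nz2 : e2 != 0.
Proof. by apply/eqP => h; have := frame_tr2 fr; rewrite h linear0 => /esym/eqP; rewrite oner_eq0. Qed.
Let nz3 : e3 != 0.
Proof. by apply/eqP => h; have := frame_tr3 fr; rewrite h linear0 => /esym/eqP; rewrite oner_eq0. Qed.

Let combZ k d1 d2 d3 : k *: comb d1 d2 d3 = comb (k * d1) (k * d2) (k * d3).
Proof. by rewrite /comb3 !scalerDr !scalerA. Qed.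

Let combD k1 k2 k3 d1 d2 d3 : comb k1 k2 k3 + comb d1 d2 d3 = comb (k1 + d1) (k2 + d2) (k3 + d3).
Proof. by rewrite /comb3; vring. Qed.

Let dimP : \dim P = 3%N.
Proof.
have : free [:: e1; e2; e3].
  apply/freeP => c; rewrite !big_ord_recl big_ord0 addr0 addrA /= -/(comb _ _ _) c0.
  move/(comb_inj fr) => [h1 h2 h3] i.
  case: i => [[|[|[|//]]] hi]; [rewrite -h1|rewrite -h2|rewrite -h3]; congr c; exact: val_inj.
by rewrite /free !span_cons span_nil addv0 => /eqP.
Qed.

Let one_mem : 'e \in P.
Proof. by rewrite (frame_one fr). Qed.

(** Each coefficient d_i satisfies d_i^2 = s d_i with s = tr v, so it is 0 or s, and s is nonzero as
    v is. If k of the coefficients equal s, then s = ks, so k = 1. *)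
Let idem_line (v : J) : v \in P -> v != 0 -> v ** v = tr v *: v ->
  <[v]>%VS \in [:: <[e1]>%VS; <[e2]>%VS; <[e3]>%VS].
Proof.
move=> /memP[d1 [d2 [d3 ->]]] v0.
rewrite frame_mul // frame_tr // combZ => /(comb_inj fr)[h1 h2 h3].
set s := d1 + d2 + d3 in h1 h2 h3.
have d01 d : d * d = s * d -> d = 0 \/ d = s.
  by move/eqP; rewrite -subr_eq0 -mulrBl mulf_eq0 subr_eq0 => /orP[]/eqP; [right|left].
have s0 : s != 0.
  apply/eqP => s0; case/eqP: v0; rewrite c0.
  by case: (d01 _ h1) (d01 _ h2) (d01 _ h3) => -> [->|->] [->|->]; rewrite ?s0.
have nN (k : nat) : k%:R * s = s -> k = 1%N.
  rewrite -[RHS]mul1r => /(mulIf s0)/eqP; by rewrite (eqr_nat K k 1) => /eqP.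
have l1 : <[s *: e1]>%VS = <[e1]>%VS by rewrite line_scale.
have l2 : <[s *: e2]>%VS = <[e2]>%VS by rewrite line_scale.
have l3 : <[s *: e3]>%VS = <[e3]>%VS by rewrite line_scale.
have sE : s = d1 + d2 + d3 by [].
clearbody s.
have bad (k : nat) : k != 1%N -> s = k%:R * s -> False by move=> /eqP k1 /esym /nN.
case: (d01 _ h1) sE => ->; case: (d01 _ h2) => ->; case: (d01 _ h3) => -> sE;
  rewrite /comb3 ?scale0r ?add0r ?addr0 ?l1 ?l2 ?l3 !inE ?eqxx ?orbT //; exfalso;
  [ apply: (@bad 0%N) => // | apply: (@bad 2%N) => // | apply: (@bad 2%N) => //
  | apply: (@bad 2%N) => // | apply: (@bad 3%N) => //]; by rewrite [LHS]sE; ring.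
Qed.

Lemma frame_plane_secant : simply_3secant (severi K n) P.
Proof.
split; first exact: dimP.
exists [:: <[e1]>%VS; <[e2]>%VS; <[e3]>%VS].
have [f1 f2 f3 f12 f13 f23 t1 t2 t3 _] := fr.
have neq x y : x != 0 -> y != 0 -> x ** y = 0 -> y ** y = y -> <[x]>%VS != <[y]>%VS.
  move=> x0 y0 xy yy; apply/eqP => /(line_eqP x0 y0)[k _ xE].
  by move: x0; rewrite xE -{1}yy -cmulZl -xE xy eqxx.
have neq12 := neq _ _ nz1 nz2 f12 f2; have neq13 := neq _ _ nz1 nz3 f13 f3.
have neq23 := neq _ _ nz2 nz3 f23 f3.
split=> //.
- by rewrite /= !inE negb_or neq12 neq13 neq23.
- move=> l; split=> [|[sl [l1 lP]]].
    have ok v : v != 0 -> v ** v = v -> tr v = 1 -> v \in P -> severi K n <[v]>%VS /\ in_lin P <[v]>%VS.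
      move=> v0 vv tv vP; split; first by apply/(severiE v0); rewrite vv tv scale1r.
      by split; [exact: dim_line|rewrite -memvE].
    rewrite !inE => /or3P[] /eqP ->; apply: ok => //.
    - by rewrite c1 comb_mem.
    - by rewrite c2 comb_mem.
    by rewrite c3 comb_mem.
  have [v v0 lE] := dim1_line l1; rewrite lE; apply: idem_line => //.
    by apply: (subvP lP); rewrite lE memv_line.
  by move: sl; rewrite lE => /(severiE v0).
move=> l; rewrite !inE => /or3P[] /eqP -> v /memP[d1 [d2 [d3 ->]]].
- have m1 : e1 ** comb d1 d2 d3 = comb d1 0 0 by rewrite {1}c1 frame_mul // !(mul0r, mul1r).
  have s1 s : s *: e1 = comb s 0 0 by rewrite /comb3 !scale0r !addr0.
  move/(tangent_severi nz1); rewrite frame_tr // t1 m1 s1 !combZ combD.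
  move=> /(comb_inj fr)[_ h2 h3].
  have -> : d2 = 0 by move: h2; rewrite !(mul0r, mul1r, mulr0, addr0).
  have -> : d3 = 0 by move: h3; rewrite !(mul0r, mul1r, mulr0, addr0).
  by rewrite -s1 memvZ ?memv_line.
- have m2 : e2 ** comb d1 d2 d3 = comb 0 d2 0 by rewrite {1}c2 frame_mul // !(mul0r, mul1r).
  have s2 s : s *: e2 = comb 0 s 0 by rewrite /comb3 !scale0r addr0 add0r.
  move/(tangent_severi nz2); rewrite frame_tr // t2 m2 s2 !combZ combD.
  move=> /(comb_inj fr)[h1 _ h3].
  have -> : d1 = 0 by move: h1; rewrite !(mul0r, mul1r, mulr0, addr0).
  have -> : d3 = 0 by move: h3; rewrite !(mul0r, mul1r, mulr0, addr0).
  by rewrite -s2 memvZ ?memv_line.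
have m3 : e3 ** comb d1 d2 d3 = comb 0 0 d3 by rewrite {1}c3 frame_mul // !(mul0r, mul1r).
have s3 s : s *: e3 = comb 0 0 s by rewrite /comb3 !scale0r !add0r.
move/(tangent_severi nz3); rewrite frame_tr // t3 m3 s3 !combZ combD.
move=> /(comb_inj fr)[h1 h2 _].
have -> : d1 = 0 by move: h1; rewrite !(mul0r, mul1r, mulr0, addr0).
have -> : d2 = 0 by move: h2; rewrite !(mul0r, mul1r, mulr0, addr0).
by rewrite -s3 memvZ ?memv_line.
Qed.

Lemma frame_reduction r1 r2 r3 (x := comb r1 r2 r3) :
  tr x = 0 -> r1 != r2 -> r1 != r3 -> r2 != r3 ->
  wedge V x (proj (x ** x)) != 0 /\ reductions K n <[wedge V x (proj (x ** x))]>%VS.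
Proof.
move=> tx n12 n13 n23.
have xV : x \in V by rewrite (J30E n3) tx.
have pV : proj (x ** x) \in V by apply: (proj_mem n3).
have [L2 LV] := proj_plane dimP one_mem.
have xL : x \in (linfun proj @: P)%VS.
  by rewrite -[x](proj_id n3) // -[proj x](lfunE proj) memv_img // comb_mem.
have pL : proj (x ** x) \in (linfun proj @: P)%VS.
  by rewrite -[proj _](lfunE proj) memv_img // /x frame_mul // comb_mem.
(* Otherwise x^2 would be a combination of x and I, and x could not have three distinct
   eigenvalues. *)
have w0 : wedge V x (proj (x ** x)) != 0.
  apply/eqP => w0.
  have x0 : x != 0.
    apply/eqP; rewrite c0 => /(comb_inj fr)[h1 h2 _].
    by move: n12; rewrite h1 h2 eqxx.
  have [k] := wedge_eq0 xV pV x0 w0.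
  rewrite (projE n3) {1}/x frame_mul // (frame_one fr) -scaleNr !combZ combD mulr1.
  move=> /(comb_inj fr)[h1 h2 h3].
  have z (a b c : K) : a * a + - c = k * a -> b * b + - c = k * b ->
      a != b -> a + b = k.
    move=> ha hb; rewrite -subr_eq0 => ab; apply: (mulfI ab).
    have : a * a - b * b = k * (a - b).
      by rewrite mulrBr -ha -hb; ring.
    by move=> e; rewrite [RHS]mulrC -e; ring.
  have s12 := z _ _ _ h1 h2 n12; have s13 := z _ _ _ h1 h3 n13.
  by move: n23; rewrite -(inj_eq (addrI r1)) s12 s13 eqxx.
split=> //; apply: subset_zclosure; exists P; split; [exact: frame_plane_secant|exact: one_mem|].
by rewrite (plucker_wedge LV L2 xL pL).
Qed.
End FrameSecant.

Lemma disc_reduction x : tr x = 0 -> disc n3 x != 0 ->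
  wedge V x (proj (x ** x)) != 0 /\ reductions K n <[wedge V x (proj (x ** x))]>%VS.
Proof.
move=> tx /(spectral tx)[e1 [e2 [e3 [fr [r1 [r2 [r3 [xE n12 n13 n23]]]]]]]].
by rewrite xE; apply: frame_reduction; rewrite -?xE.
Qed.
End Secants.

(** * The linear section *)

Lemma zclosed_in_lin (K : numFieldType) (E : vectType K) (U : {vspace E}) : zclosed (in_lin U).
Proof.
exists (fun f => homogeneous f /\ forall v, v \in U -> f.@[coords v] = 0); split=> [f []//|l].
split=> [[l1 lU]|[l1 h]]; first by split=> // f [_ fU] v vl; apply/fU/(subvP lU).
split=> //; have [v v0 lE] := dim1_line l1; rewrite lE -memvE; apply/negPn/negP => vU.
pose F : {linear E -> E} := (\1 - projv U)%VF.
have FE w : F w = w - projv U w by rewrite /= add_lfunE opp_lfunE id_lfunE.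
have [|lam lamv] := @exists_scalar _ _ (F v).
  rewrite FE subr_eq0; apply: contraNneq vU => ->; exact: memv_proj.
have [f f1 fE] := meval_coords_lin (lam \o F : {scalar E}).
have fh : homogeneous f by exists 1%N.
have : vanishes_at f l.
  by apply: h; split=> // w wU; rewrite fE /= -/(F w) FE projv_id // subrr linear0.
by rewrite lE => /(vanishes_line _ fh); rewrite fE => /eqP; apply/negP.
Qed.

Section LinearSection.
Variables (K : numClosedFieldType) (n : nat) (n3 : (n <= 3)%N).
Local Notation J := (J3 K n).
Local Notation A := (J3_cubic K n3).
Local Notation V := (J30 K n).
Local Notation Y := (reductions K n).
Local Notation W := (wedge V).
Implicit Types (x y z : J).
Local Notation "x ** y" := (cmul A x y) (at level 40, left associativity).
Local Notation "'e" := (cone A).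
Local Notation tr := (ctr A).
Local Notation T := (tform A).
Local Notation proj := (@proj_one K n).
Let C := cmulC A.

Lemma zclosed_reductions : zclosed Y.
Proof.
apply: zclosed_zclosure => l [P [sP eP ->]].
have [G _] := secant_redU (n3 := n3) sP eP; exact: grass2_dim G.
Qed.

Lemma reductions_sub l : Y l -> grass2 V l /\ in_lin (redU K n) l.
Proof.
move/(_ (fun l => grass2 V l /\ in_lin (redU K n) l)); apply=> [|_ [P [sP eP ->]]].
  exact: zclosedI (zclosed_grass2 V) (zclosed_in_lin _).
exact: (secant_redU (n3 := n3)).
Qed.

Let projD x y : proj (x + y) = proj x + proj y. Proof. exact: linearD. Qed.
Let projZ k x : proj (k *: x) = k *: proj x. Proof. exact: linearZ. Qed.
Let projV x : x \in V -> proj x = x. Proof. exact: proj_id. Qed.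
Let proj_e : proj 'e = 0. Proof. exact: proj1. Qed.

(** Elements with nonzero discriminant are dense, [D0] being one of them, and Y is closed; so x may
    be degenerate as long as the wedge is nonzero. *)
Lemma square_reduction x : x \in V -> W x (proj (x ** x)) != 0 -> Y <[W x (proj (x ** x))]>%VS.
Proof.
move=> xV; pose phi (w : J) := W (proj w) (proj (proj w ** proj w)).
have pp : pmap (1 + 2) phi.
  apply: (pmap_bilinear (wedge_linl V) (wedge_linr V)); first exact: pmap_proj.
  have sq : pmap (1 + 1) (fun w => proj w ** proj w) by apply: pmapM; apply: pmap_proj.
  move=> f; exact: (sq (f \o (proj : {linear J -> J}) : {scalar J})).
have [k pg] := pline_disc n3 (@pmap_proj K n).
have D1 : disc n3 (proj (D0 K n)) != 0 by rewrite projV ?disc_D0 // (J30E n3) tr_D0.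
have := pmap_limit pp zclosed_reductions pg D1 _ (w := x).
rewrite /phi projV //; apply=> w dw _.
by apply: (disc_reduction (n3 := n3) _ dw).2; rewrite tr_proj.
Qed.

Lemma on_powers_reduction x y : x \in V -> y \in V -> W x y != 0 -> on_powers A x y -> Y <[W x y]>%VS.
Proof.
move=> xV yV w0 [a [b [c yE]]].
have wE : W x y = c *: W x (proj (x ** x)).
  rewrite -[y]projV // yE !projD !projZ proj_e scaler0 add0r projV //.
  by rewrite !wedgeE scaler0 add0r.
have c0 : c != 0 by apply: contra_neq w0 => c0; rewrite wE c0 scale0r.
rewrite wE line_scale //; apply: square_reduction => //.
by apply: contra_neq w0 => h; rewrite wE h scaler0.
Qed.

(* Along x + tz the square varies, to first order and modulo 1 and x + tz, by
   t(2xz - al z). *)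
Lemma power_limit_reduction x y : x \in V -> y \in V -> W x y != 0 ->
  power_limit A x y -> Y <[W x y]>%VS.
Proof.
move=> xV yV w0 [al [be [z' [a' [b' [xx yE']]]]]].
have [z [a [b [zV yE]]]] : exists z a b, z \in V /\ y = 2 *: (x ** z) - al *: z + a *: x + b *: 'e.
  exists (proj z'), (2 * (tr z' / 3) + a'), (b' - al * (tr z' / 3)); split; first exact: (proj_mem n3).
  by rewrite yE' (projE n3) !mulE; vring.
pose c t := 2 *: (x ** z) - al *: z + t *: (z ** z).
pose phi (t : K^o) := W (x + t *: z) (proj (c t)).
have pid : pline 1 (fun t : K^o => t : K) by apply: (pline_lin (idfun : {scalar K^o})).
have pl (u v : J) : pmap 1 (fun t : K^o => u + (t : K) *: v).
  have h1 : pmap 1 (fun _ : K^o => u) := pmap_le (leq0n 1) (@pmap_cst _ _ _ u).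
  have h2 : pmap 1 (fun t : K^o => (t : K) *: v).
    by have := pmapZ pid (@pmap_cst K K^o J v); rewrite addn0.
  exact: pmapD h1 h2.
have pp : pmap (1 + 1) phi.
  apply: (pmap_bilinear (wedge_linl V) (wedge_linr V)); first exact: pl.
  move=> f; exact: (pl _ _ (f \o (proj : {linear J -> J}) : {scalar J})).
have n1 : (1 : K) != 0 by rewrite oner_eq0.
have phi0 : phi 0 = W x y.
  have e : proj y = proj (2 *: (x ** z) - al *: z) + a *: x.
    by rewrite yE [LHS]projD [X in X + _]projD !projZ proj_e scaler0 addr0 (projV xV).
  by rewrite /phi /c !scale0r !addr0 -(projV yV) e [RHS]wedgeDr wedgeZr wedgexx scaler0 addr0.
have := pmap_limit pp zclosed_reductions pid n1 _ (w := 0); rewrite phi0; apply=> // t t0 pt.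
have vV : x + (t : K) *: z \in V by rewrite memvD // memvZ.
have wE : W (x + (t : K) *: z) (proj ((x + (t : K) *: z) ** (x + (t : K) *: z))) = (t : K) *: phi t.
  have -> : (x + (t : K) *: z) ** (x + (t : K) *: z) = al *: (x + (t : K) *: z) + be *: 'e + (t : K) *: c t.
    by rewrite !mulE xx (C z x) /c; vring.
  have e (v v' : J) s : v \in V -> proj (al *: v + be *: 'e + s *: v') = al *: v + s *: proj v'.
    by move=> vV'; rewrite [LHS]projD [X in X + _]projD !projZ proj_e scaler0 addr0 projV.
  by rewrite (e _ _ _ vV) wedgeDr !wedgeZr wedgexx scaler0 add0r.
have := square_reduction vV; rewrite wE line_scale //; apply.
by rewrite scaler_eq0 negb_or t0.
Qed.

Theorem reductionsP l : Y l <-> grass2 V l /\ in_lin (redU K n) l.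
Proof.
split=> [/reductions_sub//|[/grass2P[x [y [xV yV w0 ->]]] [_ wU]]].
have wU' : W x y \in redU K n by rewrite memvE.
have xy := commuting_redU n3 xV yV wU'.
have x0 : x != 0 by apply: contra_neq w0 => ->; rewrite wedge0l.
have tx : tr x = 0 by apply/eqP; rewrite -(J30E n3).
have ty : tr y = 0 by apply/eqP; rewrite -(J30E n3).
have [x' [y' [k [h1 h2]]]] := commuting_pair_cases x0 tx ty xy.
have [xV' yV' wE] : [/\ x' \in V, y' \in V & <[W x y]>%VS = <[W x' y']>%VS].
  case: h1 => -[-> ->]; split=> //; first by rewrite memvD // memvZ.
  have -> : W (y + (- k) *: x) x = -1 *: W x y.
    by rewrite wedgeDl wedgeZl wedgexx scaler0 addr0 (wedgeC _ x y) scaleN1r.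
  by rewrite line_scale // oppr_eq0 oner_eq0.
have w0' : W x' y' != 0.
  by have := dim_line w0; rewrite wE dim_vline; case: (W x' y' =P 0).
rewrite wE; case: h2 => h2; [exact: on_powers_reduction|exact: power_limit_reduction].
Qed.
End LinearSection.

(** * Dimensions *)

(** Evaluation of a basis of the image of f embeds F into a space whose dimension is the rank of
    f. *)
Lemma rank_dual (K : fieldType) (E F : vectType K) (f : 'Hom(E, 'Hom(F, K^o))) :
  (forall u, (forall w, f w u = 0) -> u = 0) -> (\dim {:F} <= \dim (limg f))%N.
Proof.
move=> nd; set G := limg f; set r := \dim G.
pose g u : {ffun 'I_r -> K^o} := [ffun i : 'I_r => (vbasis G)`_i u].
have gl : linear g by move=> c u v; apply/ffunP => i; rewrite !ffunE linearP.
pose g' : {linear F -> {ffun 'I_r -> K^o}} := HB.pack g (GRing.isLinear.Build K F {ffun 'I_r -> K^o} *:%R g gl).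
have k0 : (lker (linfun g') == 0)%VS.
  rewrite -subv0; apply/subvP => u; rewrite memv_ker lfunE => /eqP /ffunP gu.
  rewrite memv0; apply/eqP/nd => w; have wG : f w \in G by apply: memv_img; apply: memvf.
  rewrite (coord_vbasis wG) sum_lfunE big1 // => i _.
  by rewrite scale_lfunE; have := gu i; rewrite !ffunE /= => ->; rewrite scaler0.
have := limg_dim_eq; move/(_ _ _ _ (linfun g') fullv); rewrite (eqP k0) capv0 => /(_ erefl) <-.
by rewrite (leq_trans (dimvS (subvf _))) // dimvf /dim /= card_ord muln1.
Qed.

(** The exterior product of two linear forms, viewed as a form on bivectors and built by
    contraction. *)
Lemma wedge_form (K : numFieldType) (E : vectType K) (V : {vspace E}) (al be : {scalar E}) :
  exists lam : {scalar ext2 V}, forall x y, x \in V -> y \in V ->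
    lam (wedge V x y) = be x * al y - be y * al x.
Proof.
pose F (w : ext2 V) := \sum_(k < \dim V) be (vbasis V)`_k * al (contract w k).
have Fl : linear_for *%R F.
  move=> c w w'; rewrite /F mulr_sumr -big_split; apply: eq_bigr => k _ /=.
  by rewrite contract_lin linearP /=; ring.
pose lam : {scalar ext2 V} := HB.pack F (GRing.isLinear.Build K (ext2 V) K *%R F Fl).
exists lam => x y xV yV; rewrite -[LHS]/(F _) /F.
rewrite {2}(coord_vbasis xV) {3}(coord_vbasis yV) !linear_sum !mulr_suml -sumrB.
apply: eq_bigr => k _; rewrite !linearZ /= contract_wedge //.
rewrite [al (_ - _)](_ : _ = coord (vbasis V) k x * al y - coord (vbasis V) k y * al x).
  by ring.
by rewrite linearB !linearZ.
Qed.

Section Dimensions.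
Variables (K : numClosedFieldType) (n : nat) (n3 : (n <= 3)%N).
Local Notation J := (J3 K n).
Local Notation A := (J3_cubic K n3).
Local Notation V := (J30 K n).
Local Notation Y := (reductions K n).
Local Notation W := (wedge V).
Local Notation D := (D0 K n).
Implicit Types (x y z : J).
Local Notation "x ** y" := (cmul A x y) (at level 40, left associativity).
Local Notation "'e" := (cone A).
Local Notation tr := (ctr A).
Local Notation T := (tform A).
Local Notation proj := (@proj_one K n).
Let C := cmulC A.

Definition offdiag : vectType K := (cd K n * cd K n * cd K n)%type.
Definition off (o : offdiag) : J := mk 0 0 0 o.1.1 o.1.2 o.2.
Definition offpart (x : J) : offdiag :=
  (vsval x (inord 1, inord 2), vsval x (inord 2, inord 0), vsval x (inord 0, inord 1)).

Lemma off_is_linear : linear off.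
Proof.
move=> c o o'; rewrite /off mk_lin !mulr0 !addr0 //.
Qed.
HB.instance Definition _ := GRing.isLinear.Build K offdiag J *:%R off off_is_linear.

Lemma offpart_is_linear : linear offpart.
Proof. by move=> c x y; rewrite /offpart !linearP !ffunE. Qed.
HB.instance Definition _ := GRing.isLinear.Build K J offdiag *:%R offpart offpart_is_linear.

Lemma offpart_mk a b c u v w : offpart (mk a b c u v w) = (u, v, w).
Proof. by rewrite /offpart !val_mk /= !inordK. Qed.

Lemma offK : cancel off offpart.
Proof. by move=> [[u v] w]; rewrite /off offpart_mk. Qed.

Lemma diag_off a b c o : mk a b c 0 0 0 ** off o =
  off ((b + c) / 2 *: o.1.1, (c + a) / 2 *: o.1.2, (a + b) / 2 *: o.2).
Proof.
have c0 : cdconj (0 : cd K n) = 0 := raddf0 _.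
rewrite [LHS]jmul_mk !cdformE !cdmulE !c0 !(addr0, scaler0, mulr0).
by congr mk; rewrite scalerA mulrC.
Qed.

Definition off3 (w : cd K n) : J := mk 0 0 0 0 0 w.

Lemma off3_mul w w' : off3 w ** off3 w' = mk (cdform w w') (cdform w w') 0 0 0 0.
Proof.
have c0 : cdconj (0 : cd K n) = 0 := raddf0 _.
by rewrite [LHS]jmul_mk !cdformE !cdmulE !c0 !(addr0, scale0r, scaler0, mulr0) !add0r.
Qed.

Lemma diag_off3 a b c w : mk a b c 0 0 0 ** off3 w = ((a + b) / 2) *: off3 w.
Proof. by rewrite -[off3 w]/(off (0, 0, w)) diag_off /off mkZ /= !scaler0 !mulr0. Qed.

Lemma T_off3 w w' : T (off3 w) (off3 w') = 2 * cdform w w'.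
Proof. by rewrite /off3 [T _ _]jtrace_jmul_mk !cdformE; ring. Qed.

Lemma off3_V w : off3 w \in V.
Proof. by rewrite (J30E n3) [tr _]jtrace_mk !addr0. Qed.

Lemma inner_so3 a b : exists2 u : 'End(J), u \in so3 K n & forall z, u z = a ** (b ** z) - b ** (a ** z).
Proof.
pose F z := a ** (b ** z) - b ** (a ** z).
have Fl : linear F by move=> k z z'; rewrite /F !mulE; vring.
pose G : {linear J -> J} := HB.pack F (GRing.isLinear.Build K J J *:%R F Fl).
exists (linfun G) => [|z]; last by rewrite lfunE.
by apply/so3P => z z'; rewrite !lfunE; apply: (inner_is_derivation A a b).1.
Qed.

Lemma D_V : D \in V. Proof. by rewrite (J30E n3) tr_D0. Qed.

Lemma orbit_D0 o : exists2 u : 'End(J), u \in so3 K n & u D = off o.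
Proof.
(* For off-diagonal a, applying [L_a, L_D] to D multiplies the (i, j) entry of a by ((d_i - d_j) /
   2)^2, where the d_i are the eigenvalues of D. The three factors are 1/4, 1, 1/4. *)
pose o' : offdiag := (4 *: o.1.1, o.1.2, 4 *: o.2).
have [u us uE] := inner_so3 (off o') D; exists u => //.
rewrite uE D0_sq !(C (off _)) /D0 !diag_off /off /o' /= -scaleN1r mkZ mkD.
by congr mk; rewrite ?mulr0 ?addr0 //; vprep; field.
Qed.

Lemma derivation_one (u : 'End(J)) : u \in so3 K n -> u 'e = 0.
Proof.
move=> /(so3_derivation n3)[uM _]; have := uM 'e 'e; rewrite !mulE => h.
by apply: (addrI (u 'e)); rewrite addr0 -h.
Qed.

(** A derivation kills I and has traceless values, so if the form T(x, u y) vanishes on V it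
    vanishes on all of J. *)
Lemma so3_nondeg (u : 'End(J)) : u \in so3 K n ->
  (forall x y, x \in V -> y \in V -> T x (u y) = 0) -> u = 0.
Proof.
move=> us h; have [uM ut] := so3_derivation n3 us; have u1 := derivation_one us.
have xE x : x = proj x + (tr x / 3) *: 'e by rewrite (projE n3) subrK.
have uV y : y \in V -> u y = 0.
  move=> yV; apply: (@T_nondeg _ _ A) => x.
  by rewrite TC (xE x) TDl TZl h ?proj_mem // T1l ut mulr0 addr0.
apply/lfunP => y.
have -> : u y = u (proj y) + (tr y / 3) *: u 'e by rewrite {1}(xE y) linearD linearZ.
by rewrite u1 scaler0 addr0 uV ?proj_mem // [RHS]lfunE.
Qed.

(** By [so3_nondeg] no nonzero derivation is annihilated by all bivectors, so [so3_map] has rank at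
    least dim so_3(A). *)
Lemma dim_redU : (\dim (so3 K n) + \dim (redU K n) <= \dim {:ext2 V})%N.
Proof.
have h : (\dim {:subvs_of (so3 K n)} <= \dim (limg (so3_map K n)))%N.
  apply: rank_dual => u h; apply: val_inj; apply: so3_nondeg (subvsP u) _ => x y xV yV.
  by rewrite -(so3_map_wedge n3 _ xV yV).
have := limg_ker_dim (so3_map K n) fullv; rewrite capfv => <-.
rewrite addnC leq_add2l; apply: leq_trans h; by rewrite dimvf.
Qed.

Lemma dim_J30 : (\dim V <= \dim {:offdiag} + 2)%N.
Proof.
pose F (s : (K^o * K^o * offdiag)%type) : J :=
  mk s.1.1 s.1.2 (- s.1.1 - s.1.2) s.2.1.1 s.2.1.2 s.2.2.
have Fl : linear F.
  by move=> c s s'; rewrite /F mk_lin; congr mk; rewrite /= !regular_scale; ring.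
pose G : {linear (K^o * K^o * offdiag)%type -> J} :=
  HB.pack F (GRing.isLinear.Build K _ J *:%R F Fl).
have VG : (V <= limg (linfun G))%VS.
  apply/subvP => x; rewrite (J30E n3); have [a [b [c [u [v [w ->]]]]]] := J3_mk x.
  rewrite [tr _]jtrace_mk => /eqP abc.
  have cE : c = - a - b by apply: subr0_eq; rewrite -[RHS]abc; ring.
  have -> : mk a b c u v w = linfun G (a, b, (u, v, w)) by rewrite lfunE /= /F /= cE.
  by apply: memv_img; apply: memvf.
apply: leq_trans (dimvS VG) _.
have le : (\dim (limg (linfun G)) <= \dim {:(K^o * K^o * offdiag)%type})%N.
  by rewrite -(limg_ker_dim (linfun G) fullv) leq_addl.
by apply: leq_trans le _; rewrite !dimvf addnC.
Qed.

Definition reg_wedge (o : offdiag) : ext2 V := W (D + off o) (proj ((D + off o) ** (D + off o))).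

Lemma D_off_V o : D + off o \in V.
Proof. by rewrite memvD ?D_V // (J30E n3) [tr _]jtrace_mk !addr0. Qed.

Let g := proj (D ** D).

Let gE : g = mk (1 / 3) (- (2 / 3)) (1 / 3) 0 0 0.
Proof.
have -> : g = D ** D - (2 / 3) *: 'e.
  by rewrite /g (projE n3) D0_sq [tr _]jtrace_mk addr0.
rewrite D0_sq [cone _]jone_mk -scaleNr mkZ mkD.
by congr mk; rewrite ?scaler0 ?addr0 //; field.
Qed.

Let g_orth o : T g (D + off o) = 0.
Proof.
by rewrite gE /D0 /off mkD [T _ _]jtrace_jmul_mk !cdformE; field.
Qed.

Lemma zchain_reductions : zchain Y (\dim {:offdiag}).
Proof.
have px : pmap 1 (fun o : offdiag => D + off o).
  have h1 : pmap 1 (fun _ : offdiag => D) := pmap_le (leq0n 1) (@pmap_cst _ _ _ D).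
  exact: pmapD h1 (pmap_linear (off : {linear offdiag -> J})).
have pxx : pmap (1 + 1) (fun o : offdiag => (D + off o) ** (D + off o)) by apply: pmapM.
have pp : pmap (1 + 2) reg_wedge.
  apply: (pmap_bilinear (wedge_linl V) (wedge_linr V)); first exact: px.
  move=> f; exact: (pxx (f \o (proj : {linear J -> J}) : {scalar J})).
have Tl : linear_for *%R (T g) by move=> k x y; rewrite TDr TZr.
pose G : {scalar J} := HB.pack (T g) (GRing.isLinear.Build K J K *%R (T g) Tl).
pose h o := T g (proj ((D + off o) ** (D + off o))).
have hp : pline (1 + 1) h by exact: (pxx (G \o (proj : {linear J -> J}) : {scalar J})).
have o0 : D + off 0 = D by rewrite linear0 addr0.
have h0 : h 0 != 0.
  rewrite /h o0 -/g gE [T _ _]jtrace_jmul_mk !cdformE.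
  rewrite (_ : _ + _ = 2 / 3); last by field.
  by rewrite mulf_neq0 ?invr_eq0 ?pnatr_eq0.
have [n0 _] := disc_reduction (@tr_D0 K n n3) (@disc_D0 K n n3).
have phi0 : reg_wedge 0 != 0 by rewrite /reg_wedge o0.
(* The exterior product of B, a coordinate of the off-diagonal part, and G = T(g, -). As G vanishes
   on D + off o, only one of the two terms remains. At o = 0, h equals T(g, g) = 2/3. *)
have lamP i : exists lam : {scalar ext2 V},
    forall o, lam (reg_wedge o) = coord (vbasis {:offdiag}) i o * h o.
  pose B : {scalar J} := (coord (vbasis {:offdiag}) i : {scalar offdiag}) \o (offpart : {linear J -> offdiag}).
  have [lam lamE] := wedge_form V G B; exists lam => o.
  rewrite /reg_wedge lamE ?D_off_V ?proj_mem //.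
  have Gx : G (D + off o) = 0 := g_orth o.
  have Bx : B (D + off o) = coord (vbasis {:offdiag}) i o.
    by rewrite /B /= /D0 /off mkD !add0r offpart_mk -!surjective_pairing.
  by rewrite Gx Bx mulr0 subr0.
have phiY o : reg_wedge o != 0 -> Y <[reg_wedge o]>%VS.
  by apply: square_reduction => //; apply: D_off_V.
exact: (flag_chain pp hp h0 phi0 lamP (@zclosed_reductions K n n3) phiY).
Qed.

Lemma has_dim_reductions : exists2 d, has_dim Y d & (\dim {:offdiag} <= d)%N.
Proof.
apply: has_dim_ex zchain_reductions _ => d /(zchain_sub (fun l Yl => (reductions_sub n3 Yl).1)).
exact: zchain_grass2.
Qed.

Lemma has_dim_grass2 : exists2 d, has_dim (grass2 V) d & (d <= 2 * \dim {:offdiag})%N.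
Proof.
have c := zchain_sub (fun l Yl => (reductions_sub n3 Yl).1) zchain_reductions.
have [d dG _] := has_dim_ex c (@zchain_grass2 _ _ V).
exists d => //; apply: leq_trans (zchain_grass2 dG.1) _.
by rewrite leq_mul2l /= leq_subLR addnC dim_J30.
Qed.
End Dimensions.

(** * Derivations killing a regular diagonal matrix, for a > 1 *)

Section Stabiliser.
Variables (K : numClosedFieldType) (n' : nat).
Local Notation n := n'.+1.
Variable n3 : (n <= 3)%N.
Local Notation J := (J3 K n).
Local Notation A := (J3_cubic K n3).
Local Notation V := (J30 K n).
Local Notation Y := (reductions K n).
Local Notation W := (wedge V).
Local Notation D := (D0 K n).
Implicit Types (x y z : J).
Local Notation "x ** y" := (cmul A x y) (at level 40, left associativity).
Local Notation "'e" := (cone A).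
Local Notation tr := (ctr A).
Local Notation T := (tform A).
Local Notation proj := (@proj_one K n).
Let C := cmulC A.

Let imag : cd K n := (0, cdone K n').
Let p : J := off3 (cdone K n).
Let q : J := off3 imag.

Let one_imag : cdform (cdone K n) imag = 0.
Proof. by rewrite cdformC /cdform cdconj1 cdmul1r /= raddf0. Qed.

Let imag_imag : cdform imag imag = 1.
Proof.
rewrite /cdform /imag /= raddf0 cdmul0l sub0r [cdconj (- _)]raddfN /= cdmulNl opprK.
by rewrite cdconj1 cdmul1l cdre1.
Qed.

(** The derivation [L_p, L_q] rotates the (0, 1) entry in the plane of 1 and an imaginary unit. It
    kills D because p and q are eigenvectors of L_D for the same eigenvalue 1/2, and u p = - q gives
    T(p, u q) = T(q, q) = 2. *)
Lemma stabiliser_D0 : exists2 u : 'End(J), u \in so3 K n &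
  [/\ u D = 0, exists x y, [/\ x \in V, y \in V & T x (u y) != 0] & u != 0].
Proof.
have [u us uE] := inner_so3 n3 p q; exists u => //.
have Dp w : D ** off3 w = 2^-1 *: off3 w by rewrite /D0 diag_off3 addr0 mul1r.
have qp : q ** p = 0 by rewrite /q /p off3_mul cdformC one_imag mk0.
have pp : p ** p = mk 1 1 0 0 0 0.
  by rewrite /p off3_mul /cdform cdconj1 cdmul1l cdre1.
have up : u p = - q.
  have h2 : (1 + 1) / 2 = 1 :> K by field.
  by rewrite uE qp cmul0r sub0r pp C /q diag_off3 h2 scale1r.
have uq : T p (u q) != 0.
  have := derivation_skew p q (so3_derivation n3 us); rewrite up TNl => /oppr_inj <-.
  by rewrite /q T_off3 imag_imag mulr1 pnatr_eq0.
split=> //.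
- by rewrite uE !(C _ D) !Dp !mulE (C q p) subrr.
- by exists p, q; rewrite !(off3_V n3).
by apply/eqP => u0; move: uq; rewrite u0 lfunE /= T0r eqxx.
Qed.

(** Rank-nullity for the evaluation of derivations at D. *)
Lemma dim_so3 : (\dim {:offdiag K n} < \dim (so3 K n))%N.
Proof.
have [u us [uD _ u0]] := stabiliser_D0.
pose F (v : 'End(J)) : J := v D.
have Fl : linear F by move=> c v v'; rewrite /F add_lfunE scale_lfunE.
pose ev : {linear 'End(J) -> J} := HB.pack F (GRing.isLinear.Build K 'End(J) J *:%R F Fl).
rewrite -(limg_ker_dim (linfun ev) (so3 K n)) -add1n leq_add //.
  rewrite lt0n dimv_eq0; apply/eqP => h; case/eqP: u0; apply/eqP; rewrite -memv0 -h.
  by rewrite memv_cap us memv_ker lfunE /= /F uD.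
have k0 : (lker (linfun (@off K n : {linear offdiag K n -> J})) == 0)%VS.
  rewrite -subv0; apply/subvP => o; rewrite memv_ker lfunE memv0 => /eqP o0.
  by apply/eqP/(can_inj (@offK K n)); rewrite [LHS]o0 linear0.
have := limg_dim_eq; move/(_ _ _ _ (linfun (@off K n : {linear offdiag K n -> J})) fullv).
rewrite (eqP k0) capv0 => /(_ erefl) <-.
apply: dimvS; apply/subvP => _ /memv_imgP[o _ ->]; rewrite lfunE /=.
have [v vs <-] := orbit_D0 n3 o.
by rewrite -[v D]/(ev v) -[ev v]lfunE memv_img.
Qed.

(** As u kills D and D^2, it kills every contraction of w = D /\ g. In the differential at w of a
    Pluecker relation composed with B, every term except w_ij B(t) then vanishes, so B kills the
    tangent space. It also kills U, but not x /\ y. *)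
Lemma not_transverse_redU : ~ transverse (grass2 V) (redU K n).
Proof.
have [u us [uD [x [y [xV yV xy]]] _]] := stabiliser_D0.
have du := so3_derivation n3 us.
pose g := proj (D ** D).
have ug : u g = 0.
  have -> : u g = u (D ** D) - (tr (D ** D) / 3) *: u 'e by rewrite /g (projE n3) linearB linearZ.
  by rewrite du.1 uD cmul0l cmul0r derivation_one // scaler0 subr0 addr0.
have DV : D \in V by apply: D_V.
have gV : g \in V by apply: (proj_mem n3).
have [w0 Yl] := disc_reduction (@tr_D0 K n n3) (@disc_D0 K n n3).
have [Gl Ul] := reductions_sub n3 Yl.
move=> tv; have [t [v [tt vU wE]]] := tv _ Gl Ul (W x y).
pose F (w : ext2 V) : K := so3_map K n w (Subvs us).
have Fl : linear_for *%R F.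
  by move=> c w w'; rewrite /F linearP add_lfunE scale_lfunE.
pose B : {scalar ext2 V} := HB.pack F (GRing.isLinear.Build K (ext2 V) K *%R F Fl).
have BW a b : a \in V -> b \in V -> B (W a b) = T a (u b) by move=> aV bV; exact: so3_map_wedge.
have BU : B v = 0 by move: vU; rewrite memv_ker => /eqP vU; rewrite /B /= /F vU lfunE.
case/eqP: xy; rewrite -BW // wE linearD /= [X in _ + X]BU addr0.
have [r wr] := entry_neq0 w0; rewrite entryP in wr.
set i := (val r).1 in wr; set j := (val r).2 in wr; set w := W D _ in wr tt.
have [f [f2 fE fD]] := plucker_quadric B i j; have fh : homogeneous f by exists 2%N.
have fG m : grass2 V m -> vanishes_at f m.
  move=> /grass2P[a [b [aV bV ab ->]]]; apply/vanishes_line => //.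
  by rewrite fE -wedge_plucker // linearZ subrr.
have := tt f fh fG w (memv_line w); rewrite fD.
have Bw : B w = 0 by rewrite BW // ug T0r.
have uc k : u (contract w k) = 0.
  have -> : u (contract w k) = coord (vbasis V) k D *: u g - coord (vbasis V) k g *: u D.
    by rewrite contract_wedge // linearB !linearZ.
  by rewrite ug uD !scaler0 subr0.
rewrite Bw !BW ?contract_mem // uc T0r mulr0 addr0 subr0.
have := derivation_skew (contract w i) (contract t j) du; rewrite uc T0l => /esym/eqP.
rewrite oppr_eq0 => /eqP ->; rewrite subr0 => /eqP; rewrite mulf_eq0 (negPf wr) /=.
by move/eqP.
Qed.
End Stabiliser.

Theorem proposition3p1 (R : realType) (a n : nat)
    (hn : (n <= 3)%N) (ha : a = (2 ^ n)%N) :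
  let V := J30 R[i] n in
  let U := redU R[i] n in
  let Y := reductions R[i] n in
  let G := grass2 V in
  (forall l : {vspace ext2 V}, Y l <-> G l /\ in_lin U l) /\
  ((1 < a)%N ->
     ~ transverse G U /\
     exists dY dG : nat,
       [/\ has_dim Y dY, has_dim G dG &
           dY%:Z <> dG%:Z - ((\dim {:ext2 V})%:Z - (\dim U)%:Z)]).
Proof.
split=> [l|a1]; first exact: (@reductionsP R[i] n hn).
case: n hn ha => [|n'] n3 aE; first by rewrite aE in a1.
split; first exact: (@not_transverse_redU R[i] n' n3).
have [dY hY leY] := @has_dim_reductions R[i] n'.+1 n3; have [dG hG leG] := @has_dim_grass2 R[i] n'.+1 n3.
exists dY, dG; split=> // e.
have := @dim_redU R[i] n'.+1 n3; rewrite -(leq_add2l (\dim {:offdiag R[i] n'.+1})).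
have := @dim_so3 R[i] n' n3; move: e leY leG.
move: (\dim (so3 _ _)) (\dim (redU _ _)) (\dim {:ext2 _}) (\dim {:offdiag _ _}) => s r v o.
(* With o = 3a and s = dim so_3(A), the expected dimension is at most 2o - s < o <= dim Y. *)
lia.
Qed.
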